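(* Let $X$ be a non-negative continuous random variable with density $f$ such that: (i) $f(t) \le C e^{-\lambda t}$ for all $t \ge 0$, for some constants $C,\lambda>0$; (ii) the support of $f$ can be partitioned into finitely many intervals, on each of which $f$ is differentiable and monotone (non-decreasing or non-increasing); (iii) there exist $C', \epsilon_0>0$ such that $x \le C'\,\mathbb{E}[X_{\le x}]$ for all $x \in (\chi_{\min}, \chi_{\min}+\epsilon_0)$. For every $n \ge 1$, let $x_1,\ldots,x_n$ be independent samples of $X$, considered as the weights of a weighted voting game with $n$ agents, and let $\varphi_{\max}(Q)$ (resp. $\varphi_{\min}(Q)$) denote the Shapley value, at quota $Q$, of the agent with the largest (resp. smallest) weight. Then for every $\epsilon>0$ there exists $\xi<1$ (and an implied constant, depending on $X$ and $\epsilon$ but not on $n$ or $Q$) such that: for all $n$ and all $Q \in [n^{1/4}, (1-\epsilon)\, n\,\mathbb{E}[X]]$, \[ \mathbb{E}[\varphi_{\max}(Q)] = \frac{1}{n}\, \mathbb{E}_{x \sim X^n_{\max}}\Big[\frac{x}{\mathbb{E}[X_{\le x}]}\Big] \pm O(\xi^{n^{1/4}}), \] and for all $n$ and all $Q \in [n^{1/4}, (n-n^{2/3})\,\mathbb{E}[X]]$, \[ \mathbb{E}[\varphi_{\min}(Q)] = \frac{1}{n}\, \mathbb{E}_{x \sim X^n_{\min}}\Big[\frac{x}{\mathbb{E}[X_{\ge x}]}\Big] \pm O(\xi^{n^{1/4}}). \] The outer expectations on the left are over the random weights.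
   Context: Weighted voting game: agents $1,\ldots,n$ with non-negative weights $w_1,\ldots,w_n$ and a quota $Q \ge 0$. The Shapley value of agent $i$ at quota $Q$ is $\varphi_i(Q) = \Pr_{\pi}\big[Q - w_i \le \sum_{j \text{ precedes } i \text{ in } \pi} w_j < Q\big]$, where $\pi$ is a uniformly random ordering of the $n$ agents. For a random variable $Z$ and real $t$, $Z_{\le t}$ denotes $Z$ conditioned on $Z \le t$ and $Z_{\ge t}$ denotes $Z$ conditioned on $Z \ge t$. $Z^n_{\max}$ (resp. $Z^n_{\min}$) denotes the maximum (resp. minimum) of $n$ independent copies of $Z$. $\chi_{\min} = \inf\{x : \Pr[X \ge x]>0\}$.
   Formalization: The definition of χ_min is corrected to inf{x : Pr[X ≤ x] > 0}; as written, with Pr[X ≥ x], the infimum is −∞ for a non-negative X and condition (iii) has no meaning. *)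

(* Defs.v *)
From HB Require Import structures.
From mathcomp Require Import all_boot all_order all_algebra all_fingroup.
From mathcomp Require Import all_classical all_reals all_analysis.
Set Implicit Arguments. Unset Strict Implicit. Unset Printing Implicit Defensive.
Import Order.TTheory GRing.Theory Num.Theory.
Import numFieldNormedType.Exports.
Local Open Scope classical_set_scope.
Local Open Scope ring_scope.

Section Defs.
Variable R : realType.
Notation leb := (@lebesgue_measure R).

(** Shapley value of agent i at quota Q in the weighted voting game with
    weights w : a uniformly random ordering is a uniform s : 'S_n, agent j
    precedes agent i iff s j < s i. *)
Definition pred_weight n (w : 'I_n -> R) (s : 'S_n) (i : 'I_n) : R :=
  \sum_(j | (s j < s i)%N) w j.

Definition shapley n (w : 'I_n -> R) (i : 'I_n) (Q : R) : R :=
  (#|[set s : 'S_n | (Q - w i <= pred_weight w s i) && (pred_weight w s i < Q)]|%:R)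
  / (n`!)%:R.

(** agent with largest / smallest weight (n.+1 >= 1 agents; ties broken
    arbitrarily, they have probability 0) *)
Definition argmax_agent n (w : 'I_n.+1 -> R) : 'I_n.+1 := Order.arg_max ord0 xpredT w.
Definition argmin_agent n (w : 'I_n.+1 -> R) : 'I_n.+1 := Order.arg_min ord0 xpredT w.

Definition cdf (f : R -> R) (x : R) : R :=
  fine (\int[leb]_(t in `]-oo, x]) (f t)%:E)%E.
Definition sf (f : R -> R) (x : R) : R :=
  fine (\int[leb]_(t in `[x, +oo[) (f t)%:E)%E.
Definition mean (f : R -> R) : R :=
  fine (\int[leb]_t (t * f t)%:E)%E.
Definition cond_mean_le (f : R -> R) (x : R) : R :=
  fine (\int[leb]_(t in `]-oo, x]) (t * f t)%:E)%E / cdf f x.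
Definition cond_mean_ge (f : R -> R) (x : R) : R :=
  fine (\int[leb]_(t in `[x, +oo[) (t * f t)%:E)%E / sf f x.
Definition chi_min (f : R -> R) : R := inf [set x | 0 < cdf f x].

Definition nonneg_density (f : R -> R) : Prop :=
  [/\ measurable_fun setT f, (forall t, 0 <= f t),
      (\int[leb]_t (f t)%:E = 1)%E &
      (\int[leb]_(t in `]-oo, (0%R : R)[) (f t)%:E = 0)%E].

Definition piecewise_diff_monotone (f : R -> R) : Prop :=
  exists (k : nat) (I : 'I_k -> interval R),
    (forall j j', j != j' -> [set x | x \in I j] `&` [set x | x \in I j'] = set0)
    /\ (\bigcup_(j in setT) [set x | x \in I j]) = [set t | 0 < f t]
    /\ (forall j,
          (forall t, (exists2 e : R, 0 < e & ball t e `<=` [set x | x \in I j]) ->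
                     derivable f t 1)
          /\ ({in I j &, {homo f : x y / x <= y}}
              \/ {in I j &, {homo f : x y / x <= y >-> y <= x}})).

Definition iid_with_density d (T : measurableType d) (P : probability T R)
    n (X : 'I_n -> T -> R) (f : R -> R) : Prop :=
  [/\ (forall i, measurable_fun setT (X i)),
      (forall i (B : set R), measurable B ->
          P (X i @^-1` B) = (\int[leb]_(t in B) (f t)%:E)%E) &
      (forall B : 'I_n -> set R, (forall i, measurable (B i)) ->
          P (\bigcap_(i in setT) (X i @^-1` B i)) = (\prod_(i < n) P (X i @^-1` B i))%E)].

Definition Ex d (T : measurableType d) (P : probability T R) (g : T -> R) : R :=
  fine (\int[P]_w (g w)%:E)%E.

End Defs.

(* Main.v *)
(** Condition on the weight [x] of the extremal agent. The other [n - 1] weights become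
independent with law [X | X <= x] (or [X | X >= x]), and the position of the agent in the
ordering is uniform: its expected Shapley value is [1/n] times the expected number of points
of an [n]-step random walk in the window [[Q - x, Q[]. Without the restriction to [n] steps,
the renewal theorem gives [x] divided by the mean of the step, with an error decaying
exponentially in [Q]; Chernoff's bound shows that the missing steps do not matter.

The renewal theorem is needed uniformly in [x]. Write [T] for convolution with the step law and
[D] for convolution with its tail. The deviation [y] of the renewal count from its limit
satisfies [y = T^m y] and [D y = 0] up to small terms, hence [y = (T^m - e D') y] up to small
terms, where [D'] is [D] truncated and delayed. As the step law dominates a multiple of
Lebesgue measure on an interval, [T^m - e D'] is still positive for suitable [m] and [e]; it
contracts the sup norm with weight [expR (c t)], and [y] is therefore [O(expR (- c t))].

Values of [x] for which these bounds are not uniform ([x] small for the maximum, large for the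
minimum) have exponentially small probability, and there (iii) bounds [x / E[X | X <= x]]. *)

Require Import Defs.
From HB Require Import structures.
From mathcomp Require Import all_boot all_order all_algebra all_fingroup.
From mathcomp Require Import all_classical all_reals all_analysis.
From mathcomp Require Import measurable_realfun ring lra.
Set Implicit Arguments.
Unset Strict Implicit.
Unset Printing Implicit Defensive.
Import Order.TTheory GRing.Theory Num.Theory.
Import numFieldNormedType.Exports.
Local Open Scope classical_set_scope.
Local Open Scope ring_scope.

(** * Bounded measurable functions *)

(** [T] fixes constants, so [y = T^m y] alone cannot force decay. [D] multiplies a constant by the
    mean [mu] of the step, and subtracting [e D'] lowers the total mass to about [1 - e mu].
    [D y = 0] comes from a telescoping of antiderivatives of windows, which is also what identifies
    the limit [x / mu]. Positivity requires [T^m] to have density at least [e] on the whole window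
    used by [D'], whence the delay and the truncation; both are chosen before the rate [c], which
    must be small in terms of them. All constants depend on the step law only through [delta], [a],
    [b], [lam] and a bound [M] on an exponential moment. These survive conditioning on an event that
    contains [[a, b]] and has probability bounded below, up to a factor in [M]. Hypothesis (ii)
    provides the interval [[a, b]], and (i) the exponential moment. For the minimum, the quota
    leaves a deficit of order [n^(2/3)], for which Chernoff's bound is [expR (- r n^(1/3))]; the
    exponent [1/4] of the theorem is imposed by the term [expR (- c Q)] at the smallest quotas. *)

Ltac nonneg := repeat first
  [ done | by apply: ltW | exact: expR_ge0 | exact: normr_ge0 | exact: ler0n
  | apply: addr_ge0 | apply: mulr_ge0 | apply: exprn_ge0 | rewrite invr_ge0 ].

Section bounded_measurable.
Context {R : realType}.
Implicit Types h g : R -> R.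

(** Boundedness holds everywhere rather than almost everywhere, so that one class serves both for
    Lebesgue measure on bounded intervals and for every step law. *)
Definition bmeas h : Prop :=
  measurable_fun [set: R] h /\ exists M : R, forall t, `|h t| <= M.

Lemma bmeas_measurable {h} : bmeas h -> measurable_fun [set: R] h.
Proof. by case. Qed.

Lemma bmeas_cst c : bmeas (fun=> c).
Proof. by split; [exact: measurable_cst|exists `|c|]. Qed.

Lemma bmeasD {h g} : bmeas h -> bmeas g -> bmeas (fun t => h t + g t).
Proof.
move=> [mh [M hM]] [mg [N gN]]; split; first exact: measurable_funD.
by exists (M + N) => t; rewrite (le_trans (ler_normD _ _))// lerD.
Qed.

Lemma bmeasZ {h} c : bmeas h -> bmeas (fun t => c * h t).
Proof.
move=> [mh [M hM]]; split; first exact: measurable_funM.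
by exists (`|c| * M) => t; rewrite normrM ler_wpM2l.
Qed.

Lemma bmeasB {h g} : bmeas h -> bmeas g -> bmeas (fun t => h t - g t).
Proof.
move=> bh /(bmeasZ (-1)) bg; have := bmeasD bh bg.
by congr bmeas; apply/funext => t; rewrite mulN1r.
Qed.

Lemma bmeas_sum I (s : seq I) (P : pred I) (h : I -> R -> R) :
  (forall i, bmeas (h i)) -> bmeas (fun t => \sum_(i <- s | P i) h i t).
Proof.
move=> bh; elim: s => [|i s IH].
  under eq_fun do rewrite big_nil. exact: bmeas_cst.
under eq_fun do rewrite big_cons.
by case: (P i) => //; exact: bmeasD.
Qed.

Lemma bmeas_comp {h} (u : R -> R) : measurable_fun [set: R] u -> bmeas h ->
  bmeas (fun s => h (u s)).
Proof.
move=> mu [mh [M hM]]; split; first exact: measurableT_comp.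
by exists M.
Qed.

Lemma measurable_rsub (t : R) : measurable_fun [set: R] (fun s : R => t - s).
Proof. exact: measurable_funB. Qed.

Lemma bmeas_shift {h} t : bmeas h -> bmeas (fun s => h (t - s)).
Proof. by apply: bmeas_comp; exact: measurable_rsub. Qed.

Lemma bmeas_indic (A : set R) : measurable A -> bmeas \1_A.
Proof.
move=> mA; split; first exact: measurable_indic.
by exists 1 => t; rewrite indicE; case: (_ \in _); rewrite ?normr1 ?normr0.
Qed.

Lemma bmeas_bounded {h} (D : set R) : bmeas h -> [bounded h x | x in D].
Proof.
move=> [mh [M hM]]; exists M; split; first exact: num_real.
move=> x Mx t _; exact: le_trans (hM t) (ltW Mx).
Qed.

Lemma bmeas_integrable {mu : {measure set R -> \bar R}} {D : set R} {h} :
  measurable D -> (mu D < +oo)%E -> bmeas h -> mu.-integrable D (EFin \o h).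
Proof.
move=> mD muD bh; apply: measurable_bounded_integrable => //.
  exact: measurable_funTS (bmeas_measurable bh).
exact: bmeas_bounded.
Qed.

End bounded_measurable.

(** * Integrals over bounded intervals *)

Section interval_integral.
Context {R : realType}.
Notation leb := (@lebesgue_measure R).
Implicit Types h g : R -> R.

(** Unlike an oriented integral, it is 0 when [t < u]; additivity therefore needs ordered
    endpoints. *)
Definition Iint h (u t : R) : R := \int[leb]_(s in `[u, t]) h s.

Lemma itv_measure_lty (u t : R) : (leb `[u, t]%classic < +oo)%E.
Proof. by rewrite lebesgue_measure_itv/=; case: ifP => _; rewrite ?ltry. Qed.

Lemma bmeas_leb_integrable {h} (u t : R) : bmeas h ->
  leb.-integrable `[u, t]%classic (EFin \o h).
Proof. move=> bh; apply: measurable_bounded_integrable => //.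
- exact: itv_measure_lty.
- exact: measurable_funTS (bmeas_measurable bh).
- exact: bmeas_bounded. Qed.

Lemma IintD h g u t : bmeas h -> bmeas g ->
  Iint (fun s => h s + g s) u t = Iint h u t + Iint g u t.
Proof. by move=> bh bg; rewrite /Iint RintegralD//; exact: bmeas_leb_integrable. Qed.

Lemma IintB h g u t : bmeas h -> bmeas g ->
  Iint (fun s => h s - g s) u t = Iint h u t - Iint g u t.
Proof. by move=> bh bg; rewrite /Iint RintegralB//; exact: bmeas_leb_integrable. Qed.

Lemma IintZ c h u t : bmeas h ->
  Iint (fun s => c * h s) u t = c * Iint h u t.
Proof. by move=> bh; rewrite /Iint RintegralZl//; exact: bmeas_leb_integrable. Qed.

Lemma Iint_cst c u t : u <= t -> Iint (fun=> c) u t = c * (t - u).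
Proof.
move=> ut; rewrite /Iint Rintegral_cst//= lebesgue_measure_itv/= lte_fin.
case: ltP => //= tu; have -> : t = u by apply/le_anti; rewrite ut tu.
by rewrite subrr.
Qed.

Lemma Iint_ge h u t : u > t -> Iint h u t = 0.
Proof. by move=> ut; rewrite /Iint set_itv_ge ?Rintegral_set0// bnd_simp -ltNge. Qed.

Lemma le_Iint h g u t : bmeas h -> bmeas g ->
  (forall s, u <= s <= t -> h s <= g s) -> Iint h u t <= Iint g u t.
Proof.
move=> bh bg hg; apply: le_Rintegral => //; [exact: bmeas_leb_integrable|exact: bmeas_leb_integrable].
Qed.

Lemma Iint_ge0 h u t : (forall s, u <= s <= t -> 0 <= h s) -> 0 <= Iint h u t.
Proof.
by move=> h0; apply: Rintegral_ge0 => s; rewrite /= in_itv/=; exact: h0.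
Qed.

Lemma Iint_split h u v t : bmeas h -> u <= v -> v <= t ->
  Iint h u t = Iint h u v + Iint h v t.
Proof.
move=> bh uv vt; have it := bmeas_leb_integrable u t bh.
have := Rintegral_itvB (x := v) it; rewrite !bnd_simp => /(_ uv vt) E.
rewrite /Iint -(subrK (\int[leb]_(s in `[u, v]) h s) (\int[leb]_(s in `[u, t]) h s)).
rewrite E addrC; congr (_ + _).
rewrite Rintegral_itv_obnd_cbnd//.
apply: integrableS (bmeas_leb_integrable v t bh) => //.
by apply: subset_itvr; rewrite bnd_simp.
Qed.

Lemma Iint_sub h u v w t : bmeas h -> u <= v -> v <= w -> w <= t ->
  (forall s, u <= s <= t -> 0 <= h s) -> Iint h v w <= Iint h u t.
Proof.
move=> bh uv vw wt h0.
rewrite (Iint_split bh uv (le_trans vw wt)).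
rewrite (Iint_split bh vw wt) addrCA lerDl addr_ge0// Iint_ge0// => s /andP[s1 s2];
  apply: h0.
  by rewrite s1/= (le_trans s2)// (le_trans vw).
by rewrite s2 andbT (le_trans uv)// (le_trans vw).
Qed.

(** A measure agreeing with length on half-open intervals is Lebesgue measure, and the preimage of
    []a, b]] is [[c - b, c - a[], of the same length. *)
Lemma lebesgue_measure_reflect (c : R) (A : set R) : measurable A ->
  pushforward leb (fun s : measurableTypeR R => (c - s)%R : measurableTypeR R) A = leb A.
Proof.
move=> mA.
have mf : measurable_fun [set: measurableTypeR R] (fun s : measurableTypeR R => (c - s)%R : measurableTypeR R)
  by exact: measurable_rsub.
apply/esym/(@lebesgue_measure_unique _
   (pushforward leb (fun s : measurableTypeR R => (c - s)%R : measurableTypeR R))) => //= _ [[a b]] _ <-.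
rewrite /pushforward.
have -> : (fun s : R => c - s) @^-1` `]a, b] = `[c - b, c - a[%classic.
  by apply/seteqP; split => s /=; rewrite !in_itv/=; lra.
rewrite !lebesgue_measure_itv/= !lte_fin.
have -> : (c - b < c - a) = (a < b) by apply/idP/idP; lra.
by case: ifP => // _; rewrite -!EFinD; congr EFin; ring.
Qed.

Lemma Iint_reflect h c a b : bmeas h ->
  Iint (fun s => h (c - s)) a b = Iint h (c - b) (c - a).
Proof.
move=> bh; rewrite /Iint /Rintegral; congr fine.
have mf : measurable_fun [set: measurableTypeR R] (fun s : measurableTypeR R => (c - s)%R : measurableTypeR R)
  by exact: measurable_rsub.
have E : `[a, b]%classic = (fun s : measurableTypeR R => (c - s)%R : measurableTypeR R) @^-1` `[c - b, c - a].
  by apply/seteqP; split => s /=; rewrite !in_itv/=; lra.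
have ih := bmeas_leb_integrable a b (bmeas_shift c bh).
rewrite {1}E in ih *.
have mh : measurable_fun [set: measurableTypeR R] (EFin \o h).
  by apply/measurable_EFinP; case: bh.
transitivity (\int[pushforward leb (fun s : measurableTypeR R => (c - s)%R : measurableTypeR R)]_(x in `[(c - b)%R, (c - a)%R])
   (h x)%:E)%E.
  by rewrite [RHS](integral_pushforward mf mh ih) // E.
by apply: eq_measure_integral => A mA _; exact: lebesgue_measure_reflect.
Qed.

(** A translation is the composite of two reflections. *)
Lemma Iint_translate h c a b : bmeas h ->
  Iint (fun s => h (s - c)) a b = Iint h (a - c) (b - c).
Proof.
move=> bh; have bk : bmeas (fun y => h (0 - y)) by exact: bmeas_shift.
have := Iint_reflect c a b bk.
rewrite (_ : (fun s => h (0 - (c - s))) = (fun s => h (s - c))); last first.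
  by apply/funext => s; congr h; lra.
by move=> ->; rewrite Iint_reflect// !sub0r !opprB.
Qed.

Lemma Iint_lookback_homo {h} t : bmeas h -> (forall s, 0 <= h s) ->
  {homo (fun v => Iint h (t - v) t) : v w / v <= w}.
Proof.
move=> bh h0 v w vw; have [v0|v0] := ltP v 0.
  by rewrite [leLHS]Iint_ge; [apply: Iint_ge0 => *|lra].
by apply: Iint_sub => //; lra.
Qed.

(** For a nonnegative integrand the integral is monotone in [v], hence measurable. Adding the bound
    [M] to [h] reduces to that case; the correction [M * Num.max v 0] takes the empty intervals into
    account. *)
Lemma measurable_Iint_lookback h t : bmeas h ->
  measurable_fun [set: R] (fun v => Iint h (t - v) t).
Proof.
move=> bh; have [mh [M hM]] := bh.
have bp : bmeas (fun s => h s + M) by apply: bmeasD => //; exact: bmeas_cst.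
have p0 s : 0 <= h s + M.
  by have := hM s; rewrite ler_norml => /andP[]; rewrite lerNl; lra.
have -> : (fun v => Iint h (t - v) t) =
  (fun v => Iint (fun s => h s + M) (t - v) t - M * Num.max v 0).
  apply/funext => v; rewrite IintD//; last exact: bmeas_cst.
  case: (ltP v 0) => v0; first by rewrite !Iint_ge ?mulr0; lra.
  by rewrite Iint_cst; [lra|lra].
apply: measurable_funB.
  by apply: nondecreasing_measurable => //; exact: Iint_lookback_homo.
by apply: measurable_funM => //; exact: measurable_maxr.
Qed.

Lemma Iint_norm h M u t : bmeas h -> u <= t ->
  (forall s, u <= s <= t -> `|h s| <= M) -> `|Iint h u t| <= M * (t - u).
Proof.
move=> bh ut hM; rewrite ler_norml; apply/andP; split.
  rewrite -mulNr -Iint_cst//; apply: le_Iint => //; first exact: bmeas_cst.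
  by move=> s /hM; rewrite ler_norml => /andP[].
rewrite -Iint_cst//; apply: le_Iint => //; first exact: bmeas_cst.
by move=> s /hM; rewrite ler_norml => /andP[].
Qed.

End interval_integral.

(** * The renewal operator *)

Section renewal_operator.
Context {R : realType}.
Notation leb := (@lebesgue_measure R).
Variable nu : probability R R.
Hypothesis nu_nneg : nu `[0, +oo[%classic = 1%E.
Implicit Types h g : R -> R.

(** Integrating over the half-line makes [Top h t] depend only on the values of [h] up to [t], so
    that all estimates below can be restricted to times at most [Q]. *)
Definition Enu h : R := \int[nu]_(s in `[0, +oo[) h s.

Definition Top h (t : R) : R := Enu (fun s => h (t - s)).

Definition nu_integrable h : Prop := nu.-integrable `[0, +oo[%classic (EFin \o h).

Lemma bmeas_nu_integrable h : bmeas h -> nu_integrable h.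
Proof. by apply: bmeas_integrable => //; rewrite [X in (X < _)%E]nu_nneg ltry. Qed.

Lemma Enu_cst c : Enu (fun=> c) = c.
Proof. by rewrite /Enu Rintegral_cst//= [X in fine X]nu_nneg mulr1. Qed.

Lemma EnuD h g : nu_integrable h -> nu_integrable g ->
  Enu (fun s => h s + g s) = Enu h + Enu g.
Proof. by move=> ih ig; rewrite /Enu RintegralD. Qed.

Lemma EnuB h g : nu_integrable h -> nu_integrable g ->
  Enu (fun s => h s - g s) = Enu h - Enu g.
Proof. by move=> ih ig; rewrite /Enu RintegralB. Qed.

Lemma EnuZ c h : nu_integrable h -> Enu (fun s => c * h s) = c * Enu h.
Proof. by move=> ih; rewrite /Enu RintegralZl. Qed.

Lemma le_Enu h g : nu_integrable h -> nu_integrable g ->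
  (forall s, 0 <= s -> h s <= g s) -> Enu h <= Enu g.
Proof.
move=> ih ig hg; apply: le_Rintegral => //= s.
by rewrite in_itv/= andbT; exact: hg.
Qed.

Lemma eq_Enu h g : (forall s, 0 <= s -> h s = g s) -> Enu h = Enu g.
Proof.
move=> hg; apply: eq_Rintegral => s; rewrite inE/= in_itv/= andbT; exact: hg.
Qed.

Lemma Enu_ge0 h : (forall s, 0 <= s -> 0 <= h s) -> 0 <= Enu h.
Proof. by move=> h0; apply: Rintegral_ge0 => s; rewrite /= in_itv/= andbT; exact: h0. Qed.

Lemma nu_integrable_le h g : measurable_fun [set: R] h ->
  nu_integrable g -> (forall s, 0 <= s -> `|h s| <= g s) -> nu_integrable h.
Proof.
move=> mh ig hg; apply: le_integrable ig => //.
  by apply/measurable_EFinP; exact: measurable_funTS.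
move=> s /=; rewrite in_itv/= andbT => /hg sg.
by rewrite lee_fin (le_trans sg)// ler_norm.
Qed.

Lemma nu_integrableD h g : nu_integrable h -> nu_integrable g ->
  nu_integrable (fun s => h s + g s).
Proof. by move=> ih ig; have := integrableD _ ih ig; apply. Qed.

Lemma nu_integrableZ c h : nu_integrable h -> nu_integrable (fun s => c * h s).
Proof. by move=> ih; have := integrableZl _ c ih; apply. Qed.

Lemma nu_integrable_cst c : nu_integrable (fun=> c).
Proof. exact/bmeas_nu_integrable/bmeas_cst. Qed.

Lemma Top_cst c t : Top (fun=> c) t = c.
Proof. exact: Enu_cst. Qed.

Lemma bmeas_shift_integrable h t : bmeas h -> nu_integrable (fun s => h (t - s)).
Proof. by move=> bh; exact/bmeas_nu_integrable/bmeas_shift. Qed.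

Lemma TopD h g t : bmeas h -> bmeas g ->
  Top (fun s => h s + g s) t = Top h t + Top g t.
Proof. by move=> bh bg; rewrite /Top EnuD//; exact: bmeas_shift_integrable. Qed.

Lemma TopB h g t : bmeas h -> bmeas g ->
  Top (fun s => h s - g s) t = Top h t - Top g t.
Proof. by move=> bh bg; rewrite /Top EnuB//; exact: bmeas_shift_integrable. Qed.

Lemma TopZ c h t : bmeas h -> Top (fun s => c * h s) t = c * Top h t.
Proof. by move=> bh; rewrite /Top EnuZ//; exact: bmeas_shift_integrable. Qed.

Lemma le_Top h g t : bmeas h -> bmeas g ->
  (forall s, s <= t -> h s <= g s) -> Top h t <= Top g t.
Proof.
move=> bh bg hg; apply: le_Enu; [exact: bmeas_shift_integrable..|].
by move=> s s0; apply: hg; lra.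
Qed.

Lemma eq_Top h g t : (forall s, s <= t -> h s = g s) -> Top h t = Top g t.
Proof. by move=> hg; apply: eq_Enu => s s0; apply: hg; lra. Qed.

Lemma measurable_fun_diff h : measurable_fun [set: R] h ->
  measurable_fun [set: R * R] (fun z : R * R => h (z.1 - z.2)).
Proof.
move=> mh; apply: measurableT_comp => //.
by apply: measurable_funB; [exact: measurable_fst|exact: measurable_snd].
Qed.

Lemma measurable_indic_comp d (T : measurableType d) (v : T -> R) (A : set R) :
  measurable A -> measurable_fun [set: T] v ->
  measurable_fun [set: T] (fun z => \1_A (v z) : R).
Proof.
move=> mA mv; have mi : measurable_fun [set: R] (\1_A : R -> R) by exact: measurable_indic.
by have := measurableT_comp mi mv.
Qed.

Lemma bmeas_Top h : bmeas h -> bmeas (Top h).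
Proof.
move=> bh; have [mh [M hM]] := bh; split.
  have p0 s : 0 <= h s + M by have := hM s; rewrite ler_norml; lra.
  pose f (z : R * R) : \bar R := ((h (z.1 - z.2) + M) * \1_(`[0, +oo[%classic) z.2)%:E.
  have f0 z : (0 <= f z)%E by rewrite lee_fin mulr_ge0// indicE.
  have mf : measurable_fun [set: R * R] f.
    apply/measurable_EFinP; apply: measurable_funM.
      by apply: measurable_funD => //; exact: measurable_fun_diff.
    by apply: measurable_indic_comp => //; exact: measurable_snd.
  have mF := @measurable_fun_fubini_tonelli_F _ _ R R R nu f mf f0.
  have -> : Top h = (fun t => fine (fubini_F nu f t) - M).
    apply/funext => t; rewrite -[LHS](addrK M); congr (_ - _).
    rewrite -[X in _ + X](Enu_cst M) /Top -EnuD; [|exact: bmeas_shift_integrable|exact: nu_integrable_cst].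
    rewrite /Enu /Rintegral /fubini_F; congr fine; rewrite integral_mkcond.
    apply: eq_integral => s _; rewrite /f/= patchE indicE.
    by case: ifPn => _; rewrite ?mulr1 ?mulr0.
  by apply: measurable_funB => //; exact: measurableT_comp.
exists M => t; rewrite ler_norml; apply/andP; split.
  rewrite -(Top_cst (- M) t); apply: le_Top => //; first exact: bmeas_cst.
  by move=> s _; have := hM s; rewrite ler_norml => /andP[].
rewrite -(Top_cst M t); apply: le_Top => //; first exact: bmeas_cst.
by move=> s _; have := hM s; rewrite ler_norml => /andP[].
Qed.

Lemma bmeas_iter_Top h k : bmeas h -> bmeas (iter k Top h).
Proof. by move=> bh; elim: k => //= k; exact: bmeas_Top. Qed.

Lemma iter_TopB k h g t : bmeas h -> bmeas g ->
  iter k Top (fun s => h s - g s) t = iter k Top h t - iter k Top g t.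
Proof.
move=> bh bg; elim: k t => [//|k IH] t /=.
rewrite -TopB; [|exact: bmeas_iter_Top..].
by apply: eq_Enu => s _; exact: IH.
Qed.

(* Fubini, applied to the antiderivative of a bounded function. *)
Lemma antiderivative_Top h H : bmeas h -> bmeas H ->
  (forall u t, u <= t -> Iint h u t = H t - H u) ->
  forall u t, u <= t -> Iint (Top h) u t = Top H t - Top H u.
Proof.
move=> bh bH hH u t ut; have [mh [M hM]] := bh.
have p0 s : 0 <= h s + M by have := hM s; rewrite ler_norml; lra.
have bp : bmeas (fun s => h s + M) by apply: bmeasD => //; exact: bmeas_cst.
have bT := bmeas_Top bh.
pose f (z : measurableTypeR R * R) : \bar R :=
  ((h (z.1 - z.2)%R + M) * \1_(`[u, t]%classic) z.1 * \1_(`[0, +oo[%classic) z.2)%:E.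
have f0 z : (0 <= f z)%E by rewrite lee_fin !mulr_ge0// indicE.
have mf : measurable_fun [set: measurableTypeR R * R] f.
  apply/measurable_EFinP; apply: measurable_funM; first apply: measurable_funM.
  - by apply: measurable_funD => //; exact: measurable_fun_diff.
  - by apply: measurable_indic_comp => //; exact: measurable_fst.
  - by apply: measurable_indic_comp => //; exact: measurable_snd.
have := @fubini_tonelli _ _ (measurableTypeR R) R R leb nu f mf f0.
have -> : (\int[leb]_x \int[nu]_s f (x, s) = (Iint (Top h) u t + M * (t - u))%:E)%E.
  rewrite -(Iint_cst M ut) -IintD//; last exact: bmeas_cst.
  rewrite /Iint /Rintegral fineK; last first.
    apply: integrable_fin_num => //; apply: bmeas_leb_integrable.
    by apply: bmeasD => //; exact: bmeas_cst.
  rewrite integral_mkcond; apply: eq_integral => x _; rewrite patchE.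
  rewrite /f/= indicE; case: (x \in _); last first.
    by under eq_integral do rewrite mulr0 mul0r; rewrite integral0.
  rewrite -[X in _ + X](Enu_cst M) /Top -EnuD; [|exact: bmeas_shift_integrable|exact: nu_integrable_cst].
  rewrite /Enu /Rintegral fineK; last first.
    by apply: integrable_fin_num => //; have := bmeas_shift_integrable x bp; apply.
  rewrite integral_mkcond; apply: eq_integral => s _; rewrite patchE mulr1 indicE.
  by case: (s \in _); rewrite ?mulr1 ?mulr0.
have bD : bmeas (fun s => H (t - s) - H (u - s)) by apply: bmeasB; exact: bmeas_shift.
have -> : (\int[nu]_s \int[leb]_x f (x, s) = (Top H t - Top H u + M * (t - u))%:E)%E.
  rewrite /Top -EnuB; [|exact: bmeas_shift_integrable..].
  rewrite -(Enu_cst (M * (t - u))) -EnuD; [|exact: bmeas_nu_integrable|exact: nu_integrable_cst].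
  rewrite /Enu /Rintegral fineK; last first.
    apply: integrable_fin_num => //; apply: bmeas_nu_integrable.
    by apply: bmeasD => //; exact: bmeas_cst.
  rewrite integral_mkcond; apply: eq_integral => s _; rewrite patchE.
  rewrite /f/= [\1_(`[0, +oo[%classic) s]indicE; case: (s \in _); last first.
    by under eq_integral do rewrite mulr0; rewrite integral0.
  have bhs : bmeas (fun x => h (x - s)) by apply: bmeas_comp => //; exact: measurable_funB.
  rewrite -hH ?lerD2r// -Iint_translate// -(Iint_cst M ut) -IintD//; last exact: bmeas_cst.
  rewrite /Iint /Rintegral fineK; last first.
    apply: integrable_fin_num => //; apply: bmeas_leb_integrable.
    by apply: bmeasD => //; exact: bmeas_cst.
  rewrite integral_mkcond; apply: eq_integral => x _; rewrite patchE mulr1 indicE.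
  by case: (x \in _); rewrite ?mulr1 ?mulr0.
by move=> [] /addIr.
Qed.

End renewal_operator.


(** * Lower bounds for iterated convolutions *)

Section renewal_contraction.
Context {R : realType}.
Variable nu : probability R R.
Implicit Types (h g y : R -> R) (c t K : R).

(* The second condition says that [nu] dominates [delta] times Lebesgue measure on [[a, b]]. *)
Definition renewal_law (delta a b lam M : R) : Prop :=
  [/\ nu `[0, +oo[%classic = 1%E,
      (forall h t, bmeas h -> (forall s, s <= t -> 0 <= h s) ->
         delta * Iint h (t - b) (t - a) <= Top nu h t),
      nu_integrable nu (fun s => expR (lam * s)) &
      Enu nu (fun s => expR (lam * s)) <= M].

Lemma iter_Top_ge0 k h t : (forall s, s <= t -> 0 <= h s) ->
  forall s, s <= t -> 0 <= iter k (Top nu) h s.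
Proof.
move=> h0; elim: k => //= k IH s st; apply: Enu_ge0 => r r0; apply: IH; lra.
Qed.

Section minorization.
Variables (delta a b eta : R).
Hypothesis delta_ge0 : 0 <= delta.
Hypothesis ab : a < b.
Hypothesis a_ge0 : 0 <= a.
Hypothesis nu_nneg : nu `[0, +oo[%classic = 1%E.
Hypothesis nu_minor : forall h t, bmeas h -> (forall s, s <= t -> 0 <= h s) ->
  delta * Iint h (t - b) (t - a) <= Top nu h t.
Hypothesis eta4 : eta * 4 = b - a.

(* Two overlapping strips, of width eta at either end of [a, b], are enough to
   cover the convolution of a window with [a, b]. *)
Lemma minorization_step h g t A B e : bmeas h -> bmeas g ->
  (forall s, s <= t -> 0 <= h s) -> (forall s, s <= t -> 0 <= g s) ->
  0 <= e -> 0 <= A -> b - a <= B - A ->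
  (forall u, u <= t -> e * Iint h (u - B) (u - A) <= g u) ->
  delta * eta * e * Iint h (t - (B + (b - eta))) (t - (A + (a + eta))) <= Top nu g t.
Proof.
move=> bh bg h0 g0 e0 A0 AB hT.
have ba := ab; have a0 := a_ge0; have eE := eta4.
apply: le_trans (nu_minor bg g0).
rewrite -!mulrA; apply: ler_wpM2l => //.
have n0 : 0 < eta by lra.
(* [I1] and [I2] run over the intersection of the windows [[s - B, s - A]] for [s] in the left and
   in the right strip. The two intersections overlap because [b - a <= B - A]. *)
set I1 := Iint h (t - b + eta - B) (t - b - A).
set I2 := Iint h (t - a - B) (t - a - eta - A).
have H1 : eta * (e * I1) <= Iint g (t - b) (t - b + eta).
  rewrite (_ : eta * _ = (e * I1) * (t - b + eta - (t - b))); last by lra.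
  rewrite -Iint_cst; last by lra.
  apply: le_Iint => // [|s /andP[s1 s2]]; first exact: bmeas_cst.
  have st : s <= t by lra.
  apply: le_trans (hT s st); apply: ler_wpM2l => //.
  by apply: Iint_sub => //; try lra; move=> r r1; apply: h0; lra.
have H2 : eta * (e * I2) <= Iint g (t - a - eta) (t - a).
  rewrite (_ : eta * _ = (e * I2) * (t - a - (t - a - eta))); last by lra.
  rewrite -Iint_cst; last by lra.
  apply: le_Iint => // [|s /andP[s1 s2]]; first exact: bmeas_cst.
  have st : s <= t by lra.
  apply: le_trans (hT s st); apply: ler_wpM2l => //.
  by apply: Iint_sub => //; try lra; move=> r r1; apply: h0; lra.
have H3 : Iint h (t - (B + (b - eta))) (t - (A + (a + eta))) <= I1 + I2.
  rewrite (@Iint_split _ h _ (t - b - A))//; [|lra|lra].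
  rewrite /I1 (_ : t - (B + (b - eta)) = t - b + eta - B); last by lra.
  rewrite lerD2l; apply: Iint_sub => //; try lra.
  by move=> r r1; apply: h0; lra.
have H4 : Iint g (t - b) (t - b + eta) +
    Iint g (t - a - eta) (t - a) <= Iint g (t - b) (t - a).
  rewrite (@Iint_split _ g (t - b) (t - b + eta) (t - a))//; [|lra|lra].
  rewrite lerD2l; apply: Iint_sub => //; try lra.
  by move=> r r1; apply: g0; lra.
apply: le_trans H4; apply: le_trans (lerD H1 H2).
rewrite -mulrDr; apply: ler_wpM2l; first exact: ltW.
by rewrite -mulrDr; apply: ler_wpM2l.
Qed.

(** Each further convolution lengthens the window by [2 * eta] and costs a factor [delta * eta] in
    density. Windows of any length are thus reached, at the price of a longer delay. *)
Lemma minorization k h t : bmeas h -> (forall s, s <= t -> 0 <= h s) ->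
  delta * (delta * eta) ^+ k *
    Iint h (t - (b + k%:R * (b - eta))) (t - (a + k%:R * (a + eta))) <=
  iter k.+1 (Top nu) h t.
Proof.
have a0 := a_ge0; have ba := ab; have d0 := delta_ge0; have eE := eta4.
have n0 : 0 <= eta by lra.
elim: k t => [|k IH] t bh h0.
  by rewrite expr0 mulr1 !mul0r !addr0; exact: nu_minor.
have bi j : bmeas (iter j (Top nu) h) by exact: bmeas_iter_Top.
have k0 : (0 : R) <= k%:R by exact: ler0n.
rewrite [iter _ _ _]/= exprS -natr1.
have := @minorization_step h _ t (a + k%:R * (a + eta)) (b + k%:R * (b - eta))
  (delta * (delta * eta) ^+ k) bh (bi k.+1) h0.
rewrite (_ : delta * eta * _ = delta * (delta * eta * (delta * eta) ^+ k)); last by ring.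
rewrite (_ : b + k%:R * (b - eta) + (b - eta) = b + (k%:R + 1) * (b - eta)); last by ring.
rewrite (_ : a + k%:R * (a + eta) + (a + eta) = a + (k%:R + 1) * (a + eta)); last by ring.
apply.
- by apply: iter_Top_ge0.
- by rewrite mulr_ge0// exprn_ge0// mulr_ge0.
- by rewrite addr_ge0// mulr_ge0// addr_ge0.
- have : 0 <= k%:R * (2 * eta) by rewrite mulr_ge0// mulr_ge0.
  rewrite (_ : k%:R * (2 * eta) = k%:R * (b - eta) - k%:R * (a + eta)); first by lra.
  by rewrite -mulrBr; congr (_ * _); lra.
- by move=> u ut; apply: IH => // s su; apply: h0; lra.
Qed.

End minorization.

(** The inverse of the weight [expR (c * t)], capped at 1 for negative times so that it is itself
    bounded. *)
Definition decay c t : R := expR (- (c * Num.max t 0)).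

Lemma decay_gt0 c t : 0 < decay c t.
Proof. exact: expR_gt0. Qed.

Lemma decay_le1 c t : 0 <= c -> decay c t <= 1.
Proof.
by move=> c0; rewrite /decay -expR0 ler_expR oppr_le0 mulr_ge0// le_max lexx orbT.
Qed.

Lemma decay_anti c s t : 0 <= c -> s <= t -> decay c t <= decay c s.
Proof.
move=> c0 st; rewrite /decay ler_expR lerN2; apply: ler_wpM2l => //.
by rewrite ge_max !le_max st lexx orbT.
Qed.

Lemma decay_shift c s t : 0 <= c -> 0 <= s ->
  decay c (t - s) <= expR (c * s) * decay c t.
Proof.
move=> c0 s0; rewrite /decay -expRD ler_expR -mulrN -mulrN -mulrDr; apply: ler_wpM2l => //.
have : Num.max t 0 <= Num.max (t - s) 0 + s.
  by rewrite ge_max -lerBlDr le_max lexx/= addr_ge0// le_max lexx orbT.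
lra.
Qed.

Lemma bmeas_decay c : 0 <= c -> bmeas (decay c).
Proof.
move=> c0; split.
  apply: measurableT_comp; first exact: measurable_expR.
  apply: measurable_funN; apply: measurable_funM => //.
  exact: measurable_maxr.
by exists 1 => t; rewrite ger0_norm ?decay_le1// ltW// decay_gt0.
Qed.

End renewal_contraction.


(** * The contraction in the weighted norm *)

Section contraction.
Context {R : realType}.
Variable nu : probability R R.
Implicit Types (h g y : R -> R) (c t K : R).

(* [Dop y] is the convolution of [y] with the tail of [nu]. *)
Definition Dop y (t : R) : R := Enu nu (fun v => Iint y (t - v) t).

Section exponential_moment.
Variables (lam M : R).
Hypothesis lam_gt0 : 0 < lam.
Hypothesis nu_nneg : nu `[0, +oo[%classic = 1%E.
Hypothesis nu_exp : nu_integrable nu (fun s => expR (lam * s)).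

Lemma nu_integrable_expR c : c <= lam -> nu_integrable nu (fun s => expR (c * s)).
Proof.
move=> cl; apply: nu_integrable_le nu_exp _.
  by apply: measurableT_comp; [exact: measurable_expR|exact: measurable_funM].
by move=> s s0; rewrite ger0_norm ?expR_ge0// ler_expR ler_wpM2r.
Qed.

Lemma nu_integrable_id : nu_integrable nu (fun s => s).
Proof.
apply: nu_integrable_le (nu_integrableZ lam^-1 nu_exp) _ => // s s0.
rewrite ger0_norm// -ler_pdivrMl ?invr_gt0// invrK.
by rewrite (le_trans _ (expR_ge1Dx _))// lerDr.
Qed.

Lemma Dop_integrable y t : bmeas y -> nu_integrable nu (fun v => Iint y (t - v) t).
Proof.
move=> by_; have [my [M' hM]] := by_.
apply: nu_integrable_le (nu_integrableZ M' nu_integrable_id) _.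
  exact: measurable_Iint_lookback.
move=> s s0; apply: le_trans (Iint_norm by_ _ (fun r _ => hM r)) _; first by lra.
by rewrite subKr.
Qed.

Lemma DopB g y t : bmeas g -> bmeas y ->
  Dop (fun s => g s - y s) t = Dop g t - Dop y t.
Proof.
move=> bg by_; rewrite /Dop -EnuB; [|exact: Dop_integrable..].
by apply: eq_Enu => s s0; rewrite IintB.
Qed.

Lemma DopZ K y t : bmeas y -> Dop (fun s => K * y s) t = K * Dop y t.
Proof.
move=> by_; rewrite /Dop -EnuZ; last exact: Dop_integrable.
by apply: eq_Enu => s s0; rewrite IintZ.
Qed.

(** By [decay_shift], going back by [s] multiplies the weight by at most [expR (c * s)]; averaging
    over the step gives one factor [q] per convolution. *)
Lemma iter_Top_decay k c q K h t : 0 <= c -> c <= lam -> 0 <= K ->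
  Enu nu (fun s => expR (c * s)) <= q -> bmeas h ->
  (forall s, s <= t -> h s <= K * decay c s) ->
  iter k (Top nu) h t <= K * q ^+ k * decay c t.
Proof.
move=> c0 cl K0 qE bh hK; elim: k t hK => [|k IH] t hK; first by rewrite mulr1; exact: hK.
have q0 : 0 <= q by apply: le_trans qE; apply: Enu_ge0 => s _; exact: expR_ge0.
have bk := bmeas_iter_Top nu_nneg k bh.
apply: (@le_trans _ _ (Enu nu (fun s => K * q ^+ k * decay c t * expR (c * s)))).
  apply: le_Enu.
  - exact: bmeas_shift_integrable.
  - exact/nu_integrableZ/nu_integrable_expR.
  - move=> s s0; apply: le_trans (IH (t - s) _) _.
      by move=> r rs; apply: hK; lra.
    rewrite -!mulrA; apply: ler_wpM2l => //; apply: ler_wpM2l; first exact: exprn_ge0.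
    by rewrite [X in _ <= X]mulrC decay_shift.
rewrite EnuZ; last exact: nu_integrable_expR.
rewrite exprSr mulrA -[leLHS]mulrA -[leRHS]mulrA; apply: ler_wpM2l.
  by rewrite mulr_ge0// exprn_ge0.
by rewrite mulrC; apply: ler_wpM2r => //; exact: ltW (decay_gt0 _ _).
Qed.

End exponential_moment.

(* Adding e times the tail convolution to the positive operator T^m - e D
   loses only what lies beyond the window of length W. *)
Lemma contraction_step (lam M : R) m (L W e kappa c q K : R) y t :
  0 < lam -> nu `[0, +oo[%classic = 1%E ->
  nu_integrable nu (fun s => expR (lam * s)) ->
  Enu nu (fun s => expR (lam * s)) <= M ->
  0 <= L -> 0 <= e -> 0 <= kappa -> 0 <= c -> c <= lam -> 0 <= W ->
  Enu nu (fun s => expR (c * s)) <= q ->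
  (forall h t, bmeas h -> (forall s, s <= t -> 0 <= h s) ->
     e * Iint h (t - L - W) (t - L) <= iter m (Top nu) h t) ->
  (forall v, W <= v -> v * expR (c * v) <= kappa * expR (lam * v)) ->
  0 <= K -> bmeas y -> (forall s, s <= t -> `|y s| <= K * decay c s) ->
  iter m (Top nu) y t - e * Dop y (t - L) <=
   K * (q ^+ m - e * Enu nu (fun s => s) + 2 * e * expR (c * L) * kappa * M) * decay c t.
Proof.
move=> lam0 nn ie eM L0 e0 k0 c0 cl W0 qE minor tail K0 by_ yK.
have bw : bmeas (decay c) by exact: bmeas_decay.
have bKw : bmeas (fun s => K * decay c s) by exact: bmeasZ.
(* The minorization applies to nonnegative functions only; [h] is nonnegative by the bound on [y],
   and everything is deduced for [y] by subtraction. *)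
pose h s := K * decay c s - y s.
have bh : bmeas h by exact: bmeasB.
have h0 s : s <= t -> 0 <= h s.
  by move=> /yK; rewrite ler_norml /h => /andP[_]; rewrite subr_ge0.
have h2 s : s <= t -> h s <= 2 * K * decay c s.
  by move=> /yK; rewrite ler_norml /h => /andP[yl _]; lra.
have wt0 := decay_gt0 c t.
set J := Iint h (t - L - W) (t - L).
have J0 : 0 <= J by apply: Iint_ge0 => s s1; apply: h0; lra.
set ex := 2 * K * decay c t * expR (c * L) * kappa.
have ex0 : 0 <= ex by rewrite /ex !mulr_ge0// ?expR_ge0// ltW.
(* For [v <= W] the lookback interval lies in the window of [J], which [iter m (Top nu)] dominates.
   Longer steps are paid for by the exponential moment, through [kappa]. *)
have HD : Dop h (t - L) <= J + ex * M.
  apply: (@le_trans _ _ (Enu nu (fun v => J + ex * expR (lam * v)))); last first.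
    rewrite EnuD; [|exact: nu_integrable_cst|exact: nu_integrableZ].
    by rewrite Enu_cst// EnuZ// lerD2l ler_wpM2l.
  apply: le_Enu.
  - exact: (Dop_integrable lam0).
  - by apply: nu_integrableD; [exact: nu_integrable_cst|exact: nu_integrableZ].
  move=> v v0; have [vW|Wv] := leP v W.
    apply: (@le_trans _ _ J); last by rewrite lerDl mulr_ge0// expR_ge0.
    by apply: Iint_sub => //; try lra; move=> s s1; apply: h0; lra.
  apply: (@le_trans _ _ (ex * expR (lam * v))); last by rewrite lerDr.
  apply: (@le_trans _ _ (2 * K * (decay c t * expR (c * (L + v))) * v)).
    set X := 2 * K * (decay c t * expR (c * (L + v))).
    have -> : X * v = X * ((t - L) - (t - L - v)) by rewrite subKr.
    rewrite -Iint_cst; last by rewrite lerBlDr lerDl.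
    apply: le_Iint => //; first exact: bmeas_cst.
    move=> s /andP[s1 s2]; apply: le_trans (h2 s _) _; first by lra.
    apply: ler_wpM2l; first by rewrite mulr_ge0.
    rewrite mulrC -{1}(subKr t s); apply: le_trans (decay_shift _ c0 _) _; first by lra.
    apply: ler_wpM2r; first exact: ltW.
    by rewrite ler_expR; apply: ler_wpM2l => //; lra.
  rewrite mulrDr expRD.
  rewrite (_ : 2 * K * _ * v = 2 * K * decay c t * expR (c * L) * (v * expR (c * v))); last by ring.
  rewrite /ex -[leRHS]mulrA; apply: ler_wpM2l; last exact/tail/ltW.
  by rewrite !mulr_ge0// ?expR_ge0// ltW.
(* This is the gain: the weight decreases in time, so on a lookback interval of length [v] its
   integral is at least [v * decay c t]. *)
have Hw : Enu nu (fun s => s) * decay c t <= Dop (decay c) (t - L).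
  rewrite mulrC -EnuZ; last exact: nu_integrable_id ie.
  apply: le_Enu; [exact/nu_integrableZ/(nu_integrable_id lam0 ie)|exact: (Dop_integrable lam0)|].
  move=> v v0; have -> : decay c t * v = decay c t * ((t - L) - (t - L - v)).
    by rewrite subKr.
  rewrite -Iint_cst; last by lra.
  apply: le_Iint => //; first exact: bmeas_cst.
  by move=> s s1; apply: decay_anti => //; lra.
have HT := minor h t bh h0.
have HTw : iter m (Top nu) (fun s => K * decay c s) t <= K * q ^+ m * decay c t.
  by apply: (iter_Top_decay nn ie).
have iterB := iter_TopB nn m t bKw by_.
have DB : Dop h (t - L) = K * Dop (decay c) (t - L) - Dop y (t - L).
  by rewrite (DopB lam0)//; congr (_ - _); apply: (DopZ lam0).
rewrite [iter m _ h t]iterB in HT; rewrite DB in HD.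
have H1 : e * (K * Dop (decay c) (t - L) - Dop y (t - L)) <= e * (J + ex * M).
  exact: ler_wpM2l.
have H2 : e * (K * (Enu nu (fun s => s) * decay c t)) <= e * (K * Dop (decay c) (t - L)).
  by apply: ler_wpM2l => //; exact: ler_wpM2l.
rewrite (_ : K * (_ + _) * _ = K * q ^+ m * decay c t
   - e * (K * (Enu nu (fun s => s) * decay c t)) + e * (ex * M)); last first.
  by rewrite /ex; ring.
move: (Dop (decay c) (t - L)) (Dop y (t - L)) (Enu nu _) (iter m _ y t) (iter m _ _ t) HT HTw H1 H2.
rewrite -/J; move: (J) (ex * M) => J' X; clear=> Dw Dy mu A B; lra.
Qed.

(** Telescoping: [y - T^m y] is the sum of the [T^k (y - T y)] for [k < m], each at most [q ^+ k]
    times the first bound. *)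
Lemma iterate_defect lam c q Q B m y t :
  0 < lam -> nu `[0, +oo[%classic = 1%E ->
  nu_integrable nu (fun s => expR (lam * s)) ->
  0 <= c -> c <= lam -> 1 <= q -> Enu nu (fun s => expR (c * s)) <= q ->
  0 <= B -> bmeas y -> (forall s, s <= Q -> `|y s - Top nu y s| <= B * decay c s) ->
  t <= Q -> `|y t - iter m (Top nu) y t| <= m%:R * q ^+ m * B * decay c t.
Proof.
move=> lam0 nn ie c0 cl q1 qE B0 by_ yB tQ.
have bT := bmeas_Top nn by_; have w0 := ltW (decay_gt0 c t).
have q0 : 0 <= q by exact: le_trans q1.
have main k : `|iter k (Top nu) y t - iter k.+1 (Top nu) y t| <= B * q ^+ k * decay c t.
  rewrite iterSr -iter_TopB// ler_norml; apply/andP; split; last first.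
    apply: (iter_Top_decay nn ie) => //; first exact: bmeasB.
    by move=> s st; apply: le_trans (ler_norm _) (yB _ _); lra.
  rewrite lerNl; have -> : - iter k (Top nu) (fun s => y s - Top nu y s) t =
      iter k (Top nu) (fun s => Top nu y s - y s) t by rewrite !iter_TopB// opprB.
  apply: (iter_Top_decay nn ie) => //; first exact: bmeasB.
  move=> s st; apply: le_trans (ler_norm _) _; rewrite distrC; apply: yB; lra.
elim: m => [|m IH]; first by rewrite subrr normr0 !mul0r.
rewrite -(subrKA (iter m (Top nu) y t)).
apply: le_trans (ler_normD _ _) _; apply: le_trans (lerD IH (main m)) _.
rewrite -natr1 (mulrDl _ 1) mul1r !mulrDl; apply: lerD.
  rewrite -!mulrA; apply: ler_wpM2l; first exact: ler0n.
  apply: ler_wpM2r; first exact: mulr_ge0.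
  by rewrite exprS ler_peMl// exprn_ge0.
apply: ler_wpM2r => //; rewrite mulrC; apply: ler_wpM2r => //.
by rewrite exprS ler_peMl// exprn_ge0.
Qed.

(** If [K] is an admissible constant for the weighted bound on [y], then so is [r * K + B]. The
    least admissible constant [k] therefore satisfies [k <= r * k + B], whence
    [k <= B / (1 - r)]. *)
Lemma contraction_bound (lam M : R) m (L W e kappa c q r Q B1 B2 : R) y :
  0 < lam -> nu `[0, +oo[%classic = 1%E ->
  nu_integrable nu (fun s => expR (lam * s)) ->
  Enu nu (fun s => expR (lam * s)) <= M ->
  0 <= L -> 0 <= e -> 0 <= kappa -> 0 <= c -> c <= lam -> 0 <= W ->
  1 <= q -> Enu nu (fun s => expR (c * s)) <= q ->
  (forall h t, bmeas h -> (forall s, s <= t -> 0 <= h s) ->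
     e * Iint h (t - L - W) (t - L) <= iter m (Top nu) h t) ->
  (forall v, W <= v -> v * expR (c * v) <= kappa * expR (lam * v)) ->
  q ^+ m - e * Enu nu (fun s => s) + 2 * e * expR (c * L) * kappa * M <= r ->
  0 <= r -> r < 1 -> 0 <= B1 -> 0 <= B2 -> bmeas y ->
  (forall t, t <= Q -> `|y t - Top nu y t| <= B1 * decay c t) ->
  (forall t, t <= Q -> `|Dop y t| <= B2 * decay c t) ->
  forall t, t <= Q ->
    `|y t| <= (m%:R * q ^+ m * B1 + e * (expR (c * L) * B2)) / (1 - r) * decay c t.
Proof.
move=> lam0 nn ie eM L0 e0 k0 c0 cl W0 q1 qE minor tail rho r0 r1 B10 B20 by_ yT yD.
set B := m%:R * q ^+ m * B1 + e * (expR (c * L) * B2).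
have q0 : 0 <= q by exact: le_trans q1.
have B0 : 0 <= B.
  by rewrite /B addr_ge0// ?mulr_ge0 ?expR_ge0 ?exprn_ge0.
pose S := [set K | 0 <= K /\ forall s, s <= Q -> `|y s| <= K * decay c s].
have step K : S K -> S (r * K + B).
  move=> [K0 yK]; split; first by rewrite addr_ge0// mulr_ge0.
  move=> t tQ.
  have st z : bmeas z -> (forall s, s <= Q -> `|z s| <= K * decay c s) ->
      iter m (Top nu) z t - e * Dop z (t - L) <= K * r * decay c t.
    move=> bz zK; apply: le_trans (contraction_step lam0 nn ie eM L0 e0 k0 c0 cl W0 qE minor tail K0 bz _) _.
      by move=> s st; apply: zK; lra.
    by apply: ler_wpM2r; [exact/ltW/decay_gt0|exact: ler_wpM2l].
  have s1 := st y by_ yK.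
  (* The lower bound is the upper bound for [- y], written [0 - y] in order to use the subtraction
     rules. *)
  have s2 : - (iter m (Top nu) y t - e * Dop y (t - L)) <= K * r * decay c t.
    have bz : bmeas (fun s => 0 - y s) by apply: bmeasB => //; exact: bmeas_cst.
    have := st _ bz; rewrite iter_TopB//; last exact: bmeas_cst.
    rewrite (DopB lam0 ie)//; last exact: bmeas_cst.
    rewrite (_ : iter m (Top nu) (fun=> 0) t = 0); last first.
      elim: m t {minor rho B B0 tQ st s1 yT} => [//|m IH] t /=.
      by rewrite -[RHS](Enu_cst nn 0); apply: eq_Enu => s _; exact: IH.
    rewrite (_ : Dop (fun=> 0) (t - L) = 0); last first.
      by rewrite -[RHS](Enu_cst nn 0); apply: eq_Enu => s s0; rewrite Iint_cst ?mul0r//; lra.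
    rewrite !sub0r mulrN opprB opprK addrC; apply.
    by move=> s sQ; rewrite sub0r normrN; exact: yK.
  have d1 := iterate_defect m lam0 nn ie c0 cl q1 qE B10 by_ yT tQ.
  have d2 : `|e * Dop y (t - L)| <= e * (expR (c * L) * B2) * decay c t.
    rewrite normrM ger0_norm// -mulrA; apply: ler_wpM2l => //.
    apply: le_trans (yD (t - L) _) _; first by lra.
    rewrite (mulrC (expR _)) -mulrA; apply: ler_wpM2l => //; exact: decay_shift.
  move: d1 d2 s1 s2; rewrite /B !ler_norml => /andP[a1 a2] /andP[b1 b2].
  rewrite !(mulrDl _ _ (decay c t)) (mulrC r).
  move: (K * r * _) (_ * B1 * _) (e * _ * _) (iter _ _ _ _) (e * Dop _ _) a1 a2 b1 b2.
  by clear=> *; apply/andP; split; lra.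
have [my [N yN]] := by_.
have wQ := decay_gt0 c Q.
(* Some constant is admissible, since [y] is bounded and the weight is at least [decay c Q] on the
   times considered. This a priori constant may be huge; it disappears from the result. *)
have S0 : S (`|N| / decay c Q).
  split; first by rewrite divr_ge0// ltW.
  move=> s sQ; apply: le_trans (yN s) _; apply: le_trans (ler_norm _) _.
  rewrite -mulrA ler_peMr// mulrC ler_pdivlMr// mul1r.
  exact: decay_anti.
have lS : has_lbound S by exists 0 => K [].
pose k := inf S.
have kS : S k.
  split; first by apply: lb_le_inf; [exists (`|N| / decay c Q)|move=> K []].
  move=> s sQ; rewrite -ler_pdivrMr ?decay_gt0//.
  apply: lb_le_inf; first by exists (`|N| / decay c Q).
  by move=> K [_ /(_ s sQ)]; rewrite -ler_pdivrMr ?decay_gt0.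
have kk : k <= r * k + B by apply: ge_inf => //; exact: step.
move=> t tQ; apply: le_trans (kS.2 t tQ) _.
apply: ler_wpM2r; first exact/ltW/decay_gt0.
by rewrite ler_pdivlMr; lra.
Qed.

End contraction.


(** * Windows, their antiderivatives and telescoping sums *)

Section renewal_functions.
Context {R : realType}.
Notation leb := (@lebesgue_measure R).
Implicit Types (c t x u v : R).

Definition above c t : R := \1_(`]c, +oo[%classic) t.
Definition posp t : R := Num.max t 0.
(** The interval is open at 0 and closed at [x] because an agent of weight [x] is pivotal when its
    predecessors weigh [S] with [Q - x <= S < Q], that is [0 < Q - S <= x]. *)
Definition window x t : R := \1_(`]0, x]%classic) t.
(** The antiderivative of [window x] that vanishes on negative times; it is constantly [x] from time
    [x] on. *)
Definition clamp x t : R := posp t - posp (t - x).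

Lemma aboveE c t : above c t = (c < t)%R%:R.
Proof.
have -> : (c < t) = (t \in `]c, +oo[%classic) by apply/idP/idP; rewrite inE/= in_itv/= andbT.
by rewrite /above indicE.
Qed.

Lemma windowE x t : 0 <= x -> window x t = above 0 t - above x t.
Proof.
move=> x0; rewrite !aboveE /window indicE.
have -> : (t \in `]0, x]%classic) = (0 < t <= x) by apply/idP/idP; rewrite inE/= in_itv.
have [t0|t0] := ltP 0 t; have [tx|xt] := leP t x; rewrite /= ?subr0 ?subrr//.
by exfalso; lra.
Qed.

Lemma bmeas_above c : bmeas (above c).
Proof. exact: bmeas_indic. Qed.

Lemma bmeas_window x : bmeas (window x).
Proof. exact: bmeas_indic. Qed.

Lemma posp_ge0 t : 0 <= posp t.
Proof. by rewrite /posp le_max lexx orbT. Qed.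

Lemma ler_posp t : t <= posp t.
Proof. by rewrite /posp le_max lexx. Qed.

Lemma posp_pos t : 0 <= t -> posp t = t.
Proof. by move=> t0; rewrite /posp max_l. Qed.

Lemma posp_neg t : t <= 0 -> posp t = 0.
Proof. by move=> t0; rewrite /posp max_r. Qed.

Lemma Iint_above c u t : u <= t -> Iint (above c) u t = posp (t - c) - posp (u - c).
Proof.
move=> ut.
have lo u' t' : u' <= t' -> t' <= c -> Iint (above c) u' t' = 0.
  move=> ut' tc; rewrite -(mul0r (t' - u')) -Iint_cst//; apply: eq_Rintegral => s.
  by rewrite inE/= in_itv/= aboveE => /andP[_ st]; rewrite ltNge (le_trans st).
have hi u' t' : u' <= t' -> c <= u' -> Iint (above c) u' t' = t' - u'.
  move=> ut' cu; rewrite -[RHS]mul1r -Iint_cst// /Iint.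
  have bd h : bmeas h -> leb.-integrable `]u', t']%classic (EFin \o h).
    move=> bh; apply: integrableS (bmeas_leb_integrable u' t' bh) => //.
    by apply: subset_itvr; rewrite bnd_simp.
  rewrite -Rintegral_itv_obnd_cbnd; last exact/bd/bmeas_above.
  rewrite -[RHS]Rintegral_itv_obnd_cbnd; last exact/bd/bmeas_cst.
  apply: eq_Rintegral => s; rewrite inE/= in_itv/= aboveE => /andP[us _].
  by rewrite (le_lt_trans cu).
have [tc|ct] := leP t c.
  by rewrite lo// !posp_neg ?subrr; lra.
have [cu|uc] := leP c u.
  by rewrite hi// !posp_pos; lra.
rewrite (@Iint_split _ _ _ c)//; [|exact: bmeas_above|exact: ltW|exact: ltW].
rewrite lo ?hi//; [|exact: ltW|exact: ltW].
by rewrite add0r posp_pos ?posp_neg ?subr0//; lra.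
Qed.

Lemma Iint_window x u t : 0 <= x -> u <= t -> Iint (window x) u t = clamp x t - clamp x u.
Proof.
move=> x0 ut; rewrite (_ : window x = fun s => above 0 s - above x s); last first.
  by apply/funext => s; exact: windowE.
rewrite IintB; [|exact: bmeas_above..].
by rewrite !Iint_above// !subr0 /clamp; lra.
Qed.

Lemma clamp_ge0 x t : 0 <= x -> 0 <= clamp x t.
Proof. by move=> x0; rewrite /clamp /posp subr_ge0 ge_max !le_max lexx orbT andbT; apply/orP; lra. Qed.

Lemma clamp_le x t : 0 <= x -> clamp x t <= x.
Proof.
move=> x0; rewrite /clamp lerBlDr /posp ge_max -lerBlDl le_max lexx/=.
by rewrite addr_ge0// le_max lexx orbT.
Qed.

Lemma clamp_neg x t : 0 <= x -> t <= 0 -> clamp x t = 0.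
Proof. by move=> x0 t0; rewrite /clamp !posp_neg ?subrr//; lra. Qed.

Lemma clamp_far x t : 0 <= x -> x <= t -> clamp x t = x.
Proof. by move=> x0 t0; rewrite /clamp !posp_pos; lra. Qed.

Lemma bmeas_clamp x : 0 <= x -> bmeas (clamp x).
Proof.
move=> x0; split; last first.
  by exists x => t; rewrite ger0_norm ?clamp_le// clamp_ge0.
apply: measurable_funB; first exact: measurable_maxr.
by apply: measurable_maxr => //; exact: measurable_funB.
Qed.

End renewal_functions.

Section renewal_sum.
Context {R : realType}.
Variable nu : probability R R.
Variables (lam : R).
Hypothesis lam_gt0 : 0 < lam.
Hypothesis nu_nneg : nu `[0, +oo[%classic = 1%E.
Hypothesis nu_exp : nu_integrable nu (fun s => expR (lam * s)).
Implicit Types (c t x u v q eta theta : R) (h : R -> R).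

(* The expected number of renewals in the window [t - x, t[ among the first N. *)
Definition renewals x N t : R := \sum_(k < N) iter k (Top nu) (window x) t.

Lemma bmeas_renewals x N : bmeas (renewals x N).
Proof. by apply: bmeas_sum => k; apply: bmeas_iter_Top => //; exact: bmeas_window. Qed.

Lemma iter_Top_window_antiderivative x k u t : 0 <= x -> u <= t ->
  Iint (iter k (Top nu) (window x)) u t =
  iter k (Top nu) (clamp x) t - iter k (Top nu) (clamp x) u.
Proof.
move=> x0; elim: k u t => [|k IH] u t ut; first exact: Iint_window.
rewrite [iter _ _ (window x)]/=; apply: antiderivative_Top => //.
  by apply: bmeas_iter_Top => //; exact: bmeas_window.
by apply: bmeas_iter_Top => //; exact: bmeas_clamp.
Qed.

(** If [H] is an antiderivative of [h], averaging [H t - H (t - v)] over the step [v] gives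
    [Dop h = H - T H]. Here [H] is [T^k] of the clamp. *)
Lemma Dop_window x k t : 0 <= x ->
  Dop nu (iter k (Top nu) (window x)) t =
  iter k (Top nu) (clamp x) t - iter k.+1 (Top nu) (clamp x) t.
Proof.
move=> x0; have bk := bmeas_iter_Top nu_nneg k (bmeas_clamp x0).
rewrite /Dop -[X in X - _](Enu_cst nu_nneg) [iter k.+1 _ _]/= /Top -EnuB.
- by apply: eq_Enu => s s0; rewrite iter_Top_window_antiderivative//; lra.
- exact: nu_integrable_cst.
- exact: bmeas_shift_integrable.
Qed.

(** The sum telescopes. For [t >= x] the first term is exactly [x], and the second is the
    contribution of the missing steps: hence the limit [x / mu], as [Dop] multiplies constants by
    [mu]. *)
Lemma Dop_renewals x N t : 0 <= x ->
  Dop nu (renewals x N) t = clamp x t - iter N (Top nu) (clamp x) t.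
Proof.
move=> x0; elim: N => [|N IH].
  rewrite subrr -[RHS](Enu_cst nu_nneg 0); apply: eq_Enu => s s0.
  rewrite (_ : renewals x 0 = fun=> 0); last by apply/funext => r; rewrite /renewals big_ord0.
  by rewrite Iint_cst ?mul0r//; lra.
have bw := bmeas_iter_Top nu_nneg N (bmeas_window x).
rewrite (_ : renewals x N.+1 =
    fun r => renewals x N r - (0 - iter N (Top nu) (window x) r)); last first.
  by apply/funext => r; rewrite sub0r opprK /renewals big_ord_recr.
have b0 : bmeas (fun=> 0 : R) by exact: bmeas_cst.
rewrite (DopB lam_gt0 nu_exp); [|exact: bmeas_renewals|exact: bmeasB].
rewrite (DopB lam_gt0 nu_exp)// IH Dop_window//.
have -> : Dop nu (fun=> 0) t = 0.
  by rewrite -[RHS](Enu_cst nu_nneg 0); apply: eq_Enu => s s0; rewrite Iint_cst ?mul0r//; lra.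
by rewrite sub0r opprK subrKA.
Qed.

Lemma Top_sum I (s : seq I) (h : I -> R -> R) t : (forall i, bmeas (h i)) ->
  Top nu (fun r => \sum_(i <- s) h i r) t = \sum_(i <- s) Top nu (h i) t.
Proof.
move=> bh; elim: s => [|i s IH].
  rewrite big_nil -[RHS](Top_cst nu_nneg 0 t).
  by apply: eq_Top => r _; rewrite big_nil.
rewrite big_cons -IH -TopD//; last exact: bmeas_sum.
by apply: eq_Top => r _; rewrite big_cons.
Qed.

Lemma renewals_defect x N t :
  renewals x N t - Top nu (renewals x N) t = window x t - iter N (Top nu) (window x) t.
Proof.
rewrite /renewals Top_sum; last first.
  by move=> k; apply: bmeas_iter_Top => //; exact: bmeas_window.
elim: N => [|N IH]; first by rewrite !big_ord0 !subrr.
rewrite !big_ord_recr/=; move: IH; move: (\sum_(i < N) _) (\sum_(i < N) _) => A B.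
by move=> IH; rewrite opprD addrACA IH addrA subrK.
Qed.

(** [expR (theta * t)] is an eigenfunction of [Top nu], with the Laplace transform of the step at
    [theta] as eigenvalue. *)
Lemma iter_Top_chernoff theta k h K t : 0 <= theta -> 0 <= K -> bmeas h ->
  (forall s, h s <= K * expR (theta * s)) ->
  iter k (Top nu) h t <= K * Enu nu (fun s => expR (- (theta * s))) ^+ k * expR (theta * t).
Proof.
move=> th0 K0 bh hK; set q := Enu nu _.
have q0 : 0 <= q by apply: Enu_ge0 => s _; exact: expR_ge0.
have iq : nu_integrable nu (fun s => expR (- (theta * s))).
  apply: nu_integrable_le (nu_integrable_cst nu_nneg 1) _.
    apply: measurableT_comp; first exact: measurable_expR.
    by apply: measurable_funN; exact: measurable_funM.
  move=> s s0; rewrite ger0_norm ?expR_ge0// -expR0 ler_expR oppr_le0.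
  exact: mulr_ge0.
elim: k t => [|k IH] t; first by rewrite mulr1; exact: hK.
rewrite [iter _ _ _]/= exprSr.
apply: (@le_trans _ _ (Enu nu (fun s => K * q ^+ k * expR (theta * t) * expR (- (theta * s))))).
  apply: le_Enu.
  - by apply: bmeas_shift_integrable => //; exact: bmeas_iter_Top.
  - exact: nu_integrableZ.
  - by move=> s s0; apply: le_trans (IH (t - s)) _; rewrite mulrBr expRD mulrA.
by rewrite EnuZ// -/q le_eqVlt; apply/orP; left; apply/eqP; ring.
Qed.

End renewal_sum.


(** * Deviation of the renewal count from its limit *)

Section renewal_estimate.
Context {R : realType}.
Implicit Types (c t x u v q eta theta lam M W : R).

(** The exponent [lam * v] is shared out: a quarter absorbs the factor [v], a quarter absorbs
    [c * v], and the remaining half is at least [lam * W / 2]. *)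
Lemma mul_expR_le lam c W v : 0 < lam -> 0 <= c -> c <= lam / 4 -> 0 <= W -> W <= v ->
  v * expR (c * v) <= 4 / lam * expR (- (lam * W / 2)) * expR (lam * v).
Proof.
move=> l0 c0 cl W0 Wv; have v0 : 0 <= v by exact: le_trans Wv.
have h1 : v <= 4 / lam * expR (lam * v / 4).
  rewrite -ler_pdivrMl ?divr_gt0// invf_div.
  by apply: le_trans (expR_ge1Dx _); rewrite mulrAC lerDr.
apply: le_trans (ler_wpM2r (expR_ge0 _) h1) _.
rewrite -!mulrA !(mulrA 4); apply: ler_wpM2l; first by rewrite divr_ge0// ltW.
rewrite -!expRD ler_expR.
have h2 : c * v <= lam / 4 * v by exact: ler_wpM2r.
have h3 : lam * W <= lam * v by apply: ler_wpM2l => //; exact: ltW.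
move: h2 h3; rewrite !mulrA; lra.
Qed.

(** The quantity is the length of the part of [[t - v, t]] that lies in negative times; it vanishes
    as soon as [v <= t]. *)
Lemma posp_lookback_ge0 t v : 0 <= v -> 0 <= v - (posp t - posp (t - v)).
Proof.
move=> v0; have := posp_ge0 t; have := posp_ge0 (t - v); have := ler_posp (t - v).
have [t0|t0] := leP 0 t; first by rewrite (posp_pos t0); lra.
by rewrite (posp_neg (ltW t0)); lra.
Qed.

Lemma posp_lookback_le c t v : 0 <= c -> 0 <= v ->
  v - (posp t - posp (t - v)) <= v * expR (c * v) * decay c t.
Proof.
move=> c0 v0; have [vt|tv] := leP v t.
  rewrite !posp_pos; [|lra..].
  rewrite (_ : v - _ = 0); last by lra.
  by rewrite !mulr_ge0 ?expR_ge0// ltW// decay_gt0.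
rewrite (posp_neg (t := t - v)); last by lra.
rewrite subr0 -mulrA /decay -expRD -/(posp t).
apply: (@le_trans _ _ v); first by have := posp_ge0 t; lra.
rewrite ler_peMr// -[leLHS]expR0 ler_expR -mulrN -mulrDr mulr_ge0//.
have [t0|t0] := leP 0 t; first by rewrite (posp_pos t0); lra.
by rewrite (posp_neg (ltW t0)); lra.
Qed.

Lemma decay_ge1 c x t : 0 <= c -> 0 <= x -> t <= x -> 1 <= expR (c * x) * decay c t.
Proof.
move=> c0 x0 tx; rewrite /decay -expRD -[leLHS]expR0 ler_expR -mulrN -mulrDr mulr_ge0//.
by rewrite subr_ge0 ge_max tx.
Qed.

Variable nu : probability R R.

Lemma Dop_above lam t : 0 < lam -> Dop nu (above 0) t = Enu nu (fun v => posp t - posp (t - v)).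
Proof.
move=> _; apply: eq_Enu => s s0; rewrite Iint_above; last by lra.
by rewrite !subr0.
Qed.

(** The two triples of terms bound [y - T y] and [Dop y], for [y] the deviation. In each, the first
    comes from the times before [x], the second from the steps after the [N]-th, the third from the
    jump of the limit at time 0. *)
Lemma renewals_bound lam M m (L W e kappa c q r : R) x N Q theta eta :
  0 < lam -> nu `[0, +oo[%classic = 1%E ->
  nu_integrable nu (fun s => expR (lam * s)) ->
  Enu nu (fun s => expR (lam * s)) <= M ->
  0 <= L -> 0 <= e -> 0 <= kappa -> 0 <= c -> c <= lam / 4 -> 0 <= W ->
  1 <= q -> Enu nu (fun s => expR (c * s)) <= q ->
  (forall h t, bmeas h -> (forall s, s <= t -> 0 <= h s) ->
     e * Iint h (t - L - W) (t - L) <= iter m (Top nu) h t) ->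
  (forall v, W <= v -> v * expR (c * v) <= kappa * expR (lam * v)) ->
  let mu := Enu nu (fun s => s) in
  q ^+ m - e * mu + 2 * e * expR (c * L) * kappa * M <= r ->
  0 <= r -> r < 1 -> 0 < mu -> 0 <= x -> 0 < Q -> 0 <= theta -> 0 <= eta ->
  expR (theta * Q) * Enu nu (fun s => expR (- (theta * s))) ^+ N <= eta ->
  `|renewals nu x N Q - x / mu| <=
   (m%:R * q ^+ m * (expR (c * x) + eta * expR (c * Q) + x / mu * q)
    + e * (expR (c * L) * (x * expR (c * x) + x * (eta * expR (c * Q)) + x / mu * (4 / lam * M))))
   / (1 - r) * decay c Q.
Proof.
move=> l0 nn ie eM L0 e0 k0 c0 cl4 W0 q1 qE minor tail mu rho r0 r1 mu0 x0 Q_gt0 th0 eta0 etaE.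
have Q0 := ltW Q_gt0.
have cl : c <= lam by lra.
have xm0 : 0 <= x / mu by rewrite divr_ge0// ltW.
have bwin := bmeas_window x; have bcl := bmeas_clamp x0.
have babv := bmeas_above (0 : R).
have bren := bmeas_renewals nn x N.
(* The limit is subtracted at positive times only, because the renewal count vanishes at the
   others. *)
pose y t := renewals nu x N t - x / mu * above 0 t.
have by_ : bmeas y by apply: bmeasB => //; exact: bmeasZ.
have M0 : 0 <= M by apply: le_trans eM; apply: Enu_ge0 => s _; exact: expR_ge0.
have q0 : 0 <= q by exact: le_trans q1.
have decay0 t : 0 <= decay c t by exact/ltW/decay_gt0.
(* [eta] bounds the missing steps at every time up to [Q], but without decay; the factor
   [expR (c * Q)] turns this constant into a multiple of the weight. *)
have chern K h t : 0 <= K -> bmeas h -> (forall s, h s <= K * expR (theta * s)) ->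
    t <= Q -> iter N (Top nu) h t <= K * (eta * expR (c * Q)) * decay c t.
  move=> K0 bh hK tQ; apply: le_trans (iter_Top_chernoff nn N t th0 K0 bh hK) _.
  rewrite -!mulrA; apply: ler_wpM2l => //.
  apply: (@le_trans _ _ eta).
    apply: le_trans etaE; rewrite mulrC; apply: ler_wpM2r.
      by rewrite exprn_ge0//; apply: Enu_ge0 => s _; exact: expR_ge0.
    by rewrite ler_expR; exact: ler_wpM2l.
  by rewrite ler_peMr//; exact: decay_ge1.
have B10 : 0 <= expR (c * x) + eta * expR (c * Q) + x / mu * q.
  apply: addr_ge0; last exact: mulr_ge0.
  by apply: addr_ge0; [exact: expR_ge0|exact: mulr_ge0 eta0 (expR_ge0 _)].
have lM0 : 0 <= 4 / lam * M by rewrite mulr_ge0// divr_ge0// ltW.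
have B20 : 0 <= x * expR (c * x) + x * (eta * expR (c * Q)) + x / mu * (4 / lam * M).
  apply: addr_ge0; last exact: mulr_ge0.
  apply: addr_ge0; first exact: mulr_ge0 x0 (expR_ge0 _).
  exact: mulr_ge0 x0 (mulr_ge0 eta0 (expR_ge0 _)).
have win1 t : window x t <= 1 * expR (theta * t).
  rewrite mul1r windowE// !aboveE; case: (ltP 0 t) => [t0|_] /=; last first.
    by rewrite sub0r; apply: le_trans (expR_ge0 _); rewrite oppr_le0.
  apply: (@le_trans _ _ 1); first by rewrite gerBl.
  by rewrite -[leLHS]expR0 ler_expR mulr_ge0// ltW.
have H1 t : t <= Q -> `|y t - Top nu y t| <=
    (expR (c * x) + eta * expR (c * Q) + x / mu * q) * decay c t.
  move=> tQ.
  have -> : y t - Top nu y t = window x t - iter N (Top nu) (window x) t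
      - x / mu * (above 0 t - Top nu (above 0) t).
    rewrite /y TopB//; last exact: bmeasZ.
    rewrite TopZ// -(renewals_defect nn x N t).
    by move: (renewals _ _ _ _) (Top _ _ _) (Top _ _ _) => *; ring.
  have a1 : 0 <= window x t by rewrite /window indicE.
  have a2 : window x t <= expR (c * x) * decay c t.
    rewrite /window indicE; have [|_] := boolP (_ \in _).
      by rewrite inE/= in_itv/= => /andP[_ tx]; exact: decay_ge1.
    by rewrite mulr_ge0// expR_ge0.
  have a3 : 0 <= iter N (Top nu) (window x) t.
    by apply: (@iter_Top_ge0 _ _ _ _ t) => // s _; rewrite /window indicE.
  have a4 := chern 1 (window x) t ler01 bwin win1 tQ.
  have [a5 a6] : 0 <= above 0 t - Top nu (above 0) t /\
     above 0 t - Top nu (above 0) t <= q * decay c t.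
    have [t0|t0] := leP t 0.
      have -> : Top nu (above 0) t = 0.
        rewrite -[RHS](Top_cst nn 0 t); apply: eq_Top => s st.
        by rewrite aboveE ltNge (le_trans st t0).
      by rewrite aboveE ltNge t0 subrr mulr_ge0.
    rewrite {1 2}aboveE t0 -[1%:R](Enu_cst nn) /Top -EnuB; [|exact: nu_integrable_cst
       |exact: bmeas_shift_integrable].
    split; first by apply: Enu_ge0 => s s0; rewrite aboveE subr_ge0 lern1 leq_b1.
    apply: le_trans (ler_wpM2r (decay0 t) qE).
    rewrite mulrC -EnuZ; last exact: nu_integrable_expR ie _ _.
    apply: le_Enu.
    - apply: bmeas_nu_integrable => //; apply: bmeasB; first exact: bmeas_cst.
      exact: bmeas_shift.
    - exact/nu_integrableZ/(nu_integrable_expR ie).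
    - move=> s s0; rewrite aboveE; case: ltP => ts; first by rewrite subrr mulr_ge0// expR_ge0.
      rewrite subr0 mulrC; apply: decay_ge1 => //; lra.
  have a7 : x / mu * (above 0 t - Top nu (above 0) t) <= x / mu * (q * decay c t) by exact: ler_wpM2l.
  have a8 : 0 <= x / mu * (above 0 t - Top nu (above 0) t) by exact: mulr_ge0.
  rewrite ler_norml !mulrDl -!mulrA.
  move: a4; rewrite mul1r -!mulrA => a4.
  have a9 : 0 <= expR (c * x) * decay c t by exact: le_trans a2.
  have a10 : 0 <= eta * (expR (c * Q) * decay c t) by rewrite !mulr_ge0 ?expR_ge0.
  move: (window x t) (iter _ _ _ _) (above 0 t - _) a1 a2 a3 a4 a7 a8 a9 a10 => w i z.
  rewrite -(mulrA x); move: (mu^-1 * z) (mu^-1 * _) => z1 z2.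
  by move: (expR _ * _) (eta * _) => A B; clear=> *; lra.
have H2 t : t <= Q -> `|Dop nu y t| <=
    (x * expR (c * x) + x * (eta * expR (c * Q)) + x / mu * (4 / lam * M)) * decay c t.
  move=> tQ.
  (* The constant parts [x] and [x / mu * mu] cancel. What remains is the boundary layer before [x],
     the missing steps, and the part of a step that reaches back before time 0. *)
  have -> : Dop nu y t = - (x - clamp x t) - iter N (Top nu) (clamp x) t
      + x / mu * (mu - Dop nu (above 0) t).
    rewrite (DopB l0 ie)//; last exact: bmeasZ.
    rewrite (DopZ l0 ie)// (Dop_renewals l0 nn ie)// mulrBr divfK ?gt_eqF//.
    by move: (iter _ _ _ _) (clamp x t) (_ * Dop _ _ _) => *; ring.
  have a1 : 0 <= x - clamp x t by rewrite subr_ge0 clamp_le.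
  have a2 : x - clamp x t <= x * expR (c * x) * decay c t.
    have [xt|tx] := leP x t.
      by rewrite clamp_far// subrr !mulr_ge0 ?expR_ge0.
    apply: (@le_trans _ _ x); first by rewrite gerBl clamp_ge0.
    by rewrite -mulrA ler_peMr//; apply: decay_ge1 => //; exact: ltW.
  have a3 : 0 <= iter N (Top nu) (clamp x) t.
    by apply: (@iter_Top_ge0 _ _ _ _ t) => // s _; exact: clamp_ge0.
  have a4 : iter N (Top nu) (clamp x) t <= x * (eta * expR (c * Q)) * decay c t.
    apply: chern => // s; have [s0|s0] := leP s 0.
      by rewrite clamp_neg// mulr_ge0// expR_ge0.
    apply: le_trans (clamp_le s x0) _; rewrite ler_peMr//.
    by rewrite -[leLHS]expR0 ler_expR mulr_ge0// ltW.
  have mpp : measurable_fun [set: R] (fun v => posp t - posp (t - v)).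
    apply: measurable_funB => //; apply: measurable_maxr => //.
    exact: measurable_rsub.
  have ii := nu_integrable_id l0 ie.
  have ipp : nu_integrable nu (fun v => posp t - posp (t - v)).
    apply: nu_integrable_le ii _ => // s s0.
    have := posp_lookback_ge0 t s0; rewrite ler_norml.
    have : posp (t - s) <= posp t.
      by rewrite ge_max !le_max lexx orbT andbT -lerBrDl subrr oppr_le0 s0.
    by move: (posp t) (posp (t - s)) => u v; lra.
  have [a5 a6] : 0 <= mu - Dop nu (above 0) t /\
      mu - Dop nu (above 0) t <= 4 / lam * M * decay c t.
    rewrite (Dop_above _ l0) /mu -EnuB//; split.
      by apply: Enu_ge0 => s; exact: posp_lookback_ge0.
    apply: (@le_trans _ _ (Enu nu (fun s => 4 / lam * decay c t * expR (lam * s)))).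
      apply: le_Enu.
      - apply: nu_integrable_le ii _ => [|s s0]; first exact: measurable_funB.
        rewrite ger0_norm ?posp_lookback_ge0// gerBl.
        rewrite subr_ge0 ge_max !le_max lexx orbT andbT.
        by rewrite -lerBrDl subrr oppr_le0 s0.
      - exact: nu_integrableZ.
      - move=> s s0; apply: le_trans (posp_lookback_le t c0 s0) _.
        rewrite [leRHS]mulrAC; apply: ler_wpM2r => //.
        have := mul_expR_le l0 c0 cl4 (lexx 0) s0.
        by rewrite mulr0 mul0r oppr0 expR0 mulr1.
    rewrite EnuZ// [leRHS]mulrAC; apply: ler_wpM2l => //.
    by rewrite mulr_ge0// divr_ge0// ltW.
  have a7 : x / mu * (mu - Dop nu (above 0) t) <= x / mu * (4 / lam * M * decay c t) by exact: ler_wpM2l.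
  have a8 : 0 <= x / mu * (mu - Dop nu (above 0) t) by exact: mulr_ge0.
  rewrite !(mulrDl _ _ (decay c t)) -(mulrA (x / mu)).
  have a9 : 0 <= x * expR (c * x) * decay c t by exact: le_trans a2.
  have a10 : 0 <= x * (eta * expR (c * Q)) * decay c t by exact: le_trans a4.
  move: (x - clamp x t) (iter _ _ _ _) (x / mu * (mu - _)) (x / mu * (_ * decay c t))
    (x * expR (c * x) * decay c t) (x * (eta * expR (c * Q)) * decay c t) a1 a2 a3 a4 a7 a8 a9 a10.
  by clear=> A B C D E F *; rewrite ler_norml; apply/andP; split; lra.
have := contraction_bound l0 nn ie eM L0 e0 k0 c0 cl W0 q1 qE minor tail rho r0 r1 B10 B20 by_ H1 H2 (lexx Q).
by rewrite /y aboveE Q_gt0 mulr1.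
Qed.

(** Markov's inequality: by minorization, a step exceeds the midpoint of [[a, b]] with probability
    at least [delta * ((b - a) / 2)]. The test function [h] is reflected, as [Top nu h 0] evaluates
    it at minus the step. *)
Lemma renewal_law_mean delta a b lam M : 0 < delta -> 0 <= a -> a < b -> 0 < lam ->
  renewal_law nu delta a b lam M ->
  (a + b) / 2 * (delta * ((b - a) / 2)) <= Enu nu (fun s => s).
Proof.
move=> d0 a0 ab l0 [nn minor ie _].
pose h : R -> R := \1_(`]-oo, (- ((a + b) / 2))%R]%classic).
have bh : bmeas h by exact: bmeas_indic.
have h0 s : 0 <= h s by rewrite /h indicE.
have hE s : h s = (s <= - ((a + b) / 2))%R%:R.
  have -> : (s <= - ((a + b) / 2)) = (s \in `]-oo, (- ((a + b) / 2))%R]%classic).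
    by apply/idP/idP; rewrite inE/= in_itv.
  by rewrite /h indicE.
have T0 := minor h 0 bh (fun s _ => h0 s); rewrite !sub0r in T0.
have I1 : (b - a) / 2 <= Iint h (- b) (- a).
  apply: (@le_trans _ _ (Iint h (- b) (- ((a + b) / 2)))); last first.
    by apply: Iint_sub => //; lra.
  rewrite (_ : (b - a) / 2 = 1 * (- ((a + b) / 2) - - b)); last by lra.
  rewrite -Iint_cst; last by lra.
  apply: le_Iint => //; first exact: bmeas_cst.
  by move=> s /andP[_ sc]; rewrite hE sc.
apply: (@le_trans _ _ ((a + b) / 2 * Top nu h 0)).
  apply: ler_wpM2l; first by lra.
  by apply: le_trans T0; apply: ler_wpM2l => //; exact: ltW.
rewrite /Top -EnuZ; last exact: bmeas_shift_integrable.
apply: le_Enu; [exact/nu_integrableZ/bmeas_shift_integrable|exact: nu_integrable_id l0 ie|].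
move=> s s0; rewrite hE sub0r lerN2; case: (leP ((a + b) / 2) s) => h1 /=; first by rewrite mulr1.
by rewrite mulr0.
Qed.

End renewal_estimate.


(** * Choice of the constants, uniformly in the law *)

Section renewal_rate.
Context {R : realType}.
Implicit Types (c x q e lam : R).

Lemma expR_le_add2 x : 0 <= x -> x <= 2^-1 -> expR x <= 1 + 2 * x.
Proof.
move=> x0 x2; have h : 1 - x <= expR (- x) by have := expR_ge1Dx (- x).
have p : expR (- x) * expR x = 1 by rewrite -expRD addNr expR0.
have e0 := expR_ge0 x.
have h2 := ler_wpM2r e0 h; rewrite p in h2.
rewrite -(ler_pM2l (_ : 0 < 1 - x)); last by lra.
apply: le_trans h2 _; rewrite (_ : (1 - x) * (1 + 2 * x) = 1 + x * (1 - 2 * x)); last by ring.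
by rewrite lerDl mulr_ge0//; lra.
Qed.

(** Integrate [expR u <= 1 + u * expR u] at [u = c * s]. The moment tends to 1 linearly in [c], so a
    fixed power of it can be brought close to 1. *)
Lemma Enu_expR_le (nu : probability R R) lam M c :
  0 < lam -> nu `[0, +oo[%classic = 1%E ->
  nu_integrable nu (fun s => expR (lam * s)) ->
  Enu nu (fun s => expR (lam * s)) <= M -> 0 <= c -> c <= lam / 4 ->
  Enu nu (fun s => expR (c * s)) <= 1 + c * (4 / lam * M).
Proof.
move=> l0 nn ie eM c0 cl.
apply: (@le_trans _ _ (Enu nu (fun s => 1 + c * (4 / lam) * expR (lam * s)))).
  apply: le_Enu.
  - by apply: nu_integrable_expR ie _ _; lra.
  - by apply: nu_integrableD; [exact: nu_integrable_cst|exact: nu_integrableZ].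
  move=> s s0; have h1 := mul_expR_le l0 c0 cl (lexx 0) s0.
  rewrite mulr0 mul0r oppr0 expR0 mulr1 in h1.
  have h2 : 1 - c * s <= expR (- (c * s)) by have := expR_ge1Dx (- (c * s)).
  have p : expR (- (c * s)) * expR (c * s) = 1 by rewrite -expRD addNr expR0.
  have h3 := ler_wpM2r (expR_ge0 (c * s)) h2; rewrite p in h3.
  have h4 : c * (s * expR (c * s)) <= c * (4 / lam * expR (lam * s)) by exact: ler_wpM2l.
  by move: h3 h4; rewrite mulrBl mul1r !mulrA; lra.
rewrite EnuD; [|exact: nu_integrable_cst|exact: nu_integrableZ].
rewrite Enu_cst// EnuZ// lerD2l -!mulrA; apply: ler_wpM2l => //.
by rewrite !mulrA; apply: ler_wpM2l => //; rewrite divr_ge0// ltW.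
Qed.

(** The rate is chosen last, [m], [L] and [e] being already fixed. Of the three terms in the
    minimum, the first allows for the exponential moments, the second controls the delay [L], and
    the third gives [(1 + c z)^m <= expR g <= 1 + 2 g] with [g <= e * mu0 / 8]. *)
Lemma exp_rate_choice (mu0 lam M L e : R) m : 0 < mu0 -> 0 < lam -> 0 < M -> 0 <= L -> 0 < e ->
  exists c, [/\ 0 < c, c <= lam / 4, expR (c * L) <= 2 &
    (1 + c * (4 / lam * M)) ^+ m <= 1 + e * mu0 / 4].
Proof.
move=> mu00 l0 M0 L0 e0.
pose D := m%:R * (4 / lam * M) + 1.
have z0 : 0 < 4 / lam * M by rewrite mulr_gt0// divr_gt0.
have D0 : 0 < D by rewrite /D ltr_wpDl// mulr_ge0// ltW.
pose g := Num.min (2^-1) (e * mu0 / 8).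
have g0 : 0 < g.
  by rewrite /g lt_min; apply/andP; split; [lra|rewrite divr_gt0// mulr_gt0].
pose c := Num.min (lam / 4) (Num.min ((2 * (L + 1))^-1) (g / D)).
have L1 : 0 < 2 * (L + 1) by lra.
exists c; split.
- by rewrite /c !lt_min invr_gt0 L1 !divr_gt0.
- by rewrite /c ge_min lexx.
- have cL : c * L <= 2^-1.
    apply: (@le_trans _ _ ((2 * (L + 1))^-1 * L)).
      by apply: ler_wpM2r => //; rewrite /c !ge_min lexx orbT.
    rewrite ler_pdivrMl//; lra.
  apply: le_trans (_ : 1 + 2 * 2^-1 <= _); last by lra.
  by apply: le_trans (expR_le_add2 _ (lexx _)); [rewrite ler_expR|lra].
have cD : c * D <= g.
  by rewrite -ler_pdivlMr// /c !ge_min lexx !orbT.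
have c0 : 0 < c by rewrite /c !lt_min invr_gt0 L1 !divr_gt0.
have h : c * (4 / lam * M) * m%:R <= g.
  apply: le_trans cD; rewrite -mulrA; apply: ler_wpM2l; first exact: ltW.
  by rewrite mulrC /D lerDl.
apply: (@le_trans _ _ (expR (c * (4 / lam * M)) ^+ m)).
  by rewrite lerXn2r// ?nnegrE ?expR_ge0 ?expR_ge1Dx// addr_ge0// mulr_ge0// ltW.
rewrite -expRM_natr; apply: (@le_trans _ _ (expR g)); first by rewrite ler_expR.
apply: le_trans (expR_le_add2 (ltW g0) _) _; first by rewrite /g ge_min lexx.
have : g <= e * mu0 / 8 by rewrite /g ge_min lexx orbT.
lra.
Qed.

(** After [k + 1] steps the window has length [b - a + 2 * k * g], which exceeds [W] once
    [k * g >= W]; [L] is its near end. *)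
Lemma scale_minorization delta a b (W : R) : 0 < delta -> 0 <= a -> a < b -> 0 <= W ->
  exists (m : nat) (L e : R), [/\ 0 <= L, 0 < e &
   forall nu : probability R R, nu `[0, +oo[%classic = 1%E ->
    (forall h t, bmeas h -> (forall s, s <= t -> 0 <= h s) ->
       delta * Iint h (t - b) (t - a) <= Top nu h t) ->
    forall h t, bmeas h -> (forall s, s <= t -> 0 <= h s) ->
      e * Iint h (t - L - W) (t - L) <= iter m (Top nu) h t].
Proof.
move=> d0 a0 ab W0; pose g := (b - a) / 4.
have gE : g * 4 = b - a by rewrite /g divfK.
have g0 : 0 < g by lra.
have gb : g < b by lra.
pose k := (Num.truncn (W / g)).+1.
have kW : W <= k%:R * g by rewrite -ler_pdivrMr// ltW// truncnS_gt.
exists k.+1, (a + k%:R * (a + g)), (delta * (delta * g) ^+ k); split.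
- by rewrite addr_ge0// mulr_ge0// addr_ge0// ltW.
- by rewrite mulr_gt0// exprn_gt0// mulr_gt0.
move=> nu nn minor h t bh h0.
apply: le_trans (minorization (ltW d0) ab a0 nn minor gE k bh h0).
apply: ler_wpM2l.
  by apply: mulr_ge0; [exact: ltW|apply: exprn_ge0; apply: mulr_ge0; exact: ltW].
have kab : k%:R * (b - g) = k%:R * (a + g) + k%:R * g + k%:R * g.
  by rewrite -!mulrDr; congr (_ * _); lra.
have kg0 : 0 <= k%:R * g by rewrite mulr_ge0// ltW.
have ka0 : 0 <= k%:R * (a + g) by rewrite mulr_ge0// addr_ge0// ltW.
move: kab kg0 ka0 kW; clearbody k; move: (k%:R * _) (k%:R * (a + g)) (k%:R * g) => X Y Z *.
by apply: Iint_sub => //; [lra..|move=> s s1; apply: h0; lra].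
Qed.

(** The dependence on [x] must remain explicit, since [x] is later integrated over all good weights:
    [(1 + x) * expR (c * x)] is integrable because [c <= lam / 4]. *)
Theorem renewal_rate delta a b lam M : 0 < delta -> 0 <= a -> a < b -> 0 < lam ->
  exists c K, [/\ 0 < c, c <= lam / 4, 0 < K &
   forall nu : probability R R, renewal_law nu delta a b lam M ->
   forall x N Q theta eta, 0 <= x -> 0 < Q -> 0 <= theta -> 0 <= eta ->
   expR (theta * Q) * Enu nu (fun s => expR (- (theta * s))) ^+ N <= eta ->
   `|renewals nu x N Q - x / Enu nu (fun s => s)| <=
     K * (1 + x) * (expR (- (c * (Q - x))) + eta)].
Proof.
move=> d0 a0 ab l0.
pose M' := `|M| + 1; have M'0 : 0 < M' by rewrite /M' ltr_wpDl.
pose mu0 := (a + b) / 2 * (delta * ((b - a) / 2)).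
have mu00 : 0 < mu0 by rewrite /mu0 mulr_gt0 ?mulr_gt0//; lra.
(* With [lam * W / 2 = X], the tail constant satisfies [kappa * M' = mu0 / 16 * (X * expR (- X))],
   which is at most [mu0 / 16]. *)
pose X := 64 / lam * M' / mu0.
have X0 : 0 < X by rewrite /X divr_gt0// mulr_gt0// divr_gt0.
pose W := 2 / lam * X.
have W0 : 0 < W by rewrite /W mulr_gt0// divr_gt0.
pose kappa := 4 / lam * expR (- (lam * W / 2)).
have k0 : 0 <= kappa by rewrite mulr_ge0 ?expR_ge0// divr_ge0// ltW.
have kM : kappa * M' <= mu0 / 16.
  have p : expR (- X) * X <= 1.
    have : expR (- X) * expR X = 1 by rewrite -expRD addNr expR0.
    move=> <-; apply: ler_wpM2l; first exact: expR_ge0.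
    by apply: le_trans (expR_ge1Dx X); rewrite lerDr.
  have -> : kappa * M' = mu0 / 16 * (expR (- X) * X).
    rewrite /kappa (_ : lam * W / 2 = X); last by rewrite /W; field; rewrite gt_eqF.
    rewrite {3}/X; field.
    by rewrite !gt_eqF.
  by apply: ler_piMr => //; rewrite divr_ge0// ltW.
have [m [L [e [L0 e0 minorL]]]] := scale_minorization d0 a0 ab (ltW W0).
have [c [c0 cl cL cm]] := exp_rate_choice m mu00 l0 M'0 L0 e0.
pose q := 1 + c * (4 / lam * M').
have q1 : 1 <= q by rewrite /q lerDl; nonneg.
have q0 : 0 <= q by exact: le_trans q1.
(* The gain [e * mu0] exceeds the losses: [e * mu0 / 4] from [q ^+ m], and [2 * e * 2 * (mu0 / 16)],
   again [e * mu0 / 4], from the tail. The maximum with 0 only keeps [r] nonnegative. *)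
pose r := Num.max 0 (1 - e * mu0 / 2).
have em0 : 0 < e * mu0 by exact: mulr_gt0.
have r1 : r < 1 by rewrite /r gt_max ltr01/=; lra.
have r0 : 0 <= r by rewrite /r le_max lexx.
pose K := (m%:R * q ^+ m * (1 + q / mu0) + e * (2 * (1 + 4 / lam * M' / mu0))) / (1 - r).
have lM0 : 0 <= 4 / lam * M' by rewrite mulr_ge0 ?divr_ge0// ltW.
have K0 : 0 < K.
  rewrite /K divr_gt0//; last by lra.
  rewrite ltr_wpDl//; last by rewrite mulr_gt0// mulr_gt0// ltr_pwDl// divr_ge0// ltW.
  by nonneg.
exists c, K; split=> // nu law x N Q theta eta x0 Q0 th0 eta0 etaE.
have [nn minor ie eM] := law.
have eM' : Enu nu (fun s => expR (lam * s)) <= M'.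
  by apply: le_trans eM _; rewrite /M' (le_trans (ler_norm _))// lerDl.
have mul := renewal_law_mean d0 a0 ab l0 law.
have qE := Enu_expR_le l0 nn ie eM' (ltW c0) cl.
have mu_gt0 : 0 < Enu nu (fun s => s) by exact: lt_le_trans mul.
have tail v : W <= v -> v * expR (c * v) <= kappa * expR (lam * v).
  exact: mul_expR_le l0 (ltW c0) cl (ltW W0).
have rho : q ^+ m - e * Enu nu (fun s => s) + 2 * e * expR (c * L) * kappa * M' <= r.
  have h1 : e * mu0 <= e * Enu nu (fun s => s) by apply: ler_wpM2l => //; exact: ltW.
  have h2 : 2 * e * expR (c * L) * kappa * M' <= 2 * e * 2 * (mu0 / 16).
    rewrite -(mulrA _ kappa); apply: ler_pM => //.
    - by rewrite !mulr_ge0 ?expR_ge0// ltW.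
    - by rewrite mulr_ge0// ltW.
    - by apply: ler_wpM2l => //; rewrite mulr_ge0// ltW.
  apply: (@le_trans _ _ (1 - e * mu0 / 2)); last by rewrite /r le_max lexx orbT.
  move: cm h1 h2; rewrite -/q; move: (_ * M') (q ^+ m) (e * Enu _ _) => A B D; lra.
apply: le_trans (renewals_bound l0 nn ie eM' L0 (ltW e0) k0 (ltW c0) cl (ltW W0)
  q1 qE (minorL nu nn minor) tail rho r0 r1 mu_gt0 x0 Q0 th0 eta0 etaE) _.
set mu := Enu nu (fun s => s) in mul mu_gt0 *.
have -> : decay c Q = expR (- (c * Q)) by rewrite /decay -/(posp Q) posp_pos// ltW.
set D := expR (- (c * Q)); set S := expR (- (c * (Q - x))) + eta.
have D0 : 0 <= D by exact: expR_ge0.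
have xD : expR (c * x) * D = expR (- (c * (Q - x))).
  by rewrite -expRD; congr expR; ring.
have QD : eta * expR (c * Q) * D = eta by rewrite -mulrA -expRD addrN expR0 mulr1.
have S0 : 0 <= S by rewrite addr_ge0// expR_ge0.
have DS : D <= S.
  rewrite /S -xD; apply: (@le_trans _ _ (expR (c * x) * D)); last by rewrite lerDl.
  by rewrite ler_peMl// -[leLHS]expR0 ler_expR mulr_ge0// ltW.
have xmu : x / mu <= x / mu0 by apply: ler_wpM2l => //; rewrite lef_pV2// posrE.
have xmu0 : 0 <= x / mu by rewrite divr_ge0// ltW.
have h1 : (expR (c * x) + eta * expR (c * Q) + x / mu * q) * D <= (1 + q / mu0) * ((1 + x) * S).
  rewrite mulrDl mulrDl xD QD -/S.
  apply: (@le_trans _ _ (S + x / mu0 * q * S)).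
    by rewrite lerD2l; apply: ler_pM => //; [exact: mulr_ge0|exact: ler_wpM2r].
  have xq : x / mu0 * q * S = q / mu0 * (x * S) by ring.
  rewrite xq (_ : (1 + q / mu0) * _ =
    S + q / mu0 * (x * S) + (x * S + q / mu0 * S)); last by ring.
  by rewrite lerDl; nonneg.
have h2 : (x * expR (c * x) + x * (eta * expR (c * Q)) + x / mu * (4 / lam * M')) * D <=
    (1 + 4 / lam * M' / mu0) * ((1 + x) * S).
  rewrite mulrDl mulrDl -!(mulrA x) xD QD -mulrDr -/S.
  apply: (@le_trans _ _ (x * S + x / mu0 * (4 / lam * M') * S)).
    rewrite lerD2l (_ : x * _ = x / mu * (4 / lam * M') * D); last by rewrite !mulrA.
    by apply: ler_pM => //; [exact: mulr_ge0|exact: ler_wpM2r].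
  have xq : x / mu0 * (4 / lam * M') * S = 4 / lam * M' / mu0 * (x * S) by ring.
  move: (4 / lam * M' / mu0) (divr_ge0 lM0 (ltW mu00)) xq => z z0 ->.
  rewrite (_ : (1 + z) * _ = x * S + z * (x * S) + (S + z * S)); last by ring.
  by rewrite lerDl; nonneg.
rewrite (_ : K * _ * _ = (m%:R * q ^+ m * ((1 + q / mu0) * ((1 + x) * S)) +
  e * (2 * ((1 + 4 / lam * M' / mu0) * ((1 + x) * S)))) / (1 - r)); last first.
  by rewrite /K; move: (1 - r)^-1 => ?; ring.
rewrite mulrAC; apply: ler_wpM2r; first by rewrite invr_ge0 subr_ge0 ltW.
rewrite mulrDl -!mulrA; apply: lerD.
  by do 2 (apply: ler_wpM2l; first by nonneg); rewrite mulrA.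
apply: ler_wpM2l; first exact: ltW.
apply: ler_pM => //; nonneg.
by move: h2; rewrite -!mulrA.
Qed.

End renewal_rate.

(** * Densities and independence *)

Section density_law.
Context {R : realType}.
Notation leb := (@lebesgue_measure R).
Variable g : R -> R.
Hypothesis mg : measurable_fun [set: R] g.
Hypothesis g_ge0 : forall t, 0 <= g t.
Hypothesis g1 : (\int[leb]_t (g t)%:E = 1)%E.

(** The proofs are arguments so that the probability structure can be attached to the term
    itself. *)
Definition density_law & measurable_fun [set: R] g & (forall t, 0 <= g t) &
  (\int[leb]_t (g t)%:E = 1)%E : set R -> \bar R :=
  fun V => (\int[leb]_(x in V) (g x)%:E)%E.

Local Notation law := (density_law mg g_ge0 g1).

Let law0 : law set0 = 0%E.
Proof. by rewrite /density_law integral_set0. Qed.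

Let law_ge0 A : (0 <= law A)%E.
Proof. by rewrite /density_law integral_ge0//= => x _; rewrite lee_fin. Qed.

Let law_sigma_additive : semi_sigma_additive law.
Proof.
move=> /= F mF tF mUF; rewrite /density_law; apply: cvg_toP.
  apply: ereal_nondecreasing_is_cvgn => m n mn.
  apply: lee_sum_nneg_natr => // k _ _; apply: integral_ge0 => /= x Fkx.
  by rewrite lee_fin.
rewrite ge0_integral_bigcup//=.
- exact/measurable_funTS/measurable_EFinP.
- by move=> x _; rewrite lee_fin.
Qed.

HB.instance Definition _ := isMeasure.Build _ _ _
  (density_law mg g_ge0 g1) law0 law_ge0 law_sigma_additive.

Let law_setT : law [set: R] = 1%E.
Proof. by rewrite /density_law g1. Qed.

HB.instance Definition _ :=
  @Measure_isProbability.Build _ _ R (density_law mg g_ge0 g1) law_setT.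

Import HBNNSimple.

(** True by definition for indicators, by linearity for simple functions, then by monotone
    convergence. *)
Lemma ge0_integral_density_law (h : R -> \bar R) :
  measurable_fun [set: R] h -> (forall t, 0 <= h t)%E ->
  (\int[law]_t h t = \int[leb]_t (h t * (g t)%:E))%E.
Proof.
move=> mh h0; pose h_ := nnsfun_approx measurableT mh.
transitivity (limn (fun n => \int[law]_x (h_ n x)%:E)%E).
  rewrite -monotone_convergence//.
  - apply: eq_integral => y _; apply/esym/cvg_lim => //.
    exact: cvg_nnsfun_approx.
  - by move=> n; exact/measurable_EFinP/measurable_funP.
  - by move=> n y _; rewrite lee_fin.
  - by move=> y _ m n mn; rewrite lee_fin; exact/lefP/nd_nnsfun_approx.
have mEg : measurable_fun [set: measurableTypeR R] (EFin \o g) by exact/measurable_EFinP.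
have mhn n : measurable_fun [set: measurableTypeR R] (h_ n).
  exact: (@measurable_funP _ _ _ _ _ (h_ n)).
rewrite [X in limn X](_ : _ = (fun n => \int[leb]_x ((h_ n x)%:E * (g x)%:E))%E).
  rewrite -monotone_convergence//; last 3 first.
    - by move=> n /=; apply: emeasurable_funM => //; exact/measurable_EFinP.
    - by move=> n x _ /=; rewrite mule_ge0// lee_fin.
    - move=> x _ m n mn; apply: lee_wpmul2r; rewrite ?lee_fin//.
      by have /lefP/(_ x) := nd_nnsfun_approx measurableT mh mn.
  apply: eq_integral => x _; apply/cvg_lim => //.
  apply: cvgeZr => //; exact: cvg_nnsfun_approx.
apply/funext => n.
have mset r : measurable (h_ n @^-1` [set r]) by exact: measurable_sfunP.
have mind r : measurable_fun [set: measurableTypeR R] (\1_(h_ n @^-1` [set r]) : R -> R).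
  exact: bmeas_measurable (bmeas_indic (mset r)).
transitivity (\sum_(k \in range (h_ n))
    \int[leb]_x (k%:E * ((\1_(h_ n @^-1` [set k]) x)%:E * (g x)%:E)))%E.
  under eq_integral do rewrite fimfunE -fsumEFin//.
  rewrite ge0_integral_fsum//; last 2 first.
  - by move=> y; exact/measurable_EFinP/measurable_funM.
  - by move=> y x _; rewrite nnfun_muleindic_ge0.
  apply: eq_fsbigr => r /[!inE] -[y _ yr]; rewrite integralZl_indic_nnsfun// integral_indic//= setIT.
  have r0 : 0 <= r by rewrite -yr.
  rewrite ge0_integralZl//; last 2 first.
  - by apply: emeasurable_funM => //; exact/measurable_EFinP.
  - by move=> x _; rewrite mule_ge0// lee_fin// indicE.
  congr (_ * _)%E; rewrite /density_law [LHS]integral_mkcond; apply: eq_integral => x _.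
  by rewrite patchE indicE; case: (x \in _); rewrite ?mul1e ?mul0e.
rewrite -ge0_integral_fsum//.
- apply: eq_integral => x _; rewrite fimfunE -fsumEFin// ge0_mule_fsuml//.
    by apply: eq_fsbigr => r _; rewrite EFinM muleA.
  by move=> r; rewrite nnfun_muleindic_ge0.
- by move=> r; apply: emeasurable_funM => //; apply: emeasurable_funM => //; exact/measurable_EFinP.
- move=> r x _; rewrite muleA; apply: mule_ge0; last by rewrite lee_fin.
  by rewrite nnfun_muleindic_ge0.
Qed.

End density_law.


(** * Independence and product laws *)

Section independence.
Context {R : realType}.
Context d (T : measurableType d) (P : probability T R) (n : nat).
Variables (X : 'I_n -> T -> R) (nu : probability R R).
Hypothesis mX : forall i, measurable_fun [set: T] (X i).
Hypothesis X_law : forall i (B : set R), measurable B -> P (X i @^-1` B) = nu B.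
Hypothesis X_indep : forall B : 'I_n -> set R, (forall i, measurable (B i)) ->
  P (\bigcap_(i in setT) (X i @^-1` B i)) = (\prod_(i < n) P (X i @^-1` B i))%E.

(** A family closed under intersection that generates the information carried by the agents of [s];
    leaving the other coordinates free is what allows one of them to be added independently. *)
Definition boxes (s : {set 'I_n}) : set (set T) :=
  [set C | exists B : 'I_n -> set R, [/\ forall i, measurable (B i),
     forall i, i \notin s -> B i = setT & C = \bigcap_(i in setT) (X i @^-1` B i)]].

Lemma measurable_preimage_X i (B : set R) : measurable B -> measurable (X i @^-1` B).
Proof. by move=> mB; rewrite -[_ @^-1` _]setTI; exact: mX. Qed.

Lemma boxes_measurable s : boxes s `<=` @measurable _ T.
Proof.
move=> _ [B [mB _ ->]]; apply: fin_bigcap_measurable => // i _.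
exact: measurable_preimage_X.
Qed.

Lemma setI_closed_boxes s : setI_closed (boxes s).
Proof.
move=> _ _ [B [mB sB ->]] [D [mD sD ->]]; exists (fun i => B i `&` D i); split.
- by move=> i; exact: measurableI.
- by move=> i si; rewrite sB// sD// setIT.
- by rewrite -bigcapI.
Qed.

Lemma boxes_setT s : boxes s setT.
Proof.
exists (fun=> setT); split => //.
by apply/esym; rewrite -subTset => w _ i _.
Qed.

Lemma indep_box (s : {set 'I_n}) j C (B : set R) : boxes s C -> j \notin s -> measurable B ->
  P (C `&` X j @^-1` B) = (P C * nu B)%E.
Proof.
move=> [D [mD sD ->]] js mB.
pose D' i := if i == j then B else D i.
have mD' i : measurable (D' i) by rewrite /D'; case: ifP.
have -> : \bigcap_(i in setT) (X i @^-1` D i) `&` X j @^-1` B =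
    \bigcap_(i in setT) (X i @^-1` D' i).
  apply/seteqP; split => w /=.
    by move=> [Dw Bw] i _; rewrite /D' /=; case: eqP => [->//|_]; exact: Dw.
  move=> Dw; split.
    move=> i _; have := Dw i I; rewrite /D' /=; case: eqP => // -> _.
    by rewrite sD.
  by have := Dw j I; rewrite /D' eqxx.
rewrite !X_indep// (bigD1 j)//= [in RHS](bigD1 j)//=.
rewrite {1}/D' eqxx X_law// sD// preimage_setT probability_setT mul1e muleC.
congr (_ * _)%E; apply: eq_bigr => i ij.
by rewrite /D' (negbTE ij).
Qed.

(** As functions of [C], both sides are finite measures; they agree on the boxes, which are closed
    under intersection, hence on the sigma-algebra that these generate. *)
Lemma indep_sigma (s : {set 'I_n}) j C (B : set R) : <<s boxes s >> C -> j \notin s -> measurable B ->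
  P (C `&` X j @^-1` B) = (P C * nu B)%E.
Proof.
move=> sC js mB; have mXB := measurable_preimage_X j mB.
have nB0 : 0 <= fine (nu B) by rewrite fine_ge0.
pose m1 : {measure set T -> \bar R} := mrestr P mXB.
pose m2 : {measure set T -> \bar R} := mscale (NngNum nB0) P.
have := @g_sigma_algebra_measure_unique _ _ _ (boxes s) (@boxes_measurable s)
  (fun=> setT) (fun=> @boxes_setT s) _ m1 m2 (@setI_closed_boxes s) _ _ C sC.
rewrite /m1 /m2 /mrestr/= /mscale/= fineK; last by rewrite fin_num_measure.
rewrite muleC; apply.
- by rewrite -subTset => w _; exists 0%N.
- move=> A bA; rewrite /mrestr muleC.
  exact: indep_box bA js mB.
- move=> k; rewrite /mrestr setTI.
  by rewrite (le_lt_trans (probability_le1 _ mXB))// ltry.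
Qed.

Lemma measurable_boxes_X (s : {set 'I_n}) i : i \in s ->
  measurable_fun [set: g_sigma_algebraType (boxes s)] (X i : g_sigma_algebraType (boxes s) -> R).
Proof.
move=> si _ B mB; rewrite setTI; apply: sub_sigma_algebra.
exists (fun l => if l == i then B else setT); split.
- by move=> l; case: ifP.
- by move=> l; case: eqP => // -> /negP.
- apply/seteqP; split => w /=; first by move=> Bw l _; case: eqP => // ->.
  by move=> /(_ i I); rewrite eqxx.
Qed.

(** The joint law of [V] and [X j] is the product of their laws, since [V] is a function of the
    agents of [s] only; Tonelli's theorem then integrates [X j] out. *)
Lemma integral_indep d' (U : measurableType d') (s : {set 'I_n}) j (V : T -> U) (G : U * R -> \bar R) :
  j \notin s ->
  measurable_fun [set: g_sigma_algebraType (boxes s)] (V : g_sigma_algebraType (boxes s) -> U) ->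
  measurable_fun [set: U * R] G -> (forall z, 0 <= G z)%E ->
  (\int[P]_w G (V w, X j w) = \int[P]_w \int[nu]_y G (V w, y))%E.
Proof.
move=> js mV mG G0.
have sub C : <<s boxes s >> C -> measurable C.
  move=> sC; apply: (smallest_sub _ _ sC); first exact: sigma_algebra_measurable.
  exact: boxes_measurable.
have mVT : measurable_fun [set: T] V by move=> _ B mB; apply: sub; exact: mV.
pose Vm : {mfun T >-> U} := HB.pack V (isMeasurableFun.Build _ _ _ _ V mVT).
have mVX : measurable_fun [set: T] (fun w => (V w, X j w)) by exact: measurable_fun_pair.
have := @ge0_integral_pushforward _ _ _ _ _ _ mVX P setT G measurableT mG (fun z _ => G0 z).
rewrite preimage_setT => <-.
transitivity (\int[distribution P Vm \x nu]_z G z)%E.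
  apply: eq_measure_integral => A mA _.
  apply/esym; apply: product_measure_unique => // B D mB mD.
  have : P (V @^-1` B `&` X j @^-1` D) = (P (V @^-1` B) * nu D)%E.
    apply: (@indep_sigma s) => //.
    by have := mV measurableT B mB; rewrite setTI.
  exact.
rewrite fubini_tonelli1//.
rewrite (@ge0_integral_pushforward _ _ _ _ _ _ mVT)//.
- exact: measurable_fun_fubini_tonelli_F.
- by move=> u _; apply: integral_ge0.
Qed.

End independence.


Lemma measurable_sum_in {R : realType} d (T : measurableType d) (I : eqType) (s : seq I)
    (h : I -> T -> R) : (forall i, i \in s -> measurable_fun [set: T] (h i)) ->
  measurable_fun [set: T] (fun x => \sum_(i <- s) h i x).
Proof.
elim: s => [|i s IH] mh.
  by under eq_fun do rewrite big_nil; exact: measurable_cst.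
under eq_fun do rewrite big_cons.
apply: measurable_funD; first by apply: mh; rewrite inE eqxx.
by apply: IH => k ks; apply: mh; rewrite inE ks orbT.
Qed.

(** * Integrating out the agents one at a time *)

Section peeling.
Context {R : realType}.
Variable nu : probability R R.
Variable D : set (R * R).
Hypothesis mD : measurable D.
Implicit Types (b : bool) (h : R * R -> \bar R).

(* Integrating out one agent whose weight s is constrained by (x, s) \in D,
   where x is the weight of the distinguished agent; the quota left drops by s
   when that agent is a predecessor of it. *)
Definition pstep b h (z : R * R) : \bar R :=
  (\int[nu]_s ((\1_D (z.1, s))%:E * h (z.1, (z.2 - b%:R * s)%R)))%E.

Fixpoint peel (s : seq bool) h : R * R -> \bar R :=
  if s is b :: s' then peel s' (pstep b h) else h.

Lemma pstep_ge0 b h : (forall z, 0 <= h z)%E -> forall z, (0 <= pstep b h z)%E.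
Proof.
by move=> h0 z; apply: integral_ge0 => s _; rewrite mule_ge0// lee_fin indicE.
Qed.

Lemma measurable_indic2 d (T : measurableType d) (u v : T -> R) :
  measurable_fun [set: T] u -> measurable_fun [set: T] v ->
  measurable_fun [set: T] (fun w => \1_D (u w, v w) : R).
Proof.
move=> mu mv; have mi : measurable_fun [set: R * R] (\1_D : R * R -> R) by exact: measurable_indic.
by have := measurableT_comp mi (measurable_fun_pair mu mv).
Qed.

Lemma measurable_pstep b h : measurable_fun [set: R * R] h -> (forall z, 0 <= h z)%E ->
  measurable_fun [set: R * R] (pstep b h).
Proof.
move=> mh h0.
have m11 : measurable_fun [set: R * R * R] (fun z : R * R * R => z.1.1).
  by apply: measurableT_comp; [exact: measurable_fst|exact: measurable_fst].
have m12 : measurable_fun [set: R * R * R] (fun z : R * R * R => z.1.2).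
  by apply: measurableT_comp; [exact: measurable_snd|exact: measurable_fst].
have m2 : measurable_fun [set: R * R * R] (fun z : R * R * R => z.2) by exact: measurable_snd.
pose f (z : R * R * R) : \bar R :=
  ((\1_D (z.1.1, z.2))%:E * h (z.1.1, (z.1.2 - b%:R * z.2)%R))%E.
have f0 z : (0 <= f z)%E by rewrite mule_ge0// lee_fin indicE.
apply: (@measurable_fun_fubini_tonelli_F _ _ (R * R)%type R R nu f) => //.
apply: emeasurable_funM.
  by apply/measurable_EFinP; exact: measurable_indic2.
apply: measurableT_comp => //; apply: measurable_fun_pair => //.
by apply: measurable_funB => //; exact: measurable_funM.
Qed.

Lemma peel_ge0 s h : (forall z, 0 <= h z)%E -> forall z, (0 <= peel s h z)%E.
Proof. by elim: s h => //= b s IH h h0; apply: IH; exact: pstep_ge0. Qed.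

Lemma measurable_peel s h : measurable_fun [set: R * R] h -> (forall z, 0 <= h z)%E ->
  measurable_fun [set: R * R] (peel s h).
Proof.
elim: s h => //= b s IH h mh h0; apply: IH; first exact: measurable_pstep.
exact: pstep_ge0.
Qed.

Section peeling_indep.
Context d (T : measurableType d) (P : probability T R) (n : nat).
Variables (X : 'I_n -> T -> R).
Hypothesis mX : forall i, measurable_fun [set: T] (X i).
Hypothesis X_law : forall i (B : set R), measurable B -> P (X i @^-1` B) = nu B.
Hypothesis X_indep : forall B : 'I_n -> set R, (forall i, measurable (B i)) ->
  P (\bigcap_(i in setT) (X i @^-1` B i)) = (\prod_(i < n) P (X i @^-1` B i))%E.

Lemma integral_peel_indep i (s : seq 'I_n) (b : 'I_n -> bool) h t :
  uniq (i :: s) -> measurable_fun [set: R * R] h -> (forall z, 0 <= h z)%E ->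
  (\int[P]_w ((\prod_(j <- s) \1_D (X i w, X j w))%:E *
      h (X i w, (t - \sum_(j <- s) (b j)%:R * X j w)%R)) =
   \int[P]_w peel (map b s) h (X i w, t))%E.
Proof.
elim: s h => [|j s IH] h us mh h0.
  by apply: eq_integral => w _; rewrite !big_nil mul1e subr0.
move: us => /= /andP[]; rewrite inE negb_or => /andP[ij is_] /andP[js us].
rewrite -IH//; [|by rewrite /= is_|exact: measurable_pstep|exact: pstep_ge0].
pose S := i |: [set k in s].
pose V w := (X i w, ((t - \sum_(k <- s) (b k)%:R * X k w)%R, \prod_(k <- s) (\1_D (X i w, X k w) : R))).
(* The absolute value makes [G] nonnegative on the whole space, as [integral_indep] requires; the
   product of indicators for which it stands is nonnegative anyway. *)
pose G (z : (R * (R * R)) * R) : \bar R :=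
  (`|z.1.2.2|%:E * ((\1_D (z.1.1, z.2))%:E * h (z.1.1, (z.1.2.1 - (b j)%:R * z.2)%R)))%E.
have G0 z : (0 <= G z)%E by rewrite !mule_ge0// lee_fin// indicE.
have jS : j \notin S by rewrite !inE negb_or eq_sym ij.
have mXS k : k \in S -> measurable_fun [set: g_sigma_algebraType (boxes X S)]
   (X k : g_sigma_algebraType (boxes X S) -> R) by exact: measurable_boxes_X.
have mXi := mXS i (setU11 _ _).
have mXs k : k \in s -> measurable_fun [set: g_sigma_algebraType (boxes X S)]
   (X k : g_sigma_algebraType (boxes X S) -> R).
  by move=> ks; apply: mXS; rewrite !inE ks orbT.
have mV : measurable_fun [set: g_sigma_algebraType (boxes X S)]
    (V : g_sigma_algebraType (boxes X S) -> R * (R * R)).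
  apply: measurable_fun_pair => //; apply: measurable_fun_pair.
    apply: measurable_funB => //.
    by apply: measurable_sum_in => k ks; apply: measurable_funM => //; exact: mXs.
  by apply: measurable_prod => k ks; apply: measurable_indic2 => //; exact: mXs.
have pr21 : measurable_fun [set: R * (R * R) * R] (fun z => z.1.2 : R * R).
  by apply: measurableT_comp; [exact: measurable_snd|exact: measurable_fst].
have m1 : measurable_fun [set: R * (R * R) * R] (fun z => z.1.1 : R).
  by apply: measurableT_comp; [exact: measurable_fst|exact: measurable_fst].
have m2 : measurable_fun [set: R * (R * R) * R] (fun z => z.1.2.1 : R).
  by apply: measurableT_comp pr21; exact: measurable_fst.
have m3 : measurable_fun [set: R * (R * R) * R] (fun z => z.1.2.2 : R).
  by apply: measurableT_comp pr21; exact: measurable_snd.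
have m4 : measurable_fun [set: R * (R * R) * R] (fun z => z.2 : R) by exact: measurable_snd.
have mG : measurable_fun [set: R * (R * R) * R] G.
  apply: emeasurable_funM.
    by apply/measurable_EFinP; apply: measurableT_comp.
  apply: emeasurable_funM.
    by apply/measurable_EFinP; exact: measurable_indic2.
  apply: measurableT_comp => //; apply: measurable_fun_pair => //.
  by apply: measurable_funB => //; exact: measurable_funM.
have pn w : `|\prod_(k <- s) (\1_D (X i w, X k w) : R)| = \prod_(k <- s) \1_D (X i w, X k w).
  by rewrite ger0_norm//; apply: prodr_ge0 => k _; rewrite indicE.
transitivity (\int[P]_w G (V w, X j w))%E.
  apply: eq_integral => w _; rewrite /G /V /= pn !big_cons mulrC EFinM -muleA.
  by rewrite opprD addrA addrAC.
rewrite (integral_indep mX X_law X_indep jS mV mG G0).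
apply: eq_integral => w _; rewrite /G /V /= pn ge0_integralZl//.
- apply: emeasurable_funM.
    apply/measurable_EFinP; apply: measurable_indic2 => //.
  apply: measurableT_comp => //; apply: measurable_fun_pair => //.
  by apply: measurable_funB => //; exact: measurable_funM.
- by move=> y _; rewrite mule_ge0// lee_fin indicE.
- by rewrite lee_fin prodr_ge0// => k _; rewrite indicE.
Qed.

Lemma integral_peel i (s : seq 'I_n) (b : 'I_n -> bool) h t :
  uniq (i :: s) -> measurable_fun [set: R * R] h -> (forall z, 0 <= h z)%E ->
  (\int[P]_w ((\prod_(j <- s) \1_D (X i w, X j w))%:E *
      h (X i w, (t - \sum_(j <- s) (b j)%:R * X j w)%R)) =
   \int[nu]_x peel (map b s) h (x, t))%E.
Proof.
move=> us mh h0; rewrite integral_peel_indep//.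
have mp : measurable_fun [set: R] (fun x => peel (map b s) h (x, t)).
  by apply: measurableT_comp; [exact: measurable_peel|exact: measurable_fun_pair].
have := @ge0_integral_pushforward _ _ _ _ _ _ (mX i) P setT _ measurableT mp
  (fun z _ => peel_ge0 (map b s) h0 (z, t)).
rewrite preimage_setT => <-; apply: eq_measure_integral => A mA _.
exact: X_law.
Qed.

End peeling_indep.
End peeling.

(** * Conditional laws *)

Section conditional_law.
Context {R : realType}.
Notation leb := (@lebesgue_measure R).
Implicit Types (nu mu : probability R R) (A : set R) (g h : R -> R).

(** Stated without division, so that a null event [A] causes no exception: both sides then vanish
    for every [mu]. *)
Definition conditional_law nu A mu : Prop :=
  mu `[0, +oo[%classic = 1%E /\
  forall g, measurable_fun [set: R] g -> (forall s, 0 <= g s) ->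
    (\int[nu]_s (\1_A s * g s)%:E = (fine (nu A))%:E * \int[mu]_(s in `[0%R, +oo[) (g s)%:E)%E.

Lemma probability_nneg nu : nu `]-oo, 0%R[%classic = 0%E -> nu `[0, +oo[%classic = 1%E.
Proof.
move=> n0; rewrite -(setCitvl (BLeft 0)) probability_setC//.
by rewrite [X in (_ - X)%E](_ : _ = 0%E) ?sube0.
Qed.

Lemma integral_nneg_support nu (h : R -> \bar R) : nu `]-oo, 0%R[%classic = 0%E ->
  measurable_fun [set: R] h -> (forall s, 0 <= h s)%E ->
  (\int[nu]_s h s = \int[nu]_(s in `[0%R, +oo[) h s)%E.
Proof.
move=> n0 mh h0; rewrite -(setCitvl (BLeft 0)) -setTD.
by apply: ge0_negligible_integral => //; exact: measurable_funTS.
Qed.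

Lemma ex_conditional_law (f : R -> R) (mf : measurable_fun [set: R] f) (f0 : forall t, 0 <= f t)
    (f1 : (\int[leb]_t (f t)%:E = 1)%E) A :
  density_law mf f0 f1 `]-oo, 0%R[%classic = 0%E -> measurable A ->
  exists mu, conditional_law (density_law mf f0 f1) A mu.
Proof.
pose nu : probability R R := density_law mf f0 f1.
change (nu `]-oo, 0%R[%classic = 0%E -> measurable A -> exists mu, conditional_law nu A mu).
move=> n0 mA.
have nu1 : nu `[0, +oo[%classic = 1%E by exact: probability_nneg.
pose P0 : set R := `[0, +oo[%classic.
have mP0 : measurable P0 by rewrite /P0.
have mI B : measurable B -> measurable_fun [set: R] (\1_B : R -> R).
  by move=> mB; exact: bmeas_measurable (bmeas_indic mB).
(* For a null event any law on the half-line will do. Otherwise the law has density [f / nu A] on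
   the nonnegative part of [A], and [nu] charges no negative number. *)
have [p0|p0] := eqVneq (nu A) 0%E.
  exists nu; split => // g mg g0; rewrite p0 mul0e.
  transitivity (\int[nu]_(s in A) (g s)%:E)%E.
    rewrite [RHS]integral_mkcond; apply: eq_integral => s _; rewrite patchE indicE.
    by case: (s \in A); rewrite ?mul1r ?mul0r.
  by apply: null_set_integral => //; exact/measurable_funTS/measurable_EFinP.
set p := fine (nu A).
have pE : p%:E = nu A by rewrite /p fineK// fin_num_measure.
have p_gt0 : 0 < p by rewrite -lte_fin pE lt_neqAle eq_sym p0 measure_ge0.
pose k s := p^-1 * (\1_A s * (\1_P0 s * f s)).
have mk : measurable_fun [set: R] k.
  apply: measurable_funM => //; apply: measurable_funM; first exact: mI.
  by apply: measurable_funM => //; exact: mI.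
have k0 s : 0 <= k s by rewrite /k !mulr_ge0// ?invr_ge0 ?indicE// ltW.
have intA : (\int[nu]_s (\1_A s * 1)%:E = p%:E)%E.
  by under eq_integral do rewrite mulr1; rewrite integral_indic// setIT pE.
have key g : measurable_fun [set: R] g -> (forall s, 0 <= g s) ->
    (\int[leb]_s ((\1_P0 s * g s * k s)%:E) = (p^-1)%:E * \int[nu]_s (\1_A s * g s)%:E)%E.
  move=> mg g0.
  have mAg : measurable_fun [set: R] (fun s => (\1_A s * g s)%:E).
    by apply/measurable_EFinP; apply: measurable_funM => //; exact: mI.
  have Ag0 s : (0 <= (\1_A s * g s)%:E)%E by rewrite lee_fin mulr_ge0// indicE.
  rewrite (integral_nneg_support n0)// (_ : (\int[nu]_(s in `[0%R, +oo[) _ =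
      \int[nu]_s (\1_P0 s * (\1_A s * g s))%:E)%E); last first.
    rewrite [LHS]integral_mkcond; apply: eq_integral => s _; rewrite patchE [\1_P0 s]indicE.
    by case: (s \in _); rewrite ?mul1r ?mul0r.
  have mPAg : measurable_fun [set: R] (fun s => (\1_P0 s * (\1_A s * g s))%:E).
    apply/measurable_EFinP; apply: measurable_funM; first exact: mI.
    by apply: measurable_funM => //; exact: mI.
  have PAg0 s : (0 <= (\1_P0 s * (\1_A s * g s))%:E)%E.
    by rewrite lee_fin !mulr_ge0// indicE.
  rewrite (ge0_integral_density_law mf f0 f1 mPAg PAg0) -ge0_integralZl//=.
  - apply: eq_integral => s _ /=; rewrite -!EFinM; congr EFin.
    rewrite /k [\1_P0 s]indicE; case: (s \in P0) => /=; last by rewrite !mul0r !mulr0.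
    by rewrite !mul1r; ring.
  - by apply: emeasurable_funM => //; exact/measurable_EFinP.
  - by move=> s _; rewrite mule_ge0// lee_fin.
  - by rewrite lee_fin invr_ge0 ltW.
have k1 : (\int[leb]_s (k s)%:E = 1)%E.
  have := key (fun=> 1) (@measurable_cst _ _ _ _ _ _) (fun=> ler01).
  rewrite intA -EFinM mulVf ?gt_eqF// => <-; apply: eq_integral => s _; congr EFin.
  rewrite /k [\1_P0 s]indicE; case: (s \in P0) => /=; first by rewrite !mul1r.
  by rewrite !mul0r !mulr0.
exists (density_law mk k0 k1).
have int_law g : measurable_fun [set: R] g -> (forall s, 0 <= g s) ->
    (\int[density_law mk k0 k1]_(s in P0) (g s)%:E = (p^-1)%:E * \int[nu]_s (\1_A s * g s)%:E)%E.
  move=> mg g0; rewrite -key// (_ : (\int[density_law mk k0 k1]_(s in P0) _ =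
      \int[density_law mk k0 k1]_s (\1_P0 s * g s)%:E)%E); last first.
    rewrite [LHS]integral_mkcond; apply: eq_integral => s _; rewrite patchE indicE.
    by case: (s \in _); rewrite ?mul1r ?mul0r.
  rewrite ge0_integral_density_law//.
  - by apply/measurable_EFinP; apply: measurable_funM => //; exact: mI.
  - by move=> s; rewrite lee_fin mulr_ge0// indicE.
split.
  have := int_law (fun=> 1) (@measurable_cst _ _ _ _ _ _) (fun=> ler01).
  rewrite integral_cst//= mul1e => ->.
  by rewrite intA -EFinM mulVf ?gt_eqF.
by move=> g mg g0; rewrite int_law// muleA -EFinM divff ?gt_eqF// mul1e.
Qed.

Lemma conditional_law_Enu nu A mu g : conditional_law nu A mu -> bmeas g -> (forall s, 0 <= g s) ->
  (\int[nu]_s (\1_A s * g s)%:E = (fine (nu A) * Enu mu g)%:E)%E.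
Proof.
move=> [mu1 H] bg g0; rewrite H//; last exact: bmeas_measurable.
rewrite EFinM; congr (_ * _)%E; rewrite /Enu /Rintegral fineK//; apply: integrable_fin_num => //.
exact: bmeas_nu_integrable.
Qed.

Lemma iter_TopZ nu k c h t : nu `[0, +oo[%classic = 1%E -> bmeas h ->
  iter k (Top nu) (fun s => c * h s) t = c * iter k (Top nu) h t.
Proof.
move=> nn bh; elim: k t => [//|k IH] t /=.
rewrite -TopZ//; last exact: bmeas_iter_Top.
by apply: eq_Enu => s _; exact: IH.
Qed.

Section peel_cond.
Variables (nu : probability R R) (D : set (R * R)) (cond : R -> probability R R).
Let section x : set R := [set s | D (x, s)].
Hypothesis condP : forall x, conditional_law nu (section x) (cond x).

Lemma pstep_cond b (h : R -> R -> R) x t :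
  (forall y, bmeas (h y)) -> (forall y u, 0 <= h y u) ->
  pstep nu D b (fun z => (h z.1 z.2)%:E) (x, t) =
  (fine (nu (section x)) * (if b then Top (cond x) (h x) t else h x t))%:E.
Proof.
move=> bh h0; rewrite /pstep /=.
have sE s : \1_D (x, s) = \1_(section x) s :> R.
  have e : ((x, s) \in D) = (s \in section x) by apply/idP/idP; rewrite !inE.
  by rewrite !indicE e.
under eq_integral do rewrite -EFinM sE.
case: b => /=.
  under eq_integral do rewrite mul1r.
  by rewrite (conditional_law_Enu (condP x))//; exact: bmeas_shift.
under eq_integral do rewrite mul0r subr0.
rewrite (conditional_law_Enu (condP x))//; last exact: bmeas_cst.
by rewrite Enu_cst//; case: (condP x).
Qed.

(** Every agent contributes the probability of its constraint, and a predecessor contributes one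
    convolution step besides. Only the number of predecessors survives: this is where the ordering
    becomes a random walk. *)
Lemma peel_cond s (h : R -> R -> R) x t :
  (forall y, bmeas (h y)) -> (forall y u, 0 <= h y u) ->
  peel nu D s (fun z => (h z.1 z.2)%:E) (x, t) =
  (fine (nu (section x)) ^+ size s * iter (count id s) (Top (cond x)) (h x) t)%:E.
Proof.
elim: s h => [|b s IH] h bh h0 /=; first by rewrite mul1r.
pose h' y u := fine (nu (section y)) * (if b then Top (cond y) (h y) u else h y u).
have bb y : bmeas (fun u => if b then Top (cond y) (h y) u else h y u).
  by case: b {h'} => //; apply: bmeas_Top => //; case: (condP y).
have -> : pstep nu D b (fun z => (h z.1 z.2)%:E) = (fun z => (h' z.1 z.2)%:E).
  by apply/funext => -[y u]; rewrite pstep_cond.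
rewrite IH => [|y|y u].
- rewrite /h' iter_TopZ//; last by case: (condP x).
  rewrite exprSr -mulrA; congr (_ * (_ * _))%:E.
  by case: b {h' bb} => //; rewrite add1n -iterSr.
- exact: bmeasZ.
- rewrite /h' mulr_ge0 ?fine_ge0//; case: b {h' bb} => //.
  by apply: Enu_ge0.
Qed.

End peel_cond.
End conditional_law.

(** * Shapley values of the extremal agents *)

Section extremal_agent.
Context {R : realType}.
Variable nu : probability R R.
Context d (T : measurableType d) (P : probability T R) (n : nat).
Variables (X : 'I_n.+1 -> T -> R).
Hypothesis mX : forall i, measurable_fun [set: T] (X i).
Hypothesis X_law : forall i (B : set R), measurable B -> P (X i @^-1` B) = nu B.
Hypothesis X_indep : forall B : 'I_n.+1 -> set R, (forall i, measurable (B i)) ->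
  P (\bigcap_(i in setT) (X i @^-1` B i)) = (\prod_(i < n.+1) P (X i @^-1` B i))%E.
Hypothesis nu_atomless : forall x, nu [set x] = 0%E.
Variables (D : set (R * R)) (arg : ('I_n.+1 -> R) -> 'I_n.+1).
Hypothesis mD : measurable D.
Hypothesis arg_pattern : forall v v' : 'I_n.+1 -> R,
  (forall i j, (v i <= v j) = (v' i <= v' j)) -> arg v = arg v'.
Hypothesis argP : forall v : 'I_n.+1 -> R, (forall i j, i != j -> v i != v j) ->
  forall i, arg v = i <-> forall j, j != i -> D (v i, v j).

Definition others (i : 'I_n.+1) : seq 'I_n.+1 := [seq j <- index_enum 'I_n.+1 | j != i].

Lemma uniq_others i : uniq (i :: others i).
Proof. by rewrite /= mem_filter eqxx/= filter_uniq// index_enum_uniq. Qed.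

Lemma size_others i : size (others i) = n.
Proof.
rewrite size_filter -sum1_count.
have : (\sum_(j < n.+1) 1 = n.+1)%N by rewrite sum1_card card_ord.
by rewrite (bigD1 i)//= add1n => -[].
Qed.

Lemma measurable_tie i j : measurable [set w | X i w = X j w].
Proof.
rewrite (_ : [set w | X i w = X j w] = [set w | (X i w == X j w) = true]); last first.
  by apply/seteqP; split => w /=; [move=> /eqP|move=> /eqP].
have := measurable_fun_eqr (mX i) (mX j).
by move=> /(_ measurableT [set true] I); rewrite setTI.
Qed.

(** Peeling with the diagonal as constraint: given [X i], the weight [X j] would have to hit one
    point, and there are no atoms. *)
Lemma tie_negligible i j : i != j -> P [set w | X i w = X j w] = 0%E.
Proof.
move=> ij; pose E : set (R * R) := [set z | z.1 = z.2].
have mE : measurable E.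
  rewrite (_ : E = [set z | (z.1 == z.2) = true]); last first.
    by apply/seteqP; split => z /=; [move=> /eqP|move=> /eqP].
  have := @measurable_fun_eqr _ _ R setT fst snd (measurable_fst) (measurable_snd).
  by move=> /(_ measurableT [set true] I); rewrite setTI.
have us : uniq [:: i; j] by rewrite /= inE ij.
have := @integral_peel R nu E mE d T P n.+1 X mX X_law X_indep i [:: j] (fun=> false)
  (fun=> 1%E) 0 us (@measurable_cst _ _ _ _ _ _) (fun=> lee01).
rewrite [X in _ = X](_ : _ = 0%E); last first.
  rewrite integral0_eq// => x _; rewrite /= /pstep /=.
  under eq_integral do rewrite mule1.
  rewrite (_ : (fun s => _) = fun s => (\1_[set x] s)%:E); last first.
    apply/funext => s; congr EFin; rewrite !indicE; congr (_%:R); congr nat_of_bool.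
    by apply/idP/idP; rewrite !inE/E/=.
  by rewrite integral_indic// setIT; exact: nu_atomless.
under eq_integral do rewrite big_seq1 mule1.
have mt := measurable_tie i j.
by move=> <-; rewrite -[in LHS](setIT [set w | _]) -integral_indic.
Qed.

Definition ties : set T := \bigcup_(z in [set z : 'I_n.+1 * 'I_n.+1 | z.1 != z.2])
  [set w | X z.1 w = X z.2 w].

Lemma measurable_ties : measurable ties.
Proof. by apply: fin_bigcup_measurable => // z _; exact: measurable_tie. Qed.

Lemma ties_negligible : P ties = 0%E.
Proof.
pose F k : set T := if unpickle k is Some z then
  (if z.1 != z.2 :> 'I_n.+1 then [set w | X z.1 w = X z.2 w] else set0) else set0.
have N : P.-negligible (\bigcup_k F k).
  apply: negligible_bigcup => k; rewrite /F; case: unpickle => [[i j]|]; last exact: negligible_set0.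
  case: ifPn => /= ij; last exact: negligible_set0.
  by apply/negligibleP; [exact: measurable_tie|exact: tie_negligible].
apply: (measure_negligible measurable_ties); apply: negligibleS N => w [z /= z12 zw].
by exists (pickle z) => //; rewrite /F pickleK z12.
Qed.

(** The extremal agent depends only on the outcome of the pairwise comparisons, of which there are
    finitely many. *)
Lemma measurable_pattern (i : 'I_n.+1) : measurable [set w | arg (X ^~ w) = i].
Proof.
pose pat (v : 'I_n.+1 -> R) : {ffun 'I_n.+1 * 'I_n.+1 -> bool} :=
  [ffun z => v z.1 <= v z.2].
rewrite (_ : [set w | _] = \bigcup_(m in [set m | exists2 v, pat v = m & arg v = i])
   [set w | pat (X ^~ w) = m]); last first.
  apply/seteqP; split => w /=.
    by move=> wi; exists (pat (X ^~ w)) => //=; exists (X ^~ w).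
  move=> [m /= [v vm <-] wm]; apply: arg_pattern => k l.
  by move: wm; rewrite -vm => /ffunP/(_ (k, l)); rewrite !ffunE.
apply: fin_bigcup_measurable => // m _.
rewrite (_ : [set w | _] = \bigcap_(z in setT) [set w | (X z.1 w <= X z.2 w) = m z]); last first.
  apply/seteqP; split => w /=.
    by move=> wm z _ /=; rewrite -wm ffunE.
  by move=> wm; apply/ffunP => z; rewrite ffunE; exact: wm.
apply: fin_bigcap_measurable => // z _.
have := measurable_fun_ler (mX z.1) (mX z.2).
by move=> /(_ measurableT [set m z] I); rewrite setTI.
Qed.

(** The event that [i] is extremal in product form, as peeling needs it; the two agree off the ties,
    which are negligible. *)
Definition beats i w : R := \prod_(j <- others i) \1_D (X i w, X j w).

Lemma measurable_beats i : measurable_fun [set: T] (beats i).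
Proof. by apply: measurable_prod => j _; exact: measurable_indic2. Qed.

Lemma beats_ge0 i w : 0 <= beats i w.
Proof. by apply: prodr_ge0 => j _; rewrite indicE. Qed.

Lemma beatsE i w : ~ ties w -> beats i w = (arg (X ^~ w) == i)%:R.
Proof.
move=> nt; have ntv k l : k != l -> X k w != X l w.
  by move=> kl; apply/eqP => e; apply: nt; exists (k, l).
have H := argP ntv i; case: eqP => [/H wi|/H wi].
  rewrite /beats big_filter big1// => j ji; rewrite indicE mem_set//; exact: wi.
have [j ji nD] : exists2 j, j != i & ~ D (X i w, X j w).
  by apply: contra_notP wi => h j ji; apply: contra_notP h => nD; exists j.
by rewrite /beats big_filter (bigD1 j)//= indicE memNset// mul0r.
Qed.

Lemma integral_arg (g : 'I_n.+1 -> T -> R) :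
  (forall i, measurable_fun [set: T] (g i)) -> (forall i w, 0 <= g i w) ->
  (\int[P]_w (g (arg (X ^~ w)) w)%:E = \sum_(i < n.+1) \int[P]_w (beats i w * g i w)%:E)%E.
Proof.
move=> mg g0.
have gE w : g (arg (X ^~ w)) w =
    \sum_(i < n.+1) \1_[set w | arg (X ^~ w) = i] w * g i w.
  rewrite (bigD1 (arg (X ^~ w)))//= indicE mem_set// mul1r big1 ?addr0// => i ia.
  by rewrite indicE memNset ?mul0r//= => e; rewrite e eqxx in ia.
have mI i : measurable_fun [set: T] (\1_[set w | arg (X ^~ w) = i] : T -> R).
  exact: measurable_indic (measurable_pattern i).
rewrite -ge0_integral_sum//; last 2 first.
- by move=> i; apply/measurable_EFinP; apply: measurable_funM => //; exact: measurable_beats.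
- by move=> i w _; rewrite lee_fin mulr_ge0// beats_ge0.
apply: ae_eq_integral => //.
- apply/measurable_EFinP; under eq_fun do rewrite gE.
  by apply: measurable_sum => i; exact: measurable_funM.
- apply: emeasurable_sum => i; apply/measurable_EFinP; apply: measurable_funM => //.
  exact: measurable_beats.
- exists ties; split; [exact: measurable_ties|exact: ties_negligible|].
  move=> w /=; apply: contra_notP => nt _; rewrite gE -sumEFin.
  apply: eq_bigr => i _; rewrite beatsE// indicE; congr (_ * _)%:E; congr (_%:R).
  by congr nat_of_bool; apply/idP/eqP; rewrite inE.
Qed.

Lemma measurable_window : measurable_fun [set: R * R] (fun z => window z.1 z.2).
Proof.
pose W : set (R * R) := [set z | (0 < z.2) && (z.2 <= z.1)].
have mW : measurable W.
  have m1 : measurable_fun [set: R * R] (fun z : R * R => 0 < z.2).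
    by apply: measurable_fun_ltr => //; exact: measurable_snd.
  have m2 : measurable_fun [set: R * R] (fun z : R * R => z.2 <= z.1).
    by apply: measurable_fun_ler; [exact: measurable_snd|exact: measurable_fst].
  have := measurable_and m1 m2.
  by move=> /(_ measurableT [set true] I); rewrite setTI.
rewrite (_ : (fun z => _) = \1_W); first exact: measurable_indic.
apply/funext => z; rewrite /window !indicE; congr (_%:R); congr nat_of_bool.
Qed.

Lemma emeasurable_window : measurable_fun [set: R * R] (fun z => (window z.1 z.2)%:E).
Proof. by apply/measurable_EFinP; exact: measurable_window. Qed.

Lemma window_ge0E (z : R * R) : (0 <= (window z.1 z.2)%:E)%E.
Proof. by rewrite lee_fin /window indicE. Qed.

Variable cond : R -> probability R R.
Hypothesis condP : forall x, conditional_law nu [set s | D (x, s)] (cond x).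

Let p x := fine (nu [set s | D (x, s)]).

Lemma count_predecessors (s : 'S_n.+1) i :
  count id [seq (s j < s i)%N | j <- others i] = s i.
Proof.
rewrite count_map count_filter -sum1_count.
rewrite (eq_bigl (fun j => (s j < s i)%N)); last first.
  by move=> j /=; case: eqVneq => [->|_]; rewrite ?ltnn ?andbT.
rewrite [LHS](_ : _ = \sum_(k < n.+1 | (k < s i)%N) 1)%N; last first.
  by rewrite [RHS](reindex_inj (@perm_inj _ s)).
by rewrite (big_ord_narrow (ltnW (ltn_ord (s i)))) sum1_card card_ord.
Qed.

Lemma integral_beats_window (s : 'S_n.+1) i Q :
  (\int[P]_w (beats i w * window (X i w) (Q - pred_weight (X ^~ w) s i))%:E =
   \int[nu]_x (p x ^+ n * iter (s i) (Top (cond x)) (window x) Q)%:E)%E.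
Proof.
have := @integral_peel R nu D mD d T P n.+1 X mX X_law X_indep i (others i)
  (fun j => (s j < s i)%N) (fun z => (window z.1 z.2)%:E) Q (uniq_others i) emeasurable_window window_ge0E.
rewrite (_ : (\int[nu]_x _ = \int[nu]_x (p x ^+ n * iter (s i) (Top (cond x)) (window x) Q)%:E)%E); last first.
  apply: eq_integral => x _.
  rewrite (peel_cond condP _ _ _ (fun y => bmeas_window y))/=; last first.
    by move=> y u; rewrite /window indicE.
  by rewrite size_map size_others count_predecessors.
move=> <-; apply: eq_integral => w _; rewrite EFinM; congr (_ * _)%E; congr (window _ _)%:E.
congr (_ - _); rewrite /pred_weight big_mkcond (bigD1 i)//= ltnn add0r big_filter.
by apply: eq_bigr => j _; case: (_ < _)%N; rewrite ?mul1r ?mul0r.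
Qed.

(** No measurability of [cond x] in [x] is assumed. The expression is recognised as a [peel] with
    [k] predecessors and [n - k] successors, which is measurable by Tonelli's theorem. *)
Lemma measurable_beats_pivot k Q : (k <= n)%N ->
  measurable_fun [set: R] (fun x => p x ^+ n * iter k (Top (cond x)) (window x) Q).
Proof.
move=> kn; apply/measurable_EFinP.
pose s := nseq k true ++ nseq (n - k) false.
rewrite (_ : _ \o _ = fun x => peel nu D s (fun z => (window z.1 z.2)%:E) (x, Q)).
  apply: measurableT_comp; last exact: measurable_fun_pair.
  apply: measurable_peel => //; first exact: emeasurable_window.
  exact: window_ge0E.
apply/funext => x; rewrite (peel_cond condP _ _ _ (fun y => bmeas_window y))/=; last first.
  by move=> y u; rewrite /window indicE.
by rewrite size_cat !size_nseq subnKC// count_cat !count_nseq mul1n mul0n addn0.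
Qed.

Lemma beats_pivot_ge0 k Q x : 0 <= p x ^+ n * iter k (Top (cond x)) (window x) Q.
Proof.
rewrite mulr_ge0 ?exprn_ge0 ?fine_ge0//.
by apply: (@iter_Top_ge0 _ _ _ _ Q) => // s _; rewrite /window indicE.
Qed.

Lemma shapleyE (v : 'I_n.+1 -> R) i Q : shapley v i Q =
  (n.+1)`!%:R^-1 * \sum_(s : 'S_n.+1) window (v i) (Q - pred_weight v s i).
Proof.
rewrite /shapley mulrC; congr (_ * _).
transitivity (\sum_(s : 'S_n.+1)
    ((Q - v i <= pred_weight v s i) && (pred_weight v s i < Q))%:R : R).
  rewrite -sum1_card natr_sum [LHS]big_mkcond; apply: eq_bigr => s _.
  rewrite (_ : (s \in _) = (Q - v i <= pred_weight v s i < Q)); first by case: ifP.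
  exact: asboolb.
apply: eq_bigr => s _; rewrite /window indicE.
have -> : (Q - pred_weight v s i \in `]0, v i]%classic) =
   (Q - v i <= pred_weight v s i) && (pred_weight v s i < Q).
  by apply/idP/idP; rewrite inE/= in_itv/= subr_gt0 lerBlDr lerBlDr addrC andbC.
by [].
Qed.

Lemma measurable_pivot s i Q :
  measurable_fun [set: T] (fun w => window (X i w) (Q - pred_weight (X ^~ w) s i)).
Proof.
have mW : measurable_fun [set: R * R] (fun z => window z.1 z.2).
  exact: measurable_window.
apply: (measurableT_comp (g := fun w => (X i w, Q - pred_weight (X ^~ w) s i)) mW).
apply: measurable_fun_pair => //; apply: measurable_funB => //.
rewrite /pred_weight; under eq_fun do rewrite big_mkcond.
by apply: measurable_sum => j; case: (s j < s i)%N.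
Qed.

Lemma measurable_shapley i Q : measurable_fun [set: T] (fun w => shapley (X ^~ w) i Q).
Proof.
under eq_fun do rewrite shapleyE.
apply: measurable_funM => //; apply: measurable_sum => s; exact: measurable_pivot.
Qed.

Lemma shapley_ge0 (v : 'I_n.+1 -> R) i Q : 0 <= shapley v i Q.
Proof. by rewrite /shapley divr_ge0. Qed.

(** For a fixed ordering, the positions of the agents run once through [0, ..., n], so summing over
    the agents yields the whole of [renewals]. Each of the orderings gives the same amount, and
    their number cancels the factorial. *)
Lemma integral_shapley_arg Q :
  (\int[P]_w (shapley (X ^~ w) (arg (X ^~ w)) Q)%:E =
   \int[nu]_x (p x ^+ n * renewals (cond x) x n.+1 Q)%:E)%E.
Proof.
rewrite (integral_arg (g := fun i w => shapley (X ^~ w) i Q)); last 2 first.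
- by move=> i; exact: measurable_shapley.
- by move=> i w; exact: shapley_ge0.
pose U k := (\int[nu]_x (p x ^+ n * iter k (Top (cond x)) (window x) Q)%:E)%E.
have c0 : 0 <= (n.+1)`!%:R^-1 :> R by rewrite invr_ge0.
transitivity (\sum_(i < n.+1) ((n.+1)`!%:R^-1)%:E * \sum_(s : 'S_n.+1) U (s i))%E.
  apply: eq_bigr => i _.
  rewrite (_ : (\int[P]_w _ = \int[P]_w (((n.+1)`!%:R^-1)%:E *
      \sum_(s : 'S_n.+1) (beats i w * window (X i w) (Q - pred_weight (X ^~ w) s i))%:E))%E); last first.
    apply: eq_integral => w _; rewrite shapleyE mulrCA EFinM; congr (_ * _)%E.
    by rewrite sumEFin mulr_sumr.
  have mb s : measurable_fun [set: T]
      (fun w => (beats i w * window (X i w) (Q - pred_weight (X ^~ w) s i))%:E).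
    apply/measurable_EFinP; apply: measurable_funM; first exact: measurable_beats.
    exact: measurable_pivot.
  have b0 s w : (0 <= (beats i w * window (X i w) (Q - pred_weight (X ^~ w) s i))%:E)%E.
    by rewrite lee_fin mulr_ge0 ?beats_ge0// /window indicE.
  rewrite ge0_integralZl//; last 2 first.
  - exact: emeasurable_sum.
  - by move=> w _; exact: sume_ge0.
  congr (_ * _)%E; rewrite ge0_integral_sum//.
  by apply: eq_bigr => s _; exact: integral_beats_window.
have U0 k : (0 <= U k)%E by apply: integral_ge0 => x _; rewrite lee_fin beats_pivot_ge0.
rewrite -ge0_sume_distrr; last by move=> i _; exact: sume_ge0.
rewrite exchange_big/= (eq_bigr (fun=> \sum_(k < n.+1) U k)%E); last first.
  by move=> s _; rewrite [RHS](reindex_inj (@perm_inj _ s)).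
have UE : (\sum_(k < n.+1) U k = \int[nu]_x (p x ^+ n * renewals (cond x) x n.+1 Q)%:E)%E.
  rewrite /U -ge0_integral_sum//; last 2 first.
  - by move=> k; apply/measurable_EFinP; apply: measurable_beats_pivot; rewrite -ltnS.
  - by move=> k x _; rewrite lee_fin beats_pivot_ge0.
  by apply: eq_integral => x _; rewrite sumEFin /renewals mulr_sumr.
rewrite UE; move: (\int[nu]_x _)%E => V.
rewrite (eq_bigr (fun=> 1%:E * V)%E); last by move=> *; rewrite mul1e.
rewrite -ge0_sume_distrl// sumEFin sumr_const card_Sn muleA -EFinM mulVf ?mul1e//.
Qed.

(** The [n + 1] agents contribute equally, which cancels the factor [1 / (n + 1)]. Both sides of the
    theorem thus become integrals against the same [p x ^+ n]. *)
Lemma integral_arg_value (h : R -> R) : measurable_fun [set: R] h -> (forall x, 0 <= h x) ->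
  ((n.+1)%:R^-1%:E * \int[P]_w (h (X (arg (X ^~ w)) w))%:E =
   \int[nu]_x (p x ^+ n * h x)%:E)%E.
Proof.
move=> mh h0.
rewrite (integral_arg (g := fun i w => h (X i w))); last 2 first.
- by move=> i; exact: measurableT_comp.
- by move=> i w; exact: h0.
pose h2 (z : R * R) : \bar R := (h z.1)%:E.
have mh2 : measurable_fun [set: R * R] h2.
  by apply/measurable_EFinP; apply: measurableT_comp => //; exact: measurable_fst.
have h20 z : (0 <= h2 z)%E by rewrite lee_fin.
have nn x : cond x `[0, +oo[%classic = 1%E by case: (condP x).
have key i : (\int[P]_w (beats i w * h (X i w))%:E = \int[nu]_x (p x ^+ n * h x)%:E)%E.
  have := @integral_peel R nu D mD d T P n.+1 X mX X_law X_indep i (others i)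
    (fun=> false) h2 0 (uniq_others i) mh2 h20.
  rewrite (_ : (\int[nu]_x _ = \int[nu]_x (p x ^+ n * h x)%:E)%E); last first.
    apply: eq_integral => x _.
    rewrite (peel_cond condP _ _ _ (h := fun y _ => h y) (fun y => bmeas_cst (h y)))//.
    rewrite size_map size_others (_ : count _ _ = 0%N)//.
    by rewrite count_map; apply/eqP; rewrite -leqn0 leqNgt -has_count; apply/hasPn.
  by move=> <-; apply: eq_integral => w _; rewrite EFinM.
under eq_bigr do rewrite key.
set V := (\int[nu]_x _)%E.
rewrite (eq_bigr (fun=> 1%:E * V)%E); last by move=> *; rewrite mul1e.
rewrite -ge0_sume_distrl// sumEFin sumr_const card_ord muleA -EFinM mulVf ?mul1e//.
Qed.

End extremal_agent.


Section extremal_agents.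
Context {R : realType} (n : nat).
Implicit Types v : 'I_n.+1 -> R.

Lemma argmax_pattern v v' : (forall i j, (v i <= v j) = (v' i <= v' j)) ->
  argmax_agent v = argmax_agent v'.
Proof.
move=> H; rewrite /argmax_agent /Order.arg_max /extremum; congr (odflt _ _).
by apply: eq_pick => i /=; apply: eq_forallb => j; rewrite H.
Qed.

Lemma argmin_pattern v v' : (forall i j, (v i <= v j) = (v' i <= v' j)) ->
  argmin_agent v = argmin_agent v'.
Proof.
move=> H; rewrite /argmin_agent /Order.arg_min /extremum; congr (odflt _ _).
by apply: eq_pick => i /=; apply: eq_forallb => j; rewrite H.
Qed.

Lemma argmax_agentP v : (forall i j, i != j -> v i != v j) ->
  forall i, argmax_agent v = i <-> forall j, j != i -> v j <= v i.
Proof.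
move=> nt i; rewrite /argmax_agent; case: Order.TotalTheory.arg_maxP => // a _ amax.
split=> [<- j _|imax]; first exact: amax.
apply/eqP; apply: contraT => ai.
have /negP[] := nt _ _ ai.
by rewrite eq_le imax//=; exact: amax.
Qed.

Lemma argmin_agentP v : (forall i j, i != j -> v i != v j) ->
  forall i, argmin_agent v = i <-> forall j, j != i -> v i <= v j.
Proof.
move=> nt i; rewrite /argmin_agent; case: Order.TotalTheory.arg_minP => // a _ amin.
split=> [<- j _|imin]; first exact: amin.
apply/eqP; apply: contraT => ai.
have /negP[] := nt _ _ ai.
by rewrite eq_le imin// andbT; exact: amin.
Qed.

End extremal_agents.

(** * Averaging the renewal error over the extremal weight *)

Section game_error.
Context {R : realType}.
Variable nu : probability R R.
Hypothesis nu_neg : nu `]-oo, 0%R[%classic = 0%E.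
Hypothesis nu_atomless : forall x, nu [set x] = 0%E.
Variables (lam M0 : R).
Hypothesis lam_gt0 : 0 < lam.
Hypothesis nu_exp : nu_integrable nu (fun s => expR (lam * s)).
Hypothesis nu_expM : Enu nu (fun s => expR (lam * s)) <= M0.

Lemma linear_expR_le c x : 0 <= c -> c <= lam / 4 -> 0 <= x ->
  (1 + x) * expR (c * x) <= (1 + 4 / lam) * expR (lam * x).
Proof.
move=> c0 cl x0; rewrite (mulrDl 1 x) (mulrDl 1 (4 / lam)) !mul1r; apply: lerD.
  by rewrite ler_expR; apply: ler_wpM2r => //; lra.
have := mul_expR_le lam_gt0 c0 cl (lexx 0) x0.
by rewrite mulr0 mul0r oppr0 expR0 mulr1.
Qed.

Lemma renewals_ge0 (mu : probability R R) x N t : 0 <= renewals mu x N t.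
Proof.
by apply: sumr_ge0 => k _; apply: (@iter_Top_ge0 _ _ _ _ t) => // s _; rewrite /window indicE.
Qed.

Lemma renewals_le (mu : probability R R) x N t : mu `[0, +oo[%classic = 1%E ->
  renewals mu x N t <= N%:R.
Proof.
move=> mu1.
have it k u : iter k (Top mu) (window x) u <= 1.
  elim: k u => [|k IH] u /=; first by rewrite /window indicE lern1 leq_b1.
  rewrite -(Top_cst mu1 1 u); apply: le_Top => //; last exact: bmeas_cst.
  by apply: bmeas_iter_Top => //; exact: bmeas_window.
rewrite -[leRHS](_ : \sum_(k < N) 1 = _); last by rewrite sumr_const card_ord.
by apply: ler_sum => k _; exact: it.
Qed.

Context d (T : measurableType d) (P : probability T R) (n : nat).
Variables (X : 'I_n.+1 -> T -> R).
Hypothesis mX : forall i, measurable_fun [set: T] (X i).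
Hypothesis X_law : forall i (B : set R), measurable B -> P (X i @^-1` B) = nu B.
Hypothesis X_indep : forall B : 'I_n.+1 -> set R, (forall i, measurable (B i)) ->
  P (\bigcap_(i in setT) (X i @^-1` B i)) = (\prod_(i < n.+1) P (X i @^-1` B i))%E.
Variables (D : set (R * R)) (arg : ('I_n.+1 -> R) -> 'I_n.+1).
Hypothesis mD : measurable D.
Hypothesis arg_pattern : forall v v' : 'I_n.+1 -> R,
  (forall i j, (v i <= v j) = (v' i <= v' j)) -> arg v = arg v'.
Hypothesis argP : forall v : 'I_n.+1 -> R, (forall i j, i != j -> v i != v j) ->
  forall i, arg v = i <-> forall j, j != i -> D (v i, v j).
Variable cond : R -> probability R R.
Hypothesis condP : forall x, conditional_law nu [set s | D (x, s)] (cond x).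
Let p x := fine (nu [set s | D (x, s)]).

Lemma measurable_section_power : measurable_fun [set: R] (fun x => p x ^+ n).
Proof.
apply/measurable_EFinP.
rewrite (_ : _ \o _ = fun x => peel nu D (nseq n false) (fun=> 1%E) (x, 0)).
  apply: measurableT_comp; last exact: measurable_fun_pair.
  by apply: measurable_peel => //; exact: measurable_cst.
apply/funext => x; rewrite (peel_cond condP _ _ _ (h := fun _ _ => 1) (fun=> bmeas_cst 1))//.
rewrite size_nseq count_nseq mul0n /= mulr1; congr (_ ^+ _)%:E.
Qed.

Lemma measurable_section_renewals Q :
  measurable_fun [set: R] (fun x => p x ^+ n * renewals (cond x) x n.+1 Q).
Proof.
rewrite (_ : (fun x => _) = fun x => \sum_(k < n.+1) p x ^+ n * iter k (Top (cond x)) (window x) Q).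
  by apply: measurable_sum => k; apply: (measurable_beats_pivot mD condP); rewrite -ltnS.
by apply/funext => x; rewrite /renewals mulr_sumr.
Qed.

Lemma Ex_shapley_arg Q : Ex P (fun w => shapley (X ^~ w) (arg (X ^~ w)) Q) =
  Enu nu (fun x => p x ^+ n * renewals (cond x) x n.+1 Q).
Proof.
rewrite /Ex (integral_shapley_arg mX X_law X_indep nu_atomless mD arg_pattern argP condP).
rewrite /Enu /Rintegral; congr fine; apply: integral_nneg_support => //.
  by apply/measurable_EFinP; exact: measurable_section_renewals.
by move=> x; rewrite lee_fin mulr_ge0 ?renewals_ge0// exprn_ge0// fine_ge0.
Qed.

(** [h] is known to be nonnegative on the half-line only. The nonnegative case is applied to its
    positive and negative parts, and the latter integrates to 0. *)
Lemma Ex_arg_value (h : R -> R) : measurable_fun [set: R] h -> (forall x, 0 <= x -> 0 <= h x) ->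
  n.+1%:R^-1 * Ex P (fun w => h (X (arg (X ^~ w)) w)) = Enu nu (fun x => p x ^+ n * h x).
Proof.
move=> mh h0.
have val g := integral_arg_value mX X_law X_indep nu_atomless mD arg_pattern argP condP (h := g).
have mp : measurable_fun [set: R] (fun x => Num.max (h x) 0) by exact: measurable_maxr.
have mn : measurable_fun [set: R] (fun x => Num.max (- h x) 0).
  by apply: measurable_maxr => //; exact: measurable_funN.
have p0 (g : R -> R) x : 0 <= Num.max (g x) 0 by rewrite le_max lexx orbT.
have Vp := val _ mp (p0 h); have Vn := val _ mn (p0 (fun x => - h x)).
have mpow := measurable_section_power.
have Enn (g : R -> R) : measurable_fun [set: R] g -> (forall x, 0 <= g x) ->
    fine (\int[nu]_x (p x ^+ n * g x)%:E) = Enu nu (fun x => p x ^+ n * g x).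
  move=> mg g0; rewrite /Enu /Rintegral; congr fine; apply: integral_nneg_support => //.
    by apply/measurable_EFinP; exact: measurable_funM.
  by move=> x; rewrite lee_fin mulr_ge0// exprn_ge0// fine_ge0.
have c_gt0 : 0 < n.+1%:R^-1 :> R by rewrite invr_gt0.
have Vn0 : (\int[P]_w (Num.max (- h (X (arg (X ^~ w)) w)) 0)%:E = 0)%E.
  move: Vn; rewrite (integral_nneg_support nu_neg); last 2 first.
  - by apply/measurable_EFinP; exact: measurable_funM.
  - by move=> x; rewrite lee_fin mulr_ge0// exprn_ge0// fine_ge0.
  rewrite [RHS]integral0_eq; last first.
    move=> x /=; rewrite in_itv/= andbT => x0.
    by rewrite max_r ?mulr0// oppr_le0 h0.
  by move/eqP; rewrite mule_eq0 eqe gt_eqF//= => /eqP.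
have -> : Ex P (fun w => h (X (arg (X ^~ w)) w)) =
    fine (\int[P]_w (Num.max (h (X (arg (X ^~ w)) w)) 0)%:E).
  rewrite /Ex; congr fine; rewrite integralE.
  rewrite (_ : (\int[P]_w _^\- w)%E = 0%E) ?sube0; last first.
    rewrite -[RHS]Vn0; apply: eq_integral => w _.
    by rewrite funenegE -EFinN -EFin_max.
  by apply: eq_integral => w _; rewrite funeposE -EFin_max.
have -> : Enu nu (fun x => p x ^+ n * h x) = Enu nu (fun x => p x ^+ n * Num.max (h x) 0).
  by apply: eq_Enu => x x0; rewrite max_l// h0.
rewrite -Enn// -Vp.
(* If the integral is infinite, [fine] turns both sides into 0. *)
case: (\int[P]_w _)%E => [v||] //=.
  by rewrite gt0_muley ?lte_fin//= mulr0.
by rewrite gt0_muleNy ?lte_fin//= mulr0.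
Qed.

Variables (rho : R -> R) (good : R -> Prop) (Q p0 C3 c K eta : R).
Hypothesis measurable_rho : measurable_fun [set: R] rho.
Hypothesis c_ge0 : 0 <= c.
Hypothesis c_le : c <= lam / 4.
Hypothesis K_ge0 : 0 <= K.
Hypothesis eta_ge0 : 0 <= eta.
Hypothesis p0_ge0 : 0 <= p0.
Hypothesis C3_ge0 : 0 <= C3.
Hypothesis rho_ge0 : forall x, 0 <= x -> 0 <= rho x.
Hypothesis bad_bound : forall x, 0 <= x -> ~ good x -> p x <= p0 /\ rho x <= C3.
Hypothesis good_bound : forall x, 0 <= x -> good x ->
  `|renewals (cond x) x n.+1 Q - rho x| <= K * (1 + x) * (expR (- (c * (Q - x))) + eta).

(** For bad [x] the factor [p x ^+ n] is at most [p0 ^+ n], and the crude bounds [n + 1] on the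
    renewals and [C3] on [rho] suffice. For good [x] the renewal error is dominated by a multiple of
    [expR (lam * x)], whose integral is at most [M0]. *)
Lemma game_error : `| Ex P (fun w => shapley (X ^~ w) (arg (X ^~ w)) Q) -
    n.+1%:R^-1 * Ex P (fun w => rho (X (arg (X ^~ w)) w)) | <=
  p0 ^+ n * (n.+1%:R + C3) + K * (1 + 4 / lam) * M0 * (expR (- (c * Q)) + eta).
Proof.
rewrite Ex_shapley_arg Ex_arg_value//.
have nn := probability_nneg nu_neg.
set S := expR (- (c * Q)) + eta.
have S0 : 0 <= S by rewrite addr_ge0// expR_ge0.
set A := p0 ^+ n * (n.+1%:R + C3).
have A0 : 0 <= A by rewrite /A; nonneg.
have k0 : 0 <= K * (1 + 4 / lam) * S.
  by apply: mulr_ge0 => //; apply: mulr_ge0 => //; rewrite addr_ge0// divr_ge0// ltW.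
pose B x := A + K * (1 + 4 / lam) * S * expR (lam * x).
have px0 x : 0 <= p x by rewrite fine_ge0.
have px1 x : p x <= 1.
  have mS : measurable [set s | D (x, s)].
    have := measurable_xsection x mD; congr measurable.
    by apply/seteqP; split => s /=; rewrite /xsection /= inE.
  by rewrite -lee_fin fineK ?fin_num_measure// probability_le1.
pose u x := p x ^+ n * renewals (cond x) x n.+1 Q.
pose v x := p x ^+ n * rho x.
have cnn x : cond x `[0, +oo[%classic = 1%E by case: (condP x).
have pn1 x : p x ^+ n <= 1 by rewrite exprn_ile1.
have pn0 x : 0 <= p x ^+ n by rewrite exprn_ge0.
have u0 x : 0 <= u x by rewrite mulr_ge0// renewals_ge0.
have un x : u x <= n.+1%:R.
  by rewrite -[leRHS]mul1r ler_pM// ?renewals_ge0 ?renewals_le.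
have uvB x : 0 <= x -> `|u x - v x| <= B x.
  move=> x0; rewrite /u /v -mulrBr normrM ger0_norm//.
  have [gx|bx] := pselect (good x).
    apply: (@le_trans _ _ (K * (1 + 4 / lam) * S * expR (lam * x))); last by rewrite lerDr.
    apply: (@le_trans _ _ (K * (1 + x) * (expR (- (c * (Q - x))) + eta))).
      by apply: le_trans (good_bound x0 gx); rewrite ler_piMl.
    have lin := linear_expR_le c_ge0 c_le x0.
    have -> : K * (1 + 4 / lam) * S * expR (lam * x) =
      K * ((1 + 4 / lam) * expR (lam * x)) * S by ring.
    apply: le_trans (ler_wpM2r S0 (ler_wpM2l K_ge0 lin)).
    rewrite -!mulrA; apply: ler_wpM2l => //; apply: ler_wpM2l; first by lra.
    rewrite /S [leRHS]mulrDr -expRD; apply: lerD.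
      by rewrite ler_expR; lra.
    by rewrite ler_peMl// -[leLHS]expR0 ler_expR mulr_ge0.
  have [pb rb] := bad_bound x0 bx.
  apply: (@le_trans _ _ A); last by rewrite lerDl mulr_ge0// expR_ge0.
  apply: ler_pM => //; first by rewrite lerXn2r ?nnegrE.
  apply: le_trans (ler_normB _ _) _; rewrite !ger0_norm ?renewals_ge0 ?rho_ge0//.
  by apply: lerD => //; exact: renewals_le.
have mu_ : measurable_fun [set: R] u by exact: measurable_section_renewals.
have mv : measurable_fun [set: R] v by apply: measurable_funM => //; exact: measurable_section_power.
have iB : nu_integrable nu B.
  by apply: nu_integrableD; [exact: nu_integrable_cst|exact: nu_integrableZ].
have iu : nu_integrable nu u.
  apply: nu_integrable_le mu_ (nu_integrable_cst nn n.+1%:R) _ => x x0.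
  by rewrite ger0_norm.
(* The integrability of the limit term is a consequence of the estimate itself: [v] is at most
   [u + B]. *)
have iv : nu_integrable nu v.
  apply: nu_integrable_le mv (nu_integrableD (nu_integrable_cst nn n.+1%:R) iB) _ => x x0.
  have v0 : 0 <= v x := mulr_ge0 (pn0 x) (rho_ge0 x0).
  have := uvB x x0; have := un x; rewrite (ger0_norm v0).
  by rewrite ler_norml => h1 /andP[h2 _]; lra.
have EB : Enu nu B <= A + K * (1 + 4 / lam) * M0 * S.
  rewrite EnuD; [|exact: nu_integrable_cst|exact: nu_integrableZ].
  rewrite Enu_cst// EnuZ// lerD2l.
  have -> : K * (1 + 4 / lam) * M0 * S = K * (1 + 4 / lam) * S * M0 by ring.
  exact: ler_wpM2l.
apply: le_trans EB; rewrite -/u -/v -EnuB// ler_norml.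
have iuv : nu_integrable nu (fun x => u x - v x).
  by have := nu_integrableD iu (nu_integrableZ (-1) iv); congr nu_integrable; apply/funext => x; rewrite mulN1r.
apply/andP; split; last first.
  by apply: le_Enu => // x x0; exact: le_trans (ler_norm _) (uvB x x0).
rewrite -mulN1r -EnuZ//; apply: le_Enu => //; first exact: nu_integrableZ.
move=> x x0; rewrite mulN1r lerNl; apply: le_trans (uvB x x0).
by rewrite -normrN; exact: ler_norm.
Qed.

End game_error.

(** * Moments and tails of a density *)

Section density_facts.
Context {R : realType}.
Notation leb := (@lebesgue_measure R).
Variable f : R -> R.
Hypothesis mf : measurable_fun [set: R] f.
Hypothesis f_ge0 : forall t, 0 <= f t.
Hypothesis f1 : (\int[leb]_t (f t)%:E = 1)%E.
Hypothesis f_neg : (\int[leb]_(t in `]-oo, 0%R[) (f t)%:E = 0)%E.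
Let nu : probability R R := density_law mf f_ge0 f1.

Lemma density_atomless x : nu [set x] = 0%E.
Proof. by rewrite /nu/= /density_law integral_set1. Qed.

Lemma density_ae_neg : {ae leb, forall x, x < 0 -> f x = 0}.
Proof.
have mN : measurable_fun (`]-oo, 0[%classic : set (measurableTypeR R)) (EFin \o f).
  by apply/measurable_EFinP; exact: measurable_funTS.
have := (ae_eq_integral_abs leb (measurable_itv `]-oo, (0:R)[) mN).1.
rewrite (_ : (\int[leb]_(x in `]-oo, 0%R[) `|(EFin \o f) x|)%E = 0%E); last first.
  by rewrite -f_neg; apply: eq_integral => x _ /=; rewrite ger0_norm.
move=> /(_ erefl); apply: filterS => x H x0.
by have := H; rewrite /= in_itv/= x0 => /(_ isT) [].
Qed.

(** The integrand [t * f t] may be negative, but only on a null set; replacing [s] by [posp s]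
    brings it within the scope of nonnegative integration. *)
Lemma first_moment (A : set R) : measurable A ->
  (\int[leb]_(t in A) (t * f t)%:E = \int[nu]_s (\1_A s * posp s)%:E)%E.
Proof.
move=> mA; have mA' : @measurable _ (measurableTypeR R) A by [].
have mI : measurable_fun [set: measurableTypeR R] (\1_A : R -> R).
  exact: bmeas_measurable (bmeas_indic mA).
have mpos : measurable_fun [set: R] (@posp R) by exact: measurable_maxr.
rewrite (ge0_integral_density_law mf f_ge0 f1); last 2 first.
- by apply/measurable_EFinP; exact: measurable_funM.
- by move=> s; rewrite lee_fin mulr_ge0 ?posp_ge0// indicE.
rewrite (_ : (\int[leb]_(t in A) _ = \int[leb]_t (\1_A t * (t * f t))%:E)%E); last first.
  rewrite [LHS]integral_mkcond; apply: eq_integral => s _; rewrite patchE indicE.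
  by case: (s \in A); rewrite ?mul1r ?mul0r.
apply: ae_eq_integral => //.
- apply/measurable_EFinP; apply: measurable_funM => //; exact: measurable_funM.
- apply: emeasurable_funM; last exact/measurable_EFinP.
  by apply/measurable_EFinP; exact: measurable_funM.
have [N [mN N0 nN]] := density_ae_neg; exists N; split => // x /= nx; apply: nN => /=.
apply: contra_not nx => fx _; rewrite -EFinM; congr EFin.
have [x0|x0] := ltP x 0; first by rewrite fx// !mulr0.
by rewrite posp_pos// mulrA.
Qed.

Lemma cond_first_moment (A : set R) mu : measurable A -> conditional_law nu A mu ->
  fine (\int[leb]_(t in A) (t * f t)%:E) = fine (nu A) * Enu mu (fun s => s).
Proof.
move=> mA [_ H]; rewrite first_moment// H; last 2 first.
- exact: measurable_maxr.
- exact: posp_ge0.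
rewrite /Enu /Rintegral.
rewrite (_ : (\int[mu]_(s in _) (posp s)%:E = \int[mu]_(s in `[0%R, +oo[) s%:E)%E); last first.
  by apply: eq_integral => s; rewrite inE/= in_itv/= andbT => s0; rewrite posp_pos.
have p0 : 0 <= fine (nu A) by rewrite fine_ge0.
have := integral_ge0 mu (D := `[0, +oo[%classic) (f := EFin).
move: p0; rewrite le_eqVlt => /predU1P[<-|p0]; first by rewrite mul0e mul0r.
case: (\int[mu]_(s in _) _)%E => [v||] //= _.
  by rewrite gt0_muley ?lte_fin//= mulr0.
by rewrite gt0_muleNy ?lte_fin//= mulr0.
Qed.

Variables (C lam0 : R).
Hypothesis C_gt0 : 0 < C.
Hypothesis lam0_gt0 : 0 < lam0.
Hypothesis f_le : forall t, 0 <= t -> f t <= C * expR (- (lam0 * t)).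
Let lam := lam0 / 2.
Let M0 := C / lam.

(** Halving the rate leaves room: [expR (lam * s) * f s <= C * expR (- lam * s)], which is [M0]
    times the exponential density of rate [lam]. *)
Lemma exp_moment_density :
  (\int[nu]_(s in `[0%R, +oo[) (expR (lam * s))%:E <= M0%:E)%E.
Proof.
have l0 : 0 < lam by rewrite divr_gt0.
have me : measurable_fun [set: R] (fun s => expR (lam * s)).
  by apply: measurableT_comp; [exact: measurable_expR|exact: measurable_funM].
have mI : measurable_fun [set: R] (\1_(`[0, +oo[%classic) : R -> R) by exact: measurable_indic.
rewrite (_ : (\int[nu]_(s in _) _ = \int[nu]_s (\1_(`[0, +oo[%classic) s * expR (lam * s))%:E)%E); last first.
  rewrite [LHS]integral_mkcond; apply: eq_integral => s _; rewrite patchE indicE.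
  by case: (s \in _); rewrite ?mul1r ?mul0r.
rewrite (ge0_integral_density_law mf f_ge0 f1); last 2 first.
- by apply/measurable_EFinP; exact: measurable_funM.
- by move=> s; rewrite lee_fin mulr_ge0 ?expR_ge0// indicE.
have mpdf := @measurable_exponential_pdf R lam.
have pdf0 x : 0 <= exponential_pdf lam x by apply: exponential_pdf_ge0; exact: ltW.
apply: (@le_trans _ _ (\int[leb]_s (M0%:E * (exponential_pdf lam s)%:E))%E); last first.
  rewrite ge0_integralZl//; last 3 first.
  - exact/measurable_EFinP.
  - by move=> x _; rewrite lee_fin.
  - by rewrite lee_fin divr_ge0// ltW.
  by rewrite integral_exponential_pdf// mule1.
apply: ge0_le_integral => //.
- by move=> s _; rewrite mule_ge0// lee_fin// mulr_ge0 ?expR_ge0// indicE.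
- apply: emeasurable_funM; last exact/measurable_EFinP.
  by apply/measurable_EFinP; exact: measurable_funM.
- by apply: emeasurable_funM => //; exact/measurable_EFinP.
move=> s _; rewrite -!EFinM lee_fin indicE.
have [/set_mem/=|_] := boolP (s \in _); last first.
  by rewrite !mul0r mulr_ge0// divr_ge0// ltW.
rewrite in_itv/= andbT mul1r => s0.
rewrite exponential_pdfE//.
apply: le_trans (ler_wpM2l (expR_ge0 _) (f_le s0)) _.
have -> : M0 * (lam * expR (- lam * s)) = C * expR (- lam * s).
  by rewrite mulrA /M0 divfK// gt_eqF.
rewrite mulrCA -expRD; apply: ler_wpM2l; first exact: ltW.
rewrite ler_expR (_ : lam * s - lam0 * s = - lam * s)//.
by rewrite /lam -mulrBl; congr (_ * _); rewrite [X in _ - X]splitr opprD addrA subrr sub0r.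
Qed.

Let lam_gt0 : 0 < lam.
Proof. by rewrite divr_gt0. Qed.

Let nu_neg : nu `]-oo, 0%R[%classic = 0%E.
Proof. exact: f_neg. Qed.

Lemma density_nneg : nu `[0, +oo[%classic = 1%E.
Proof. exact: probability_nneg nu_neg. Qed.

Lemma measurable_expR_mul c : measurable_fun [set: R] (fun s : R => expR (c * s)).
Proof. by apply: measurableT_comp; [exact: measurable_expR|exact: measurable_funM]. Qed.

Lemma nu_integrable_exp_moment (mu : probability R R) (M : R) :
  (\int[mu]_(s in `[0%R, +oo[) (expR (lam * s))%:E <= M%:E)%E ->
  nu_integrable mu (fun s => expR (lam * s)) /\ Enu mu (fun s => expR (lam * s)) <= M.
Proof.
move=> H; have i0 : (0 <= \int[mu]_(s in `[0%R, +oo[) (expR (lam * s))%:E)%E.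
  by apply: integral_ge0 => s _; rewrite lee_fin expR_ge0.
have fin : (\int[mu]_(s in `[0%R, +oo[) (expR (lam * s))%:E)%E \is a fin_num.
  by rewrite ge0_fin_numE// (le_lt_trans H)// ltry.
split; last by rewrite -lee_fin /Enu /Rintegral fineK.
apply/integrableP; split.
  by apply/measurable_EFinP; exact: measurable_funTS (measurable_expR_mul lam).
under eq_integral do rewrite /= ger0_norm ?expR_ge0//.
by rewrite (le_lt_trans H)// ltry.
Qed.

Lemma exp_moment_conditional (A : set R) mu p0 : measurable A -> conditional_law nu A mu ->
  0 < p0 -> p0 <= fine (nu A) ->
  nu_integrable mu (fun s => expR (lam * s)) /\ Enu mu (fun s => expR (lam * s)) <= M0 / p0.
Proof.
move=> mA [_ H] p00 p0A; apply: nu_integrable_exp_moment.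
have me := measurable_expR_mul lam.
have mI : measurable_fun [set: R] (\1_A : R -> R) by exact: measurable_indic.
have := H _ me (fun s => expR_ge0 _).
set I := (\int[mu]_(s in _) _)%E => HI.
have I0 : (0 <= I)%E by apply: integral_ge0 => s _; rewrite lee_fin expR_ge0.
have HM : ((fine (nu A))%:E * I <= M0%:E)%E.
  rewrite -HI; apply: le_trans exp_moment_density.
  rewrite (integral_nneg_support nu_neg); last 2 first.
  - by apply/measurable_EFinP; exact: measurable_funM.
  - by move=> s; rewrite lee_fin mulr_ge0 ?expR_ge0// indicE.
  apply: ge0_le_integral => //.
  - by apply: measurable_funTS; apply/measurable_EFinP; exact: measurable_funM.
  - by apply: measurable_funTS; exact/measurable_EFinP.
  - by move=> s _; rewrite lee_fin ler_piMl ?expR_ge0// indicE lern1 leq_b1.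
have : (p0%:E * I <= M0%:E)%E.
  by apply: le_trans HM; apply: lee_wpmul2r => //; rewrite lee_fin.
case: I I0 {HI HM} => [v||] //=; last by rewrite gt0_muley ?lte_fin.
by move=> _; rewrite -EFinM !lee_fin mulrC => h; rewrite ler_pdivlMr.
Qed.

(** Conditioning divides the density by [nu A <= 1], which can only improve the lower bound [delta]
    on [[a, b]]; the exponential moment grows by at most [1 / p0]. *)
Lemma conditional_renewal_law (A : set R) mu p0 delta a b : measurable A ->
  conditional_law nu A mu -> 0 < p0 -> p0 <= fine (nu A) ->
  0 < delta -> 0 <= a -> a < b -> (forall s, a <= s <= b -> A s /\ delta <= f s) ->
  renewal_law mu delta a b lam (M0 / p0).
Proof.
move=> mA cl p00 p0A d0 a0 ab fA.
have [ie eM] := exp_moment_conditional mA cl p00 p0A.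
split => //; first by case: cl.
(* [h] is nonnegative up to time [t] only; cutting it off makes [g] nonnegative everywhere without
   changing it at nonnegative steps. *)
move=> h t bh h0; pose g s := Num.max (h (t - s)) 0.
have bg : bmeas g.
  have [mh [M hM]] := bmeas_shift t bh; split; first exact: measurable_maxr.
  exists M => s; apply: le_trans (hM s); rewrite /g ger0_norm ?le_max ?lexx ?orbT//.
  by rewrite ge_max ler_norm normr_ge0.
have g0 s : 0 <= g s by rewrite /g le_max lexx orbT.
have gE s : 0 <= s -> g s = h (t - s) by move=> s0; rewrite /g max_l// h0//; lra.
have -> : Top mu h t = Enu mu g by apply: eq_Enu => s s0; rewrite gE.
rewrite -Iint_reflect//.
have -> : Iint (fun s => h (t - s)) a b = Iint g a b.
  apply: eq_Rintegral => s; rewrite inE/= in_itv/= => /andP[sa _].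
  by rewrite gE// (le_trans a0).
have E1 := conditional_law_Enu cl bg g0.
have pA1 : fine (nu A) <= 1 by rewrite -lee_fin fineK ?fin_num_measure// probability_le1.
have Eg0 : 0 <= Enu mu g by apply: Enu_ge0.
apply: (@le_trans _ _ (fine (nu A) * Enu mu g)); last by rewrite ler_piMl.
rewrite -lee_fin -E1 -IintZ// /Iint /Rintegral fineK; last first.
  apply: integrable_fin_num => //; apply: bmeas_leb_integrable; exact: bmeasZ.
have mI : measurable_fun [set: R] (\1_A : R -> R) by exact: measurable_indic.
have mg := bmeas_measurable bg.
rewrite (ge0_integral_density_law mf f_ge0 f1); last 2 first.
- by apply/measurable_EFinP; exact: measurable_funM.
- by move=> s; rewrite lee_fin mulr_ge0// indicE.
rewrite integral_mkcond; apply: ge0_le_integral => //.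
- by move=> s _; rewrite patchE; case: ifP => // _; rewrite lee_fin mulr_ge0// ltW.
- apply/measurable_restrict => //; apply: measurable_funTS; apply/measurable_EFinP.
  exact: measurable_funM.
- apply: emeasurable_funM; last exact/measurable_EFinP.
  by apply/measurable_EFinP; apply: measurable_funM => //; exact: measurable_indic.
move=> s _; rewrite patchE; case: ifPn => [|_]; last first.
  by rewrite mule_ge0// lee_fin// mulr_ge0// indicE.
rewrite inE/= in_itv/= => /fA[As fs]; rewrite -EFinM lee_fin indicE mem_set//= mul1r mulrC.
exact: ler_wpM2l.
Qed.

Lemma density_lipschitz x y : x <= y -> fine (nu `]x, y]%classic) <= C * (y - x).
Proof.
move=> xy; rewrite -lee_fin fineK ?fin_num_measure//.
apply: (@le_trans _ _ (\int[leb]_(t in `]x, y]) (cst C%:E t))%E); last first.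
  rewrite integral_cst//= lebesgue_measure_itv/= lte_fin; case: ltP => h.
    by rewrite -EFinD -EFinM.
  by rewrite mule0 lee_fin mulr_ge0 ?subr_ge0// ltW.
change ((\int[leb]_(t in `]x, y]) (f t)%:E <= \int[leb]_(t in `]x, y]) (cst C%:E t))%E).
apply: ae_ge0_le_integral => //.
- by move=> s _; rewrite lee_fin.
- by apply: measurable_funTS; exact/measurable_EFinP.
- by move=> s _; rewrite lee_fin ltW.
have [N [mN N0 nN]] := density_ae_neg; exists N; split => // s /= ns; apply: nN => /=.
apply: contra_not ns => fs _; rewrite lee_fin.
have [s0|s0] := ltP s 0; first by rewrite fs// ltW.
apply: le_trans (f_le s0) _; rewrite ler_piMr ?(ltW C_gt0)// -expR0 ler_expR.
by rewrite oppr_le0 mulr_ge0// ltW.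
Qed.

End density_facts.

Lemma sqr_le_expR {R : realType} (lam s : R) : 0 < lam -> 0 <= s ->
  s ^+ 2 <= 4 / lam ^+ 2 * expR (lam * s).
Proof.
move=> l0 s0; have -> : lam * s = lam * s / 2 + lam * s / 2 by rewrite -splitr.
have ls0 : 0 <= lam * s / 2 by rewrite divr_ge0// mulr_ge0// ltW.
rewrite expRD -expr2.
have -> : s ^+ 2 = 4 / lam ^+ 2 * (lam * s / 2) ^+ 2 by field; rewrite gt_eqF.
apply: ler_wpM2l; first by rewrite divr_ge0 ?exprn_ge0// ltW.
by rewrite lerXn2r ?nnegrE ?expR_ge0// (le_trans _ (expR_ge1Dx _))// lerDr.
Qed.

(** * Truncated moments, quantiles and the lower bound on the density *)

Section density_moments.
Context {R : realType}.
Notation leb := (@lebesgue_measure R).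
Variable f : R -> R.
Hypothesis mf : measurable_fun [set: R] f.
Hypothesis f_ge0 : forall t, 0 <= f t.
Hypothesis f1 : (\int[leb]_t (f t)%:E = 1)%E.
Hypothesis f_neg : (\int[leb]_(t in `]-oo, 0%R[) (f t)%:E = 0)%E.
Let nu : probability R R := density_law mf f_ge0 f1.
Variables (C lam0 : R).
Hypothesis C_gt0 : 0 < C.
Hypothesis lam0_gt0 : 0 < lam0.
Hypothesis f_le : forall t, 0 <= t -> f t <= C * expR (- (lam0 * t)).
Let lam := lam0 / 2.
Let M0 := C / lam.

Definition density_moment (A : set R) := fine (\int[leb]_(t in A) (t * f t)%:E)%E.

Let lam_gt0 : 0 < lam.
Proof. by rewrite divr_gt0. Qed.

Let nu_neg : nu `]-oo, 0%R[%classic = 0%E.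
Proof. exact: f_neg. Qed.

Let nn : nu `[0, +oo[%classic = 1%E.
Proof. exact: density_nneg f_neg. Qed.

Let M0_ge0 : 0 <= M0.
Proof. by rewrite divr_ge0// ltW. Qed.

Lemma density_exp_moment : nu_integrable nu (fun s => expR (lam * s)) /\
  Enu nu (fun s => expR (lam * s)) <= M0.
Proof. exact: (nu_integrable_exp_moment (exp_moment_density mf f_ge0 f1 C_gt0 lam0_gt0 f_le)). Qed.

Lemma nu_integrable_indic_mul (A : set R) g : measurable A ->
  nu_integrable nu g -> measurable_fun [set: R] g -> nu_integrable nu (fun s => \1_A s * g s).
Proof.
move=> mA ig mg.
have mI : measurable_fun [set: R] (\1_A : R -> R) by exact: measurable_indic.
apply: (nu_integrable_le (g := fun s => `|g s|)).
- exact: measurable_funM.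
- by have := integrable_abse ig.
- by move=> s _; rewrite normrM ler_piMl// ger0_norm indicE// lern1 leq_b1.
Qed.

Lemma density_integrable_id : nu_integrable nu (fun s => s).
Proof. by have [ie _] := density_exp_moment; exact: nu_integrable_id lam_gt0 ie. Qed.

Lemma density_integrable_indic (A : set R) : measurable A -> nu_integrable nu \1_A.
Proof. by move=> mA; apply: bmeas_nu_integrable => //; exact: bmeas_indic. Qed.

Lemma density_integrable_indic_id (A : set R) : measurable A ->
  nu_integrable nu (fun s => \1_A s * s).
Proof.
by move=> mA; apply: nu_integrable_indic_mul => //; exact: density_integrable_id.
Qed.

Lemma densityE (A : set R) : measurable A -> fine (nu A) = Enu nu \1_A.
Proof.
move=> mA; rewrite /Enu /Rintegral -integral_nneg_support//.
- by rewrite integral_indic// setIT.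
by apply/measurable_EFinP; exact: measurable_indic.
Qed.

Lemma density_momentE (A : set R) : measurable A ->
  density_moment A = Enu nu (fun s => \1_A s * s).
Proof.
move=> mA; rewrite /density_moment (first_moment mf f_ge0 f1 f_neg mA).
rewrite (integral_nneg_support nu_neg); last 2 first.
- apply/measurable_EFinP; apply: measurable_funM; first exact: measurable_indic.
  exact: measurable_maxr.
- by move=> s; rewrite lee_fin mulr_ge0 ?posp_ge0// indicE.
by rewrite -/(Rintegral _ _ _) -/(Enu _ _); apply: eq_Enu => s s0; rewrite posp_pos.
Qed.

Lemma density_momentT : density_moment setT = Enu nu (fun s => s).
Proof. by rewrite density_momentE//; apply: eq_Enu => s _; rewrite indicT mul1r. Qed.

Lemma density_moment_ge0 (A : set R) : measurable A -> 0 <= density_moment A.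
Proof.
by move=> mA; rewrite density_momentE//; apply: Enu_ge0 => s s0; rewrite mulr_ge0// indicE.
Qed.

Lemma le_density_moment (A B : set R) : measurable A -> measurable B -> A `<=` B ->
  density_moment A <= density_moment B.
Proof.
move=> mA mB AB; rewrite !density_momentE//.
apply: le_Enu => //; [exact: density_integrable_indic_id..|] => s s0.
apply: ler_wpM2r => //; rewrite !indicE ler_nat.
by have [/set_mem/AB/mem_set ->|] := boolP (s \in A).
Qed.

Lemma le_density (A B : set R) : measurable A -> measurable B -> A `<=` B ->
  fine (nu A) <= fine (nu B).
Proof. by move=> mA mB AB; rewrite fine_le ?fin_num_measure// le_measure ?inE. Qed.

Lemma density_le1 (A : set R) : measurable A -> fine (nu A) <= 1.
Proof. by move=> mA; rewrite -lee_fin fineK ?fin_num_measure// probability_le1. Qed.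

Lemma density_moment_cst_ge (A : set R) c : measurable A -> (forall s, A s -> c <= s) ->
  c * fine (nu A) <= density_moment A.
Proof.
move=> mA cA; rewrite densityE// density_momentE// -EnuZ; last exact: density_integrable_indic.
apply: le_Enu => //; [|exact: density_integrable_indic_id|] => [|s s0].
  exact/nu_integrableZ/density_integrable_indic.
rewrite mulrC !indicE; have [/set_mem/cA|_] := boolP (s \in A); last by rewrite !mul0r.
by rewrite !mul1r.
Qed.

Let F x := fine (nu `]-oo, x]%classic).
Let S x := fine (nu `[x, +oo[%classic).

Lemma density_split (A B : set R) : measurable A -> measurable B -> A `&` B = set0 ->
  fine (nu (A `|` B)) = fine (nu A) + fine (nu B).
Proof. by move=> mA mB AB; rewrite measureU// fineD ?fin_num_measure. Qed.

Lemma le_density_itvNy x y : x <= y -> F x <= F y.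
Proof.
by move=> xy; apply: le_density => // s /=; rewrite !in_itv/= => /le_trans; apply.
Qed.

Lemma density_itvNyB x y : x <= y -> F y - F x <= C * (y - x).
Proof.
move=> xy; apply: le_trans (density_lipschitz mf f_ge0 f1 f_neg C_gt0 lam0_gt0 f_le xy).
rewrite lerBlDl -density_split//; last first.
  by apply/seteqP; split => s //= []; rewrite !in_itv/= => sx /andP[]; rewrite ltNge sx.
apply: le_density => //; first exact: measurableU.
move=> s /=; rewrite !in_itv/= => sy; have [|sx] := leP s x; [by left|by right].
Qed.

Lemma density_itvNyDy x : F x + S x = 1.
Proof.
have -> : S x = fine (nu `]x, +oo[%classic).
  rewrite /S; have -> : `[x, +oo[%classic = [set x] `|` `]x, +oo[%classic.
    by rewrite set_itvcy set_itvoy; apply/seteqP; split => s /=; rewrite le_eqVlt eq_sym => /predU1P.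
  rewrite density_split//; last first.
    by apply/seteqP; split => s //= []; rewrite in_itv/= => ->; rewrite ltxx.
  by rewrite (density_atomless mf f_ge0 f1) add0r.
rewrite /F -density_split//; last first.
  by apply/seteqP; split => s //= []; rewrite !in_itv/= andbT leNgt => /negPf ->.
by rewrite -(setCitvl (BRight x)) setUv probability_setT.
Qed.

Lemma continuous_density_itvNy : continuous F.
Proof.
move=> x; apply/cvgrPdist_lt => e e0; near=> y.
have h u v : u <= v -> v - u < e / C -> `|F v - F u| < e.
  move=> uv uve; rewrite ger0_norm ?subr_ge0 ?le_density_itvNy//.
  by apply: le_lt_trans (density_itvNyB uv) _; rewrite mulrC -ltr_pdivlMr.
have : `|x - y| < e / C by near: y; apply: cvgr_dist_lt => //; rewrite divr_gt0.
have [xy|/ltW yx] := leP x y.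
  by rewrite distrC ger0_norm ?subr_ge0// distrC; exact: h.
by rewrite ger0_norm ?subr_ge0//; exact: h.
Unshelve. all: by end_near. Qed.

Lemma density_tail y : 0 <= y -> 1 - F y <= M0 * expR (- (lam * y)).
Proof.
have [ie eM] := density_exp_moment.
move=> y0; have -> : 1 - F y = S y by rewrite -(density_itvNyDy y) addrC addKr.
rewrite /S densityE//.
apply: le_trans (_ : Enu nu (fun s => expR (- (lam * y)) * expR (lam * s)) <= _).
  apply: le_Enu => //; [exact: density_integrable_indic|exact: nu_integrableZ|] => s s0.
  rewrite -expRD indicE; have [/set_mem|_] := boolP (s \in _); last exact: expR_ge0.
  rewrite /= in_itv/= andbT => ys; rewrite -[leLHS]expR0 ler_expR.
  by rewrite addrC -mulrBr mulr_ge0 ?subr_ge0// ltW.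
by rewrite EnuZ// mulrC; apply: ler_wpM2r => //; exact: expR_ge0.
Qed.

Lemma density_ge (p q delta : R) : p <= q -> 0 <= delta ->
  (forall s, p <= s <= q -> delta <= f s) -> delta * (q - p) <= fine (nu `[p, q]%classic).
Proof.
move=> pq d0 fs; rewrite -lee_fin fineK ?fin_num_measure//.
apply: (@le_trans _ _ (\int[leb]_(t in `[p, q]) (cst delta%:E t))%E).
  rewrite integral_cst//= lebesgue_measure_itv/= lte_fin; case: ltP => h.
    by rewrite -EFinD -EFinM.
  by rewrite mule0 lee_fin (_ : q - p = 0) ?mulr0//; lra.
change (\int[leb]_(t in `[p, q]) (cst delta%:E t) <= \int[leb]_(t in `[p, q]) (f t)%:E)%E.
apply: ge0_le_integral => //.
by apply: measurable_funTS; exact/measurable_EFinP.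
Qed.

Lemma density_quantile b delta : 0 <= b -> F b <= 1 - delta -> 0 < delta ->
  exists2 x, b <= x & F x = 1 - delta.
Proof.
(* Markov's bound on the tail and [expR (lam * y) >= 1 + lam * y] give
   [1 - F y <= M0 / (1 + lam * y) <= delta]. The intermediate value theorem then applies between [b]
   and [y]. *)
move=> b0 Fb d0; pose y := b + M0 / (lam * delta).
have by_ : b <= y by rewrite /y lerDl divr_ge0// mulr_ge0// ltW.
have y0 : 0 <= y := le_trans b0 by_.
have Fy : 1 - delta <= F y.
  have : 1 - F y <= delta; last by lra.
  apply: le_trans (density_tail y0) _.
  rewrite expRN ler_pdivrMr ?expR_gt0//.
  apply: (@le_trans _ _ (delta * (1 + lam * y))); last first.
    by apply: ler_wpM2l (expR_ge1Dx _); exact: ltW.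
  have -> : delta * (1 + lam * y) = delta + delta * lam * b + M0.
    by rewrite /y; field; rewrite !gt_eqF.
  by rewrite lerDr addr_ge0 ?mulr_ge0// ltW.
have [|x /itvP xb Fx] := @IVT R F b y (1 - delta) by_ (continuous_subspaceT continuous_density_itvNy).
  by rewrite min_l ?max_r ?Fb ?le_density_itvNy.
by exists x => //; rewrite xb.
Qed.

(** Almost all of the mean must lie below [x], while [F x < 1] must remain strict even for a bounded
    support, so that [F x ^+ n] decays. A quantile of small enough order [delta] meets both
    demands. *)
Lemma density_moment_cutoff b eps : 0 <= b -> F b < 1 -> 0 < eps ->
  exists x, [/\ b <= x, F x < 1 & density_moment setT - eps <= density_moment `]-oo, x]%classic].
Proof.
move=> b0 Fb e0; have [ie eM] := density_exp_moment.
(* Beyond [x], use [s <= L + s ^+ 2 / L]: the first part costs [L * delta], the second is bounded by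
   the exponential moment, and [L] makes it at most [eps / 2]. *)
pose L := 8 / lam ^+ 2 * (M0 + 1) / eps.
have L0 : 0 < L by rewrite /L !mulr_gt0 ?invr_gt0 ?exprn_gt0// ltr_wpDl.
pose delta := Num.min (1 - F b) (eps / (2 * L)).
have d0 : 0 < delta by rewrite lt_min subr_gt0 Fb/= divr_gt0// mulr_gt0.
have [|x bx Fx] := density_quantile b0 _ d0.
  by rewrite lerBrDr -lerBrDl ge_min lexx.
exists x; split => //; first by rewrite Fx; lra.
rewrite lerBlDr -lerBlDl density_momentT density_momentE//.
have idi := density_integrable_indic_id (measurable_itv `]-oo, x]).
rewrite -EnuB//; last exact: density_integrable_id.
have mS : measurable `[x, +oo[%classic by [].
apply: le_trans (_ : Enu nu (fun s => L * \1_(`[x, +oo[%classic) s +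
    4 / lam ^+ 2 / L * expR (lam * s)) <= _).
  apply: le_Enu => //.
  - have := nu_integrableD density_integrable_id (nu_integrableZ (-1) idi).
    by congr nu_integrable; apply/funext => s; rewrite mulN1r.
  - apply: nu_integrableD; apply: nu_integrableZ => //; exact: density_integrable_indic.
  move=> s s0; rewrite !indicE.
  have k0 : 0 <= 4 / lam ^+ 2 / L * expR (lam * s).
    by rewrite !mulr_ge0 ?expR_ge0 ?invr_ge0 ?exprn_ge0// ltW.
  have [/set_mem|/negP] := boolP (s \in `]-oo, x]%classic).
    by move=> _; rewrite mul1r subrr addr_ge0// mulr_ge0// ltW.
  rewrite inE/= in_itv/= => /negP; rewrite -ltNge => xs.
  rewrite mul0r subr0 mem_set/= ?in_itv/= ?andbT ?(ltW xs)// mulr1.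
  have /orP[sL|Ls] := le_total s L; first by rewrite (le_trans sL)// lerDl.
  apply: (@le_trans _ _ (4 / lam ^+ 2 / L * expR (lam * s))); last by rewrite lerDr ltW.
  rewrite mulrAC ler_pdivlMr//; apply: le_trans (sqr_le_expR lam_gt0 s0).
  by rewrite expr2 ler_wpM2l.
rewrite EnuD//; last 2 first.
- exact/nu_integrableZ/density_integrable_indic.
- exact: nu_integrableZ.
rewrite !EnuZ//; last exact: density_integrable_indic.
rewrite -densityE// -/(S x) (_ : S x = delta); last by rewrite -[LHS](addKr (F x)) density_itvNyDy Fx; ring.
have h1 : L * delta <= eps / 2.
  apply: (@le_trans _ _ (L * (eps / (2 * L)))).
    by apply: ler_wpM2l; [exact: ltW|rewrite ge_min lexx orbT].
  by rewrite le_eqVlt; apply/orP; left; apply/eqP; field; rewrite gt_eqF.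
have h2 : 4 / lam ^+ 2 / L * Enu nu (fun s => expR (lam * s)) <= eps / 2.
  have -> : 4 / lam ^+ 2 / L = eps / 2 / (M0 + 1).
    have M1 : M0 + 1 != 0 by rewrite gt_eqF// ltr_wpDl.
    by rewrite /L; move: M1; move: (M0 + 1) => M M1; field; rewrite M1 !gt_eqF.
  rewrite mulrAC ler_pdivrMr ?ltr_wpDl//; apply: ler_wpM2l; first by rewrite divr_ge0// ltW.
  by apply: le_trans eM _; rewrite lerDl.
lra.
Qed.

(** For the minimum, conditioning only raises the mean of a step. The unconditional mean is thus a
    uniform lower bound with no loss, which is what permits quotas so close to the total weight. *)
Lemma density_moment_le_cond x : S x * density_moment setT <= density_moment `[x, +oo[%classic.
Proof.
have iA := density_integrable_indic (measurable_itv `[x, +oo[).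
have iAs := density_integrable_indic_id (measurable_itv `[x, +oo[).
have is_ := density_integrable_id.
set m := density_moment setT.
have mE : m = Enu nu (fun s => s) := density_momentT.
have [xm|mx] := leP m x.
  apply: le_trans (density_moment_cst_ge (c := m) _ _) => //; first by rewrite mulrC.
  by move=> s /=; rewrite in_itv/= andbT; exact: le_trans.
(* [1_A (s - m)] and [(1_A - 1) (s - m)] have the same mean, and the latter is nonnegative. *)
have : 0 <= Enu nu (fun s => (\1_(`[x, +oo[%classic) s - 1) * (s - m)).
  apply: Enu_ge0 => s s0; rewrite indicE.
  have [_|] := boolP (s \in _); first by rewrite subrr mul0r.
  rewrite notin_setE/= in_itv/= andbT => /negP; rewrite -ltNge => sx.
  by rewrite sub0r mulN1r opprB subr_ge0 ltW// (lt_trans sx).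
rewrite (_ : (fun s => _) = fun s =>
    (\1_(`[x, +oo[%classic) s * s + - m * \1_(`[x, +oo[%classic) s) +
    ((-1) * s + m)); last by apply/funext => s; ring.
have i1 : nu_integrable nu (fun s => - m * \1_(`[x, +oo[%classic) s) by exact: nu_integrableZ.
have i2 : nu_integrable nu (fun s => (-1) * s) by exact: nu_integrableZ.
have i3 : nu_integrable nu (fun=> m) by exact: nu_integrable_cst.
rewrite EnuD; [|exact: nu_integrableD..].
rewrite EnuD// EnuD// !EnuZ// Enu_cst// -mE -density_momentE// -densityE//.
by rewrite -/(S x); lra.
Qed.

(** Some piece contains two nonnegative points [p < q], for otherwise [f] would vanish on the
    half-line off a finite set. On [[p, q]] a monotone [f] is at least the smaller of its values at
    the ends. *)
Lemma density_minorized : piecewise_diff_monotone f -> exists a b delta,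
  [/\ 0 <= a, a < b, 0 < delta, (forall s, a <= s <= b -> delta <= f s) & 0 < F a /\ F b < 1].
Proof.
move=> [k [I [_ [cover mono]]]].
have [j [p [q [p0 pq Ip Iq]]]] : exists j p q, [/\ 0 <= p, p < q, p \in I j & q \in I j].
  apply: contrapT => no.
  pose A j := [set x | x \in I j] `&` `[0, +oo[%classic.
  have finA j : finite_set (A j).
    have [->|/set0P[x [Ix]]] := eqVneq (A j) set0; first exact: finite_set0.
    rewrite /= in_itv/= andbT => x0.
    apply: (sub_finite_set (B := [set x])); last exact: finite_set1.
    move=> y [/= Iy]; rewrite /= in_itv/= andbT => y0; apply: contrapT => /eqP.
    rewrite neq_lt => /orP[yx|xy]; apply: no; first by exists j, y, x.
    by exists j, x, y.
  pose U := \bigcup_(j in setT) A j.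
  have finU : finite_set U by apply: bigcup_finite => //; exact: finite_finset.
  have mU : measurable (U : set (measurableTypeR R)) by exact: countable_measurable (finite_set_countable finU).
  have U0 : leb U = 0%E by apply: countable_lebesgue_measure0; exact: finite_set_countable.
  have : nu `[0, +oo[%classic = 0%E.
    change (\int[leb]_(t in `[0%R, +oo[) (f t)%:E = 0)%E.
    rewrite -[RHS](integral0 leb (`[0, +oo[%classic : set (measurableTypeR R))).
    apply: ae_eq_integral => //.
    - by apply: measurable_funTS; exact/measurable_EFinP.
    - exists U; split => // x /= /not_implyP[x0 fx].
      have : [set t | 0 < f t] x.
        by rewrite /= lt_neqAle f_ge0 andbT eq_sym; apply: contra_not_neq fx => ->.
      by rewrite -cover => -[j _ Ij]; exists j.
  by rewrite nn => /eqP; rewrite onee_eq0.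
have fI x : x \in I j -> 0 < f x.
  by move=> Ix; have : [set t | 0 < f t] x by rewrite -cover; exists j.
pose delta := Num.min (f p) (f q).
have d0 : 0 < delta by rewrite lt_min !fI.
have fs s : p <= s <= q -> delta <= f s.
  move=> /andP[ps sq]; have Is : s \in I j.
    by apply: (@interval_is_interval _ (I j) p q Ip Iq s); rewrite ps.
  rewrite ge_min; have [_ [h|h]] := mono j; first by rewrite (h p s)//.
  by rewrite (h s q)// orbT.
(* Only the middle third is kept, the outer ones providing positive mass on either side. *)
pose e := (q - p) / 3.
have e0 : 0 < e by rewrite divr_gt0// subr_gt0.
have qE : q = p + e + e + e by rewrite /e; field.
have third u v : p <= u -> u < v -> v <= q -> 0 < fine (nu `[u, v]%classic).
  move=> pu uv vq; apply: lt_le_trans (_ : 0 < delta * (v - u)) _.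
    by rewrite mulr_gt0// subr_gt0.
  apply: density_ge; [exact: ltW..|] => s /andP[us sv].
  by apply: fs; rewrite (le_trans pu)// (le_trans sv).
exists (p + e), (p + e + e), delta; split => //; [lra|lra| |].
- by move=> s /andP[s1 s2]; apply: fs; apply/andP; split; lra.
- split.
  + apply: lt_le_trans (third p (p + e) _ _ _) _; [lra..|].
    by apply: le_density => // s /=; rewrite !in_itv/= => /andP[].
  + rewrite -(density_itvNyDy (p + e + e)) ltrDl.
    apply: lt_le_trans (third (p + e + e) q _ _ _) _; [lra..|].
    by apply: le_density => // s /=; rewrite !in_itv/= andbT => /andP[].
Qed.

(** Just above [chi_min], hypothesis (iii) applies. Further up, the conditional mean is at least the
    moment truncated at [x1], which (iii) shows to be positive. Below, the conditional mean is a
    division by 0 and the ratio is 0. *)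
Lemma ratio_cond_mean_le_bounded C' eps0 x0 b : 0 < F b -> 0 < C' -> 0 < eps0 ->
  (forall x, chi_min f < x < chi_min f + eps0 -> x <= C' * cond_mean_le f x) ->
  exists2 C3, 0 <= C3 & forall x, 0 <= x -> x <= x0 -> x / cond_mean_le f x <= C3.
Proof.
move=> Fb C'0 e0 hC'.
have cmE x : cond_mean_le f x = density_moment `]-oo, x]%classic / F x by [].
have chiE : chi_min f = inf [set x | 0 < F x] by [].
set chi := chi_min f in hC' chiE *.
have F_ge0 x : 0 <= F x by rewrite fine_ge0.
have F_neg x : x < 0 -> F x = 0.
  move=> x0'; apply/eqP; rewrite eq_le F_ge0 andbT.
  rewrite (_ : 0 = fine (nu `]-oo, 0%R[%classic)); last by rewrite nu_neg.
  by apply: le_density => // s /=; rewrite !in_itv/= => /le_lt_trans; apply.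
have lbS : lbound [set x | 0 < F x] 0.
  by move=> x /=; apply: contraTT; rewrite -ltNge => /F_neg ->; rewrite ltxx.
have infS : has_inf [set x | 0 < F x] by split; [exists b|exists 0].
have chi_le x : 0 < F x -> chi <= x by move=> Fx; rewrite chiE; apply: ge_inf => //; exists 0.
have chi0 : 0 <= chi by rewrite chiE; apply: lb_le_inf => //; exists b.
have F_chi : F chi = 0.
  apply/eqP; rewrite eq_le F_ge0 andbT leNgt; apply/negP => Fchi.
  (* [F] is Lipschitz of constant [C], so it loses at most half of [F chi] between [chi] and [y]; it
     would still be positive below its infimum. *)
  pose y := chi - F chi / (2 * C).
  have h : 0 < F chi / (2 * C) by rewrite divr_gt0// mulr_gt0.
  have ychi : y < chi by rewrite /y ltrBlDr ltrDl.
  have := density_itvNyB (ltW ychi).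
  have -> : C * (chi - y) = F chi / 2 by rewrite /y opprB addrCA subrr addr0; field; rewrite gt_eqF.
  move=> h2; have /chi_le : 0 < F y by lra.
  by rewrite leNgt ychi.
pose x1 := chi + eps0 / 2.
have x1i : chi < x1 < chi + eps0 by rewrite /x1; apply/andP; split; lra.
have cm_gt0 x : chi < x < chi + eps0 -> 0 < cond_mean_le f x.
  move=> /[dup] /andP[cx _] /hC' h; rewrite -(pmulr_rgt0 _ C'0).
  by apply: lt_le_trans h; exact: le_lt_trans cx.
have m1 : 0 < density_moment `]-oo, x1]%classic.
  have := cm_gt0 _ x1i; rewrite cmE.
  have := F_ge0 x1; rewrite le_eqVlt => /predU1P[<-|Fx1]; first by rewrite invr0 mulr0 ltxx.
  by rewrite pmulr_lgt0// invr_gt0.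
exists (C' + `|x0| / density_moment `]-oo, x1]%classic).
  by rewrite addr_ge0 ?(ltW C'0)// divr_ge0// ltW.
move=> x x_ge0 xx0.
have t0 : 0 <= `|x0| / density_moment `]-oo, x1]%classic by rewrite divr_ge0// ltW.
have := F_ge0 x; rewrite le_eqVlt => /predU1P[Fx|Fx].
  by rewrite cmE -Fx invr0 mulr0 invr0 mulr0 addr_ge0// ltW.
have cx : chi < x.
  rewrite lt_neqAle chi_le// andbT; apply/eqP => cx; move: Fx; rewrite -cx F_chi.
  by rewrite ltxx.
have [xe|ex] := ltP x (chi + eps0).
  have xi : chi < x < chi + eps0 by rewrite cx.
  rewrite ler_pdivrMr ?cm_gt0//; apply: le_trans (hC' _ xi) _.
  by apply: ler_wpM2r; [exact/ltW/cm_gt0|rewrite lerDl].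
apply: (@le_trans _ _ (`|x0| / density_moment `]-oo, x1]%classic)); last by rewrite lerDr ltW.
have le1 : density_moment `]-oo, x1]%classic <= cond_mean_le f x.
  apply: (@le_trans _ _ (density_moment `]-oo, x]%classic)).
    apply: le_density_moment => // s /=; rewrite !in_itv/= => sx1.
    by move: x1i => /andP[_ h]; rewrite (le_trans sx1)// ltW// (lt_le_trans h).
  rewrite cmE ler_pdivlMr// ler_piMr ?density_moment_ge0//.
  exact: density_le1.
apply: ler_pM => //.
- by rewrite invr_ge0 (le_trans (ltW m1)).
- exact: le_trans (ler_norm _).
- by rewrite lef_pV2 ?posrE// (lt_le_trans m1).
Qed.

End density_moments.

(** Integrate [expR (- u) <= 1 - u + u ^+ 2] at [u = theta * s], the square being controlled by the
    exponential moment. The mean appears with its exact constant, as the quotas close to the total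
    weight require. *)
Lemma Enu_laplace_le {R : realType} (mu : probability R R) (lam M theta : R) :
  0 < lam -> mu `[0, +oo[%classic = 1%E -> nu_integrable mu (fun s => expR (lam * s)) ->
  Enu mu (fun s => expR (lam * s)) <= M -> 0 <= theta ->
  Enu mu (fun s => expR (- (theta * s))) <=
    expR (- (theta * Enu mu (fun s => s)) + theta ^+ 2 * (4 * M / lam ^+ 2)).
Proof.
move=> l0 nn ie eM th0.
have ii := nu_integrable_id l0 ie.
have quad (u : R) : 0 <= u -> expR (- u) <= 1 - u + u ^+ 2.
  move=> u0; rewrite expRN; have u1 : 0 < 1 + u by rewrite ltr_wpDr.
  apply: (@le_trans _ _ (1 + u)^-1).
    by rewrite lef_pV2 ?posrE ?expR_gt0// expR_ge1Dx.
  rewrite -[leLHS]mul1r ler_pdivrMr//.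
  rewrite (_ : (1 - u + u ^+ 2) * (1 + u) = 1 + u ^+ 3); last by ring.
  by rewrite lerDl exprn_ge0.
apply: (@le_trans _ _ (1 - theta * Enu mu (fun s => s) + theta ^+ 2 * (4 * M / lam ^+ 2))); last first.
  by rewrite -addrA expR_ge1Dx.
pose g s := 1 + (- theta) * s + theta ^+ 2 * (4 / lam ^+ 2) * expR (lam * s).
have k0 : 0 <= theta ^+ 2 * (4 / lam ^+ 2).
  by rewrite mulr_ge0 ?exprn_ge0// divr_ge0// exprn_ge0// ltW.
have i1 : nu_integrable mu (fun s => 1 + (- theta) * s).
  by apply: nu_integrableD; [exact: nu_integrable_cst|exact: nu_integrableZ].
have i2 : nu_integrable mu (fun s => theta ^+ 2 * (4 / lam ^+ 2) * expR (lam * s)).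
  exact: nu_integrableZ.
apply: (@le_trans _ _ (Enu mu g)).
  apply: le_Enu; [|exact: nu_integrableD|]; last first.
    move=> s s0; rewrite /g; have := quad _ (mulr_ge0 th0 s0).
    have : (theta * s) ^+ 2 <= theta ^+ 2 * (4 / lam ^+ 2) * expR (lam * s).
      rewrite exprMn -mulrA; apply: ler_wpM2l; first exact: exprn_ge0.
      exact: sqr_le_expR.
    move: (expR (lam * s)) (expR (- _)) => A B; move: (_ * A) => A'.
    by rewrite mulNr; lra.
  apply: nu_integrable_le (nu_integrable_cst nn 1) _ => [|s s0].
    apply: measurableT_comp; first exact: measurable_expR.
    by apply: measurable_funN; exact: measurable_funM.
  by rewrite ger0_norm ?expR_ge0// -[leRHS]expR0 ler_expR oppr_le0 mulr_ge0.
rewrite /g EnuD// EnuD//; last 2 first.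
- exact: nu_integrable_cst.
- exact: nu_integrableZ.
rewrite Enu_cst// !EnuZ// mulNr lerD2l.
have -> : theta ^+ 2 * (4 * M / lam ^+ 2) = theta ^+ 2 * (4 / lam ^+ 2) * M by ring.
exact: ler_wpM2l.
Qed.


(** * Rates *)

Section game_value.
Context {R : realType}.
Notation leb := (@lebesgue_measure R).
Variable f : R -> R.
Hypothesis mf : measurable_fun [set: R] f.
Hypothesis f_ge0 : forall t, 0 <= f t.
Hypothesis f1 : (\int[leb]_t (f t)%:E = 1)%E.
Hypothesis f_neg : (\int[leb]_(t in `]-oo, 0%R[) (f t)%:E = 0)%E.
Let nu : probability R R := density_law mf f_ge0 f1.
Variables (C lam0 : R).
Hypothesis C_gt0 : 0 < C.
Hypothesis lam0_gt0 : 0 < lam0.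
Hypothesis f_le : forall t, 0 <= t -> f t <= C * expR (- (lam0 * t)).
Let lam := lam0 / 2.
Let M0 := C / lam.
Variables a b delta : R.
Hypothesis a_ge0 : 0 <= a.
Hypothesis ab : a < b.
Hypothesis delta_gt0 : 0 < delta.
Hypothesis f_ge : forall s, a <= s <= b -> delta <= f s.

Variables (D : set (R * R)) (arg : forall n, ('I_n.+1 -> R) -> 'I_n.+1).
Hypothesis mD : measurable D.
Hypothesis arg_pattern : forall n (v v' : 'I_n.+1 -> R),
  (forall i j, (v i <= v j) = (v' i <= v' j)) -> arg v = arg v'.
Hypothesis argP : forall n (v : 'I_n.+1 -> R), (forall i j, i != j -> v i != v j) ->
  forall i, arg v = i <-> forall j, j != i -> D (v i, v j).
Let A x := [set s | D (x, s)].
Let rho x := x / (density_moment f (A x) / fine (nu (A x))).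
Variables (good : R -> Prop) (pg mlow p0 C3 : R).
Hypothesis measurable_rho : measurable_fun [set: R] rho.
Hypothesis p0_ge0 : 0 <= p0.
Hypothesis C3_ge0 : 0 <= C3.
Hypothesis pg_gt0 : 0 < pg.
Hypothesis bad_bound : forall x, 0 <= x -> ~ good x -> fine (nu (A x)) <= p0 /\ rho x <= C3.
Hypothesis good_bound : forall x, good x ->
  [/\ pg <= fine (nu (A x)), `[a, b] `<=` A x & fine (nu (A x)) * mlow <= density_moment f (A x)].

(* The last exponential is Chernoff's bound for the event that all the agents together
   weigh less than [Q]. *)
Lemma game_value_rate : exists c K V, [/\ 0 < c, 0 <= K, 0 < V &
  forall (n : nat) d (T : measurableType d) (P : probability T R) (X : 'I_n.+1 -> T -> R),
  iid_with_density P X f -> forall Q theta, 0 < Q -> 0 <= theta ->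
  `| Ex P (fun w => shapley (X ^~ w) (arg (X ^~ w)) Q) -
    n.+1%:R^-1 * Ex P (fun w => rho (X (arg (X ^~ w)) w)) | <=
  p0 ^+ n * (n.+1%:R + C3) +
  K * (expR (- (c * Q)) + expR (theta * (Q - n.+1%:R * mlow) + n.+1%:R * (theta ^+ 2 * V)))].
Proof.
have lam_gt0 : 0 < lam by rewrite divr_gt0.
have M0_gt0 : 0 < M0 by rewrite divr_gt0.
have nu_neg : nu `]-oo, 0%R[%classic = 0%E by exact: f_neg.
have mA x : measurable (A x).
  have := measurable_xsection x mD; congr measurable.
  by apply/seteqP; split => s /=; rewrite /xsection /= inE.
have [cond condP] := choice (fun x => ex_conditional_law nu_neg (mA x)).
have [c [K [c0 cl K0 rate]]] := renewal_rate (M0 / pg) delta_gt0 a_ge0 ab lam_gt0.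
have [ie eM] := density_exp_moment mf f_ge0 f1 C_gt0 lam0_gt0 f_le.
pose V := 4 * (M0 / pg) / lam ^+ 2.
have V0 : 0 < V by rewrite divr_gt0 ?exprn_gt0// mulr_gt0// divr_gt0.
exists c, (K * (1 + 4 / lam) * M0), V; split => //.
  by apply/ltW/mulr_gt0 => //; apply: mulr_gt0 => //; apply: addr_gt0 => //; exact: divr_gt0.
move=> n d T P X [mX X_law X_indep] Q theta Q0 th0.
set eta := expR (theta * _ + _).
apply: (game_error nu_neg (density_atomless mf f_ge0 f1) lam_gt0 ie eM mX X_law X_indep mD
  (@arg_pattern n) (@argP n) condP (good := good)) => //.
- exact: ltW.
- exact: ltW.
- by rewrite /eta expR_ge0.
- move=> x x0; rewrite /rho divr_ge0//; apply: divr_ge0; last exact: fine_ge0.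
  exact: (density_moment_ge0 mf f_ge0 f1 f_neg).
move=> x x0 /good_bound[pgA abA mlowA].
have cm : density_moment f (A x) = fine (nu (A x)) * Enu (cond x) (fun s => s).
  exact: cond_first_moment.
have pA : 0 < fine (nu (A x)) by exact: lt_le_trans pgA.
have -> : rho x = x / Enu (cond x) (fun s => s) by rewrite /rho cm mulrAC divff ?mul1r ?gt_eqF.
have [iec eMc] := exp_moment_conditional f_neg C_gt0 lam0_gt0 f_le (mA x) (condP x) pg_gt0 pgA.
have nnc : cond x `[0, +oo[%classic = 1%E by case: (condP x).
apply: (rate _ _ x n.+1 Q theta eta) => //.
- apply: conditional_renewal_law (condP x) _ pgA _ _ _ _ => // s sab; split; last exact: f_ge.
  by apply: abA; rewrite /= in_itv.
- exact: expR_ge0.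
have m_le : mlow <= Enu (cond x) (fun s => s).
  by rewrite -(ler_pM2l pA) -cm.
have := Enu_laplace_le lam_gt0 nnc iec eMc th0; rewrite -/V.
set q := Enu _ _ => qle.
have q0 : 0 <= q by apply: Enu_ge0 => s _; exact: expR_ge0.
apply: (@le_trans _ _ (expR (theta * Q) * expR (- (theta * mlow) + theta ^+ 2 * V) ^+ n.+1)).
  apply: ler_wpM2l; first exact: expR_ge0.
  rewrite lerXn2r ?nnegrE ?expR_ge0//; apply: le_trans qle _.
  by rewrite ler_expR lerD2r lerN2 ler_wpM2l.
rewrite -expRM_natl -expRD /eta ler_expR le_eqVlt; apply/orP; left; apply/eqP.
by rewrite -mulr_natl; ring.
Qed.

End game_value.

Lemma measurable_invr_ge0 {R : realType} (g : R -> R) : measurable_fun [set: R] g ->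
  (forall x, 0 <= g x) -> measurable_fun [set: R] (fun x => (g x)^-1).
Proof.
move=> mg g0; rewrite (_ : (fun x => _) = (fun x => g x `^ (-1))); last first.
  by apply/funext => x; rewrite powRN powRr1.
by have := measurableT_comp (@measurable_powR R (-1)) mg; apply.
Qed.

Lemma linear_expn_le {R : realType} (p C : R) : 0 <= p -> p < 1 -> 0 <= C ->
  exists r K, [/\ 0 < r, 0 <= K &
    forall n : nat, p ^+ n * (n.+1%:R + C) <= K * expR (- (r * n.+1%:R))].
Proof.
(* The maximum with [1 / 2] allows for [p = 0], where the logarithm would be meaningless. *)
move=> p0 p1 C0; pose q := Num.max p 2^-1.
have q0 : 0 < q by rewrite lt_max invr_gt0 ltr0n orbT.
have q1 : q < 1 by rewrite gt_max p1/= invf_lt1// ltr1n.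
(* Half of the decay of [q ^+ n] absorbs the linear factor; [expR (2 * r)] makes up for the shift
   from [n] to [n + 1]. *)
pose r := - ln q / 2.
have r0 : 0 < r by rewrite divr_gt0// oppr_gt0 ln_lt0// q0.
have qE : q = expR (- (2 * r)) by rewrite /r mulrC divfK// opprK lnK.
exists r, (expR (2 * r) * (r^-1 + C)); split => //.
  by rewrite mulr_ge0 ?expR_ge0// addr_ge0// invr_ge0 ltW.
move=> n; set N : R := n.+1%:R.
have h1 : N + C <= (r^-1 + C) * expR (r * N).
  have h := expR_ge1Dx (r * N).
  have rN : 0 <= r * N by rewrite mulr_ge0// ltW.
  rewrite mulrDl; apply: lerD.
    rewrite -[leLHS](mulKf (lt0r_neq0 r0)); apply: ler_wpM2l; first by rewrite invr_ge0 ltW.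
    by rewrite (le_trans _ h)// lerDr.
  by rewrite ler_peMr// (le_trans _ h)// lerDl.
apply: (@le_trans _ _ (q ^+ n * ((r^-1 + C) * expR (r * N)))).
  apply: ler_pM => //; [exact: exprn_ge0|by rewrite addr_ge0|].
  by rewrite lerXn2r ?nnegrE ?(ltW q0)// le_max lexx.
have e : n%:R * - (2 * r) + r * N = 2 * r + - (r * N) by rewrite /N -addn1 natrD; ring.
by rewrite qE -expRM_natl mulrCA -expRD e expRD mulrA (mulrC (_ + _)).
Qed.

(** * Error rates for the two extremal agents *)

Section extremal_rates.
Context {R : realType}.
Notation leb := (@lebesgue_measure R).
Variable f : R -> R.
Hypothesis mf : measurable_fun [set: R] f.
Hypothesis f_ge0 : forall t, 0 <= f t.
Hypothesis f1 : (\int[leb]_t (f t)%:E = 1)%E.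
Hypothesis f_neg : (\int[leb]_(t in `]-oo, 0%R[) (f t)%:E = 0)%E.
Let nu : probability R R := density_law mf f_ge0 f1.
Variables (C lam : R).
Hypothesis C_gt0 : 0 < C.
Hypothesis lam_gt0 : 0 < lam.
Hypothesis f_le : forall t, 0 <= t -> f t <= C * expR (- (lam * t)).
Hypothesis hii : piecewise_diff_monotone f.

Let F x := fine (nu `]-oo, x]%classic).
Let S x := fine (nu `[x, +oo[%classic).

Let le_moment := le_density_moment mf f_ge0 f1 f_neg C_gt0 lam_gt0 f_le.
Let F_le x y : x <= y -> F x <= F y := @le_density_itvNy _ _ mf f_ge0 f1 x y.

Let F_ge0 x : 0 <= F x.
Proof. by rewrite fine_ge0. Qed.

Let S_ge0 x : 0 <= S x.
Proof. by rewrite fine_ge0. Qed.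

Let S_le x y : x <= y -> S y <= S x.
Proof.
by move=> xy; apply: le_density => // s /=; rewrite !in_itv/= !andbT; exact: le_trans.
Qed.

Lemma mean_gt0 : 0 < mean f.
Proof.
have [a [b [delta [a0 ab d0 fs [Fa Fb]]]]] := density_minorized mf f_ge0 f1 f_neg hii.
have b0 : 0 < b := le_lt_trans a0 ab.
have Sb : 0 < S b by have := density_itvNyDy mf f_ge0 f1 b; rewrite -/(S b); move: Fb; lra.
change (0 < density_moment f setT).
apply: lt_le_trans (_ : 0 < b * S b) _; first exact: mulr_gt0.
apply: (@le_trans _ _ (density_moment f `[b, +oo[%classic)); last exact: le_moment.
apply: (density_moment_cst_ge mf f_ge0 f1 f_neg C_gt0 lam_gt0 f_le) => // s /=.
by rewrite in_itv/= andbT.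
Qed.

Lemma measurable_ratio_cond_mean_le : measurable_fun [set: R] (fun x => x / cond_mean_le f x).
Proof.
have mge0 := density_moment_ge0 mf f_ge0 f1 f_neg.
apply: measurable_funM => //; apply: measurable_invr_ge0; last first.
  by move=> x; apply: divr_ge0; [exact: mge0|exact: F_ge0].
apply: measurable_funM.
  apply: nondecreasing_measurable => // x y xy; apply: le_moment => // s /=.
  by rewrite !in_itv/= => /le_trans; apply.
apply: measurable_invr_ge0; last exact: F_ge0.
by apply: nondecreasing_measurable => // x y; exact: F_le.
Qed.

Lemma measurable_ratio_cond_mean_ge : measurable_fun [set: R] (fun x => x / cond_mean_ge f x).
Proof.
have mge0 := density_moment_ge0 mf f_ge0 f1 f_neg.
apply: measurable_funM => //; apply: measurable_invr_ge0; last first.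
  by move=> x; apply: divr_ge0; [exact: mge0|exact: S_ge0].
apply: measurable_funM.
  apply: nonincreasing_measurable => // x y xy; apply: le_moment => // s /=.
  by rewrite !in_itv/= !andbT; exact: le_trans.
apply: measurable_invr_ge0; last exact: S_ge0.
by apply: nonincreasing_measurable => // x y; exact: S_le.
Qed.

Lemma ratio_cond_mean_ge_le1 x : 0 <= x -> x / cond_mean_ge f x <= 1.
Proof.
move=> x0; have cmE : cond_mean_ge f x = density_moment f `[x, +oo[%classic / S x by [].
have : 0 <= S x := S_ge0 x.
rewrite le_eqVlt => /predU1P[Sx|Sx].
  by rewrite cmE -Sx invr0 mulr0 invr0 mulr0.
have xcm : x <= cond_mean_ge f x.
  rewrite cmE ler_pdivlMr//.
  apply: (density_moment_cst_ge mf f_ge0 f1 f_neg C_gt0 lam_gt0 f_le) => // s /=.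
  by rewrite in_itv/= andbT.
have := x0; rewrite le_eqVlt => /predU1P[<-|xp]; first by rewrite mul0r.
by rewrite ler_pdivrMr ?mul1r// (lt_le_trans xp).
Qed.

Lemma combine_rates (K1 K2 r r1 r2 c Q N y : R) : 0 <= K1 -> 0 <= K2 ->
  0 <= r -> r <= r1 -> r <= c -> r <= r2 -> 0 <= Q -> 0 <= y -> y <= N ->
  K1 * expR (- (r1 * N)) + K2 * (expR (- (c * Q)) + expR (- (r2 * y))) <=
  (K1 + K2) * (expR (- (r * Q)) + expR (- (r * y))).
Proof.
move=> K10 K20 r0 rr1 rc rr2 Q0 y0 yN; rewrite [leRHS]mulrDl; apply: lerD; apply: ler_wpM2l => //.
  apply: (@le_trans _ _ (expR (- (r * y)))); last by rewrite lerDr expR_ge0.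
  by rewrite ler_expR lerN2 ler_pM.
by apply: lerD; rewrite ler_expR lerN2 ler_wpM2r.
Qed.

Let F_S x : F x + S x = 1 := density_itvNyDy mf f_ge0 f1 x.

Let moment_ge0 A : measurable A -> 0 <= density_moment f A :=
  @density_moment_ge0 _ _ mf f_ge0 f1 f_neg A.

(** Weights [x >= x0] are good: their conditional mean is at least [(1 - eps / 2) * mean f]. As [Q]
    is at most [1 - eps] times the expected total, half of the margin is left for Chernoff's
    bound. *)
Lemma game_max_rate C' eps0 eps : 0 < C' -> 0 < eps0 ->
  (forall x, chi_min f < x < chi_min f + eps0 -> x <= C' * cond_mean_le f x) -> 0 < eps ->
  exists r K, [/\ 0 < r, 0 <= K &
    forall (n : nat) d (T : measurableType d) (P : probability T R) (X : 'I_n.+1 -> T -> R),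
    iid_with_density P X f -> forall Q, 0 < Q -> Q <= (1 - eps) * n.+1%:R * mean f ->
    `| Ex P (fun w => shapley (X ^~ w) (argmax_agent (X ^~ w)) Q) -
       n.+1%:R^-1 * Ex P (fun w => X (argmax_agent (X ^~ w)) w /
                                   cond_mean_le f (X (argmax_agent (X ^~ w)) w)) |
    <= K * (expR (- (r * Q)) + expR (- (r * n.+1%:R)))].
Proof.
move=> C'0 e00 hC' e0; have m0 := mean_gt0.
have [a [b [delta [a0 ab d0 fs [Fa Fb]]]]] := density_minorized mf f_ge0 f1 f_neg hii.
have b0 : 0 <= b := ltW (le_lt_trans a0 ab).
have em0 : 0 < eps / 2 * mean f by rewrite mulr_gt0// divr_gt0.
have [x0 [bx0 Fx0 mx0]] := density_moment_cutoff f_neg C_gt0 lam_gt0 f_le b0 Fb em0.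
have [C3 C30 rho_le] := ratio_cond_mean_le_bounded f_neg C_gt0 lam_gt0 f_le
  x0 Fa C'0 e00 hC'.
pose mlow := mean f - eps / 2 * mean f.
pose D : set (R * R) := [set z | z.2 <= z.1].
have AE x : [set s | D (x, s)] = `]-oo, x]%classic by rewrite set_itvNyc.
have rhoE x : x / (density_moment f [set s | D (x, s)] / fine (nu [set s | D (x, s)])) =
    x / cond_mean_le f x by rewrite AE.
have [||||c [K [V [c0 K0 V0 rate]]]] := @game_value_rate R f mf f_ge0 f1 f_neg C lam
    C_gt0 lam_gt0 f_le a b delta a0 ab d0 fs D (@argmax_agent R) _ (@argmax_pattern R)
    (@argmax_agentP R) (fun x => x0 <= x) (F a) mlow (F x0) C3 _ (F_ge0 x0) C30 Fa.
- have m12 : measurable_fun [set: R * R] (fun z : R * R => z.2 <= z.1).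
    by apply: measurable_fun_ler; [exact: measurable_snd|exact: measurable_fst].
  by have := m12 measurableT [set true] I; rewrite setTI.
- by rewrite (funext rhoE); exact: measurable_ratio_cond_mean_le.
- move=> x x_ge0 /negP; rewrite -ltNge => xx0; rewrite rhoE AE; split.
    exact/F_le/ltW.
  by apply: rho_le => //; exact: ltW.
- move=> x x0x; rewrite AE; split.
  + by apply: F_le; rewrite (le_trans (ltW ab))// (le_trans bx0).
  + move=> s /=; rewrite !in_itv/= => /andP[_ sb].
    by rewrite (le_trans sb)// (le_trans bx0).
  (* [eps] is arbitrary, so [mlow] may be negative; the bound is then trivial. *)
  + have [ml|ml] := leP 0 mlow; last first.
      apply: (@le_trans _ _ 0); first by apply: mulr_ge0_le0; [exact: F_ge0|exact: ltW].
      exact: moment_ge0.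
    apply: (@le_trans _ _ mlow); first by rewrite ler_piMl// density_le1.
    apply: le_trans mx0 _; apply: le_moment => // s /=; rewrite !in_itv/= => h.
    exact: le_trans h x0x.
have [r1 [K1 [r10 K10 geom]]] := linear_expn_le (F_ge0 x0) Fx0 C30.
(* The minimiser of [- theta * (eps * mean f / 2) + theta ^+ 2 * V]; the minimum is [- r2]. *)
pose theta := eps * mean f / (4 * V).
have th0 : 0 < theta by rewrite divr_gt0 ?mulr_gt0.
pose r2 := theta * (eps * mean f / 4).
have r20 : 0 < r2 by rewrite mulr_gt0// divr_gt0// mulr_gt0.
exists (Num.min r1 (Num.min c r2)), (K1 + K); split.
- by rewrite !lt_min r10 c0.
- exact: addr_ge0.
move=> n d T P X iid Q Q0 Qle.
rewrite (_ : (fun w => _ / cond_mean_le f _) = fun w => let x := X (argmax_agent (X ^~ w)) w in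
    x / (density_moment f [set s | D (x, s)] / fine (nu [set s | D (x, s)]))); last first.
  by apply/funext => w; rewrite -rhoE.
apply: le_trans (rate n d T P X iid Q theta Q0 (ltW th0)) _.
apply: le_trans; last first.
  apply: (combine_rates (r1 := r1) (r2 := r2) (c := c) (N := n.+1%:R)) => //.
  - by rewrite !le_min !ltW.
  - by rewrite ge_min lexx.
  - by rewrite !ge_min lexx orbT.
  - by rewrite !ge_min lexx !orbT.
  - exact: ltW.
apply: lerD; first exact: geom.
apply: ler_wpM2l => //; rewrite lerD2l ler_expR.
have thV : theta * V = eps * mean f / 4 by rewrite /theta; field; rewrite gt_eqF.
set N : R := n.+1%:R in Qle *.
have h : theta * (Q - N * mlow) <= theta * (- (N * (eps * mean f / 2))).
  apply: ler_wpM2l; first exact: ltW.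
  rewrite /mlow; have -> : - (N * (eps * mean f / 2)) =
    (1 - eps) * N * mean f - N * (mean f - eps / 2 * mean f) by field.
  by rewrite lerD2r.
apply: le_trans (lerD h (lexx _)) _.
have -> : N * (theta ^+ 2 * V) = N * theta * (theta * V) by ring.
rewrite thV /r2 le_eqVlt; apply/orP; left; apply/eqP.
by field.
Qed.

(** Weights [x <= a] are good, since [[x, +oo[] then contains [[a, b]]. The others have
    [p x <= S a < 1], and for them the ratio is at most 1 without any hypothesis near the bottom of
    the support. *)
Lemma game_min_rate :
  exists r K, [/\ 0 < r, 0 <= K &
    forall (n : nat) d (T : measurableType d) (P : probability T R) (X : 'I_n.+1 -> T -> R),
    iid_with_density P X f -> forall Q, 0 < Q ->
    Q <= (n.+1%:R - n.+1%:R `^ (2 / 3)) * mean f ->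
    `| Ex P (fun w => shapley (X ^~ w) (argmin_agent (X ^~ w)) Q) -
       n.+1%:R^-1 * Ex P (fun w => X (argmin_agent (X ^~ w)) w /
                                   cond_mean_ge f (X (argmin_agent (X ^~ w)) w)) |
    <= K * (expR (- (r * Q)) + expR (- (r * n.+1%:R `^ (3^-1))))].
Proof.
have m0 := mean_gt0.
have [a [b [delta [a0 ab d0 fs [Fa Fb]]]]] := density_minorized mf f_ge0 f1 f_neg hii.
have Sb : 0 < S b by have := F_S b; move: Fb; rewrite -/(F b); lra.
have Sa : S a < 1 by have := F_S a; move: Fa; rewrite -/(F a); lra.
pose D : set (R * R) := [set z | z.1 <= z.2].
have AE x : [set s | D (x, s)] = `[x, +oo[%classic by rewrite set_itvcy.
have rhoE x : x / (density_moment f [set s | D (x, s)] / fine (nu [set s | D (x, s)])) =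
    x / cond_mean_ge f x by rewrite AE.
have [||||c [K [V [c0 K0 V0 rate]]]] := @game_value_rate R f mf f_ge0 f1 f_neg C lam
    C_gt0 lam_gt0 f_le a b delta a0 ab d0 fs D (@argmin_agent R) _ (@argmin_pattern R)
    (@argmin_agentP R) (fun x => x <= a) (S b) (mean f) (S a) 1 _ (S_ge0 a) ler01 Sb.
- have m12 : measurable_fun [set: R * R] (fun z : R * R => z.1 <= z.2).
    by apply: measurable_fun_ler; [exact: measurable_fst|exact: measurable_snd].
  by have := m12 measurableT [set true] I; rewrite setTI.
- by rewrite (funext rhoE); exact: measurable_ratio_cond_mean_ge.
- move=> x x_ge0 /negP; rewrite -ltNge => ax; rewrite rhoE AE; split.
    exact/S_le/ltW.
  exact: ratio_cond_mean_ge_le1.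
- move=> x xa; rewrite AE; split.
  + by apply: S_le; rewrite (le_trans xa)// ltW.
  + by move=> s /=; rewrite !in_itv/= andbT => /andP[/(le_trans xa)].
  + exact: (density_moment_le_cond mf f_ge0 f1 f_neg C_gt0 lam_gt0 f_le).
have [r1 [K1 [r10 K10 geom]]] := linear_expn_le (S_ge0 a) Sa ler01.
pose r2 := (mean f) ^+ 2 / (4 * V).
have r20 : 0 < r2 by rewrite divr_gt0 ?exprn_gt0 ?mulr_gt0.
exists (Num.min r1 (Num.min c r2)), (K1 + K); split.
- by rewrite !lt_min r10 c0.
- exact: addr_ge0.
move=> n d T P X iid Q Q0; set N : R := n.+1%:R => Qle.
have N1 : 1 <= N by rewrite ler1n.
pose y := N `^ (3^-1).
have y1 : 1 <= y by rewrite -(powRr0 N) ler_powR// invr_ge0.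
have y0 : 0 < y := lt_le_trans ltr01 y1.
have Ny : N = y ^+ 3 by rewrite -powR_mulrn ?ltW// -powRrM mulVf// powRr1// (le_trans ler01).
have N23 : N `^ (2 / 3) = y ^+ 2.
  by rewrite -powR_mulrn ?ltW// -powRrM mulrC.
(* With [N = y ^+ 3] and a deficit of [y ^+ 2 * mean f], this minimises [- theta * y ^+ 2 * mean f +
   y ^+ 3 * theta ^+ 2 * V]; the minimum is [- r2 * y]. *)
pose theta := mean f / (2 * V) / y.
have th0 : 0 < theta by rewrite !divr_gt0 ?mulr_gt0.
rewrite (_ : (fun w => _ / cond_mean_ge f _) = fun w => let x := X (argmin_agent (X ^~ w)) w in
    x / (density_moment f [set s | D (x, s)] / fine (nu [set s | D (x, s)]))); last first.
  by apply/funext => w; rewrite -rhoE.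
apply: le_trans (rate n d T P X iid Q theta Q0 (ltW th0)) _; rewrite -/N -/y.
apply: le_trans; last first.
  apply: (combine_rates (r1 := r1) (r2 := r2) (c := c) (N := N)) => //.
  - by rewrite !le_min !ltW.
  - by rewrite ge_min lexx.
  - by rewrite !ge_min lexx orbT.
  - by rewrite !ge_min lexx !orbT.
  - exact: ltW.
  - exact: ltW.
  - by rewrite Ny ler_eXnr.
apply: lerD; first exact: geom.
apply: ler_wpM2l => //; rewrite lerD2l ler_expR.
have thV : theta * V * y = mean f / 2.
  by rewrite /theta; field; rewrite !gt_eqF.
have h : theta * (Q - N * mean f) <= theta * (- (y ^+ 2 * mean f)).
  apply: ler_wpM2l; first exact: ltW.
  have -> : - (y ^+ 2 * mean f) = (N - N `^ (2 / 3)) * mean f - N * mean f.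
    by rewrite N23; ring.
  by rewrite lerD2r.
apply: le_trans (lerD h (lexx _)) _.
have -> : N * (theta ^+ 2 * V) = theta * y ^+ 2 * (theta * V * y) by rewrite Ny; ring.
rewrite thV /r2 /theta le_eqVlt; apply/orP; left; apply/eqP.
by field; rewrite !gt_eqF.
Qed.

End extremal_rates.

Theorem theorem1 (R : realType) (f : R -> R)
  (hf : nonneg_density f)
  (hi : exists C lam : R, [/\ 0 < C, 0 < lam &
          forall t, 0 <= t -> f t <= C * expR (- (lam * t))])
  (hii : piecewise_diff_monotone f)
  (hiii : exists C' eps0 : R, [/\ 0 < C', 0 < eps0 &
          forall x, chi_min f < x < chi_min f + eps0 -> x <= C' * cond_mean_le f x]) :
  forall eps : R, 0 < eps ->
  exists xi K : R, [/\ 0 < xi < 1, 0 <= K &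
    forall (n : nat) (d : measure_display) (T : measurableType d)
           (P : probability T R) (X : 'I_n.+1 -> T -> R),
      iid_with_density P X f ->
      (forall Q : R,
         (n.+1)%:R `^ (4^-1) <= Q <= (1 - eps) * (n.+1)%:R * mean f ->
         `| Ex P (fun w => shapley (X ^~ w) (argmax_agent (X ^~ w)) Q)
            - (n.+1)%:R^-1 * Ex P (fun w => let x := X (argmax_agent (X ^~ w)) w in
                                            x / cond_mean_le f x) |
         <= K * xi `^ ((n.+1)%:R `^ (4^-1)))
      /\
      (forall Q : R,
         (n.+1)%:R `^ (4^-1) <= Q
           <= ((n.+1)%:R - (n.+1)%:R `^ (2 / 3)) * mean f ->
         `| Ex P (fun w => shapley (X ^~ w) (argmin_agent (X ^~ w)) Q)
            - (n.+1)%:R^-1 * Ex P (fun w => let x := X (argmin_agent (X ^~ w)) w in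
                                            x / cond_mean_ge f x) |
         <= K * xi `^ ((n.+1)%:R `^ (4^-1))) ].
Proof.
move=> eps eps_gt0.
have [mf f_ge0 f1 f_neg] := hf.
have [C [lam [C_gt0 lam_gt0 f_le]]] := hi.
have [C' [eps0 [C'_gt0 eps0_gt0 hC']]] := hiii.
have [r1 [K1 [r10 K10 rate_max]]] :=
  game_max_rate mf f_ge0 f1 f_neg C_gt0 lam_gt0 f_le hii C'_gt0 eps0_gt0 hC' eps_gt0.
have [r2 [K2 [r20 K20 rate_min]]] :=
  game_min_rate mf f_ge0 f1 f_neg C_gt0 lam_gt0 f_le hii.
pose r := Num.min r1 r2.
have r0 : 0 < r by rewrite lt_min r10.
(* [y] is the size of the Chernoff exponent: [n + 1] for the maximum, its cube root for the minimum.
   Both dominate the fourth root, as [Q] does by hypothesis, so each of the two exponentials is at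
   most [xi] to that power. *)
have bound (K' r' : R) (n : nat) Q y : 0 <= K' -> K' <= K1 + K2 -> r <= r' ->
    n.+1%:R `^ 4^-1 <= Q -> n.+1%:R `^ 4^-1 <= y ->
    K' * (expR (- (r' * Q)) + expR (- (r' * y))) <=
    2 * (K1 + K2) * expR (- r) `^ (n.+1%:R `^ 4^-1).
  move=> K'0 K'K rr' zQ zy; rewrite -expRM (mulrC 2) -mulrA.
  have z0 : 0 <= n.+1%:R `^ 4^-1 :> R := powR_ge0 _ _.
  have e v : n.+1%:R `^ 4^-1 <= v -> expR (- (r' * v)) <= expR (- r * n.+1%:R `^ 4^-1).
    by move=> zv; rewrite ler_expR mulNr lerN2 ler_pM// ltW.
  apply: ler_pM => //.
  by rewrite [leRHS]mulr_natl mulr2n; apply: lerD; exact: e.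
exists (expR (- r)), (2 * (K1 + K2)); split.
- by rewrite expR_gt0 expR_lt1 oppr_lt0.
- by rewrite mulr_ge0// addr_ge0.
move=> n d T P X iid.
have N1 : 1 <= n.+1%:R :> R by rewrite ler1n.
have z1 : 1 <= n.+1%:R `^ 4^-1 :> R by rewrite -[leLHS](powRr0 n.+1%:R) ler_powR// invr_ge0.
split=> Q /andP[zQ Qle]; have Q0 : 0 < Q by rewrite (lt_le_trans ltr01)// (le_trans z1).
  apply: le_trans (rate_max n d T P X iid Q Q0 Qle) _.
  apply: bound => //; [by rewrite lerDl|by rewrite ge_min lexx|].
  by rewrite -[leRHS]powRr1// ler_powR// invf_le1// ler1n.
apply: le_trans (rate_min n d T P X iid Q Q0 Qle) _.
apply: bound => //; [by rewrite lerDr|by rewrite ge_min lexx orbT|].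
by rewrite ler_powR// lef_pV2 ?posrE// ler_nat.
Qed.
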